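(* Let $\mathbb{K}=\mathbb{R}$ or $\mathbb{C}$, let $A_1,\dots,A_m$ be symmetric (if $\mathbb{K}=\mathbb{R}$) or hermitian (if $\mathbb{K}=\mathbb{C}$) $n\times n$ matrices and $v_1,\dots,v_m\in\mathbb{K}^n$. Let $f_i(x)=x^*A_ix-v_i^*x-x^*v_i$ and let $$\mathcal{F}(A,v)=\{y\in\mathbb{R}^m:\ \exists\, x\in\mathbb{K}^n,\ |x|^2=1,\ y_i=f_i(x)\text{ for } i=1,\dots,m\}$$ be the inhomogeneous joint numerical range. Suppose that $$\lim_{\epsilon\to0^+}\ \min_{c\in\mathbb{R}^m,\ |c|^2=1}\left|\left(c\cdot A-\lambda_{\min}(c\cdot A)+\epsilon\right)^{-1}c\cdot v\right|>1 .$$ If $n>m$ in the real case ($2n>m$ in the complex case), then $\mathcal{F}(A,v)$ is strongly convex and smooth. If $n=m$ in the real case ($2n=m$ in the complex case), then $\mathcal{F}(A,v)$ is an ''empty shell'': $\mathcal{F}(A,v)=\partial\,{\rm Conv}[\mathcal{F}(A,v)]$, where ${\rm Conv}$ denotes the convex hull.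
   Context: $x^*$ denotes the transpose (real case) or hermitian conjugate (complex case). For $c=(c^1,\dots,c^m)\in\mathbb{R}^m$: $c\cdot A=\sum_i c^iA_i$, $c\cdot v=\sum_i c^iv_i$. $\lambda_{\min}(A)$ is the smallest eigenvalue of a symmetric (hermitian) matrix $A$. The sum of a matrix and a number means the number is multiplied by the $n\times n$ identity matrix. $|\cdot|$ is the Euclidean norm. The limit is allowed to be $+\infty$. A compact set is strictly convex if it is convex and each supporting hyperplane touches it at exactly one point; smooth means that its boundary is a smoothly embedded hypersurface in $\mathbb{R}^m$; strongly convex means that, in addition to strict convexity, the second derivative (Hessian) of the boundary relative to the supporting hyperplane is strictly positive definite at every boundary point. *)

(* Defs.v *)
From HB Require Import structures.
From mathcomp Require Import all_boot all_order all_algebra.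
From mathcomp Require Import complex.
From mathcomp Require Import all_classical all_reals all_analysis.

Set Implicit Arguments.
Unset Strict Implicit.
Unset Printing Implicit Defensive.

Import Order.TTheory GRing.Theory Num.Theory.
Import numFieldNormedType.Exports.

Local Open Scope classical_set_scope.
Local Open Scope ring_scope.

Variant scalar_kind := RealScalars | ComplexScalars.

Definition scalar_field (R : realType) (k : scalar_kind) : numFieldType :=
  match k with RealScalars => R | ComplexScalars => R[i] end.

Definition scalar_dim (k : scalar_kind) : nat :=
  match k with RealScalars => 1 | ComplexScalars => 2 end.

Definition of_real (R : realType) (k : scalar_kind) : R -> scalar_field R k :=
  match k with RealScalars => fun r => r | ComplexScalars => fun r => r%:C%C end.

Definition sconj (R : realType) (k : scalar_kind) :
    scalar_field R k -> scalar_field R k :=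
  match k with RealScalars => fun x => x | ComplexScalars => fun z => z^*%C end.

Definition modulus (R : realType) (k : scalar_kind) : scalar_field R k -> R :=
  match k with
  | RealScalars => fun x => `|x|
  | ComplexScalars => fun z => complex.Re `|z|
  end.

Section NumericalRange.
Variables (R : realType) (k : scalar_kind) (m n : nat).
Local Notation K := (scalar_field R k).

Definition adjoint p q (M : 'M[K]_(p, q)) : 'M[K]_(q, p) :=
  (map_mx (@sconj R k) M)^T.

Definition enorm (x : 'cV[K]_n) : R :=
  Num.sqrt (\sum_i modulus (x i 0) ^+ 2).

(* The spectrum of a hermitian matrix of positive size is a nonempty finite
   set of reals, so this infimum is the smallest eigenvalue. *)
Definition lambda_min (B : 'M[K]_n) : R :=
  inf [set r : R | eigenvalue B (of_real k r)].

Variables (A : 'I_m -> 'M[K]_n) (v : 'I_m -> 'cV[K]_n).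

Definition comb_mx (c : 'rV[R]_m) : 'M[K]_n :=
  \sum_i of_real k (c 0 i) *: A i.

Definition comb_vec (c : 'rV[R]_m) : 'cV[K]_n :=
  \sum_i of_real k (c 0 i) *: v i.

Definition quad (i : 'I_m) (x : 'cV[K]_n) : K :=
  (adjoint x *m A i *m x - adjoint (v i) *m x - adjoint x *m v i) 0 0.

Definition joint_range : set 'rV[R]_m :=
  [set y | exists x : 'cV[K]_n,
     enorm x ^+ 2 = 1 /\ forall i, of_real k (y 0 i) = quad i x].

Definition dot (c d : 'rV[R]_m) : R := \sum_i c 0 i * d 0 i.

Definition resolvent_norm (e : R) (c : 'rV[R]_m) : R :=
  enorm (invmx (comb_mx c + (of_real k (e - lambda_min (comb_mx c)))%:M)
         *m comb_vec c).

(* For hermitian A_i, 0 < m and 0 < e the function minimized is continuous on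
   the nonempty compact unit sphere, so the infimum is a minimum. *)
Definition min_resolvent_norm (e : R) : R :=
  inf [set resolvent_norm e c | c in [set c | dot c c = 1]].

End NumericalRange.

Section ConvexGeometry.
Variables (R : realType) (m : nat).
Local Notation V := 'rV[R]_m.

Definition frontier (S : set V) : set V := closure S `\` S°.

Definition conv_hull (S : set V) : set V :=
  smallest (fun C : set V => @convex_set R V C) S.

(* The hyperplane through p orthogonal to the unit vector c supports S, and S
   lies on the side into which c points. *)
Definition supports (S : set V) (c p : V) : Prop :=
  [/\ dot c c = 1, S p & forall y, S y -> dot c p <= dot c y].

Definition strictly_convex (S : set V) : Prop :=
  [/\ compact S, @convex_set R V S &
   forall c p, supports S c p -> S `&` [set y | dot c y = dot c p] = [set p]].

(* C^oo on an open set: all iterated directional derivatives exist and are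
   differentiable there. *)
Definition smooth_on (U : set V) (g : V -> R) : Prop :=
  forall (ws : seq V) (x : V), U x ->
    differentiable (foldr (fun w h => 'D_w h) g ws) x.

(* Near each of its points H is the regular zero set of a C^oo function. *)
Definition smooth_hypersurface (H : set V) : Prop :=
  forall p, H p -> exists (U : set V) (g : V -> R),
    [/\ open U, U p, smooth_on U g, exists w, 'D_w g p != 0 &
        H `&` U = [set x | g x = 0] `&` U].

Definition smooth_boundary (S : set V) : Prop :=
  smooth_hypersurface (frontier S).

Definition twice_differentiable_at0 (h : V -> R) : Prop :=
  (\forall x \near (0 : V), differentiable h x) /\
  (forall u, differentiable ('D_u h) (0 : V)).

(* Near p the boundary is the graph, over the supporting hyperplane
   { p + u | dot c u = 0 } and in the direction c, of a function h whose second
   derivative at the contact point is positive definite.  Only the restriction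
   of h to the hyperplane c^\perp matters.  Every boundary point of a compact
   convex set has a supporting hyperplane, so all boundary points are covered. *)
Definition strongly_convex (S : set V) : Prop :=
  strictly_convex S /\
  forall c p, supports S c p ->
    exists (U : set V) (h : V -> R),
      [/\ open U, U p, twice_differentiable_at0 h,
          frontier S `&` U =
            [set p + u + h u *: c | u in [set u | dot c u = 0]] `&` U &
          forall u, dot c u = 0 -> u != 0 -> 0 < 'D_u ('D_u h) (0 : V)].

End ConvexGeometry.

(* Main.v *)
(* Identify K^n with R^N.  For c != 0 the hypothesis makes c . f attain its
   minimum over the unit sphere at a single point X(c): X(c) solves
   (c . A + mu) x = c . v, |x| = 1, with c . A + mu >= e0 |c| > 0.  Let B be the
   convex body { y | c . y >= c . f(X(c)) for all c }; its supporting hyperplane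
   with inner normal c touches it only at f(X(c)).

   If N > m, pick q != 0 orthogonal to all v_i.  Coning X from q extends X to a
   nowhere zero map E on the ball.  For y interior to B, the field
   c |-> y - f(E(c)/|E(c)|) points outwards on the boundary of the ball, hence
   vanishes somewhere (no-retraction theorem), so y belongs to the range, which
   is therefore B.  If N = m, X is onto the sphere, because at a maximum of
   z . X(c) the differential of X has full rank; so the range is the boundary
   of B, and B is its convex hull.

   Near a boundary point, y = f(x) + s c0 together with the equations of X(c),
   normalised by c . c0 = 1, is a quadratic system in (c, mu, x, s) with
   invertible Jacobian.  Its solution s(y) is a smooth defining function of the
   boundary, with gradient c, and its second derivative along the boundary is
   - 2 (c . A + mu)[dx, dx] < 0. *)
Require Import Defs.
From HB Require Import structures.
From mathcomp Require Import all_boot all_order all_algebra all_fingroup.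
From mathcomp Require Import complex.
From mathcomp Require Import all_classical all_reals all_analysis.
From mathcomp Require Import zify ring lra.

Set Implicit Arguments.
Unset Strict Implicit.
Unset Printing Implicit Defensive.

Import Order.TTheory GRing.Theory Num.Theory.
Import numFieldNormedType.Exports.

Local Open Scope ring_scope.

(** * No retraction of the cube onto a sphere *)

(** The hypothesis is used at a single value [e0] of epsilon. For a unit c the resolvent vector is
    longer than 1; enlarging the shift brings its length down to exactly 1 and keeps c . A + mu at
    least [e0]. So the stationary points, although taken on a nonconvex sphere, come with a positive
    definite multiplier, and the increment of c . f between points of the sphere is exactly the
    value of c . A + mu on their difference. The delicate point is that a boundary point determines
    its normal, as otherwise the boundary could have corners. Positive definiteness of a pencil with
    a unit solution improves by itself to the bound [e0] |c|, so it cannot be lost along a line of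
    pencils sharing one solution x; since no nontrivial line stays positive at both ends, the pair
    (c, mu) is unique up to scaling. This is what makes the Jacobian invertible; the unknown s makes
    the system square, and c . c0 = 1 removes the scaling. Lipschitz constants replace continuity
    throughout, because the retraction is refuted by volumes on a grid, where a modulus of
    continuity without a rate would not make the simplices small enough. *)

Section KuhnTriangulation.
Variables (R : realFieldType) (d n : nat).
Local Notation m := d.+1.
Local Notation cell := {ffun 'I_m -> 'I_n.+1}.
Local Notation point := {ffun 'I_m -> nat}.

(* Kuhn's triangulation: the cell with lower corner [x] is cut into the simplices
   obtained by increasing the coordinates one after the other, in the order [t]. *)
Definition vtx (x : cell) (t : 'S_m) (j : nat) : point :=
  [ffun a => (x a + (t a < j))%N].

Lemma vtx_le (x : cell) (t : 'S_m) j b : (vtx x t j b <= n.+1)%N.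
Proof. by rewrite ffunE; have := ltn_ord (x b); case: (t b < j)%N; lia. Qed.

Variable phi : point -> 'rV[R]_m.

Definition facet (x : cell) (t : 'S_m) (i : 'I_m.+1) : 'M[R]_m :=
  \matrix_(j, k) phi (vtx x t (lift i j)) 0 k.

Definition simplex_mx (x : cell) (t : 'S_m) : 'M[R]_(1 + m) :=
  row_mx (const_mx 1) (\matrix_(j < 1 + m, k < m) phi (vtx x t j) 0 k).

(** Expansion along the column of ones. Up to a common factor, the oriented volume of a simplex is
    the signed sum of the volumes of the cones from the origin over its facets: a discrete Stokes
    formula. *)
Lemma det_simplex_facets x t :
  \det (simplex_mx x t) = \sum_(i < m.+1) (-1) ^+ i * \det (facet x t i).
Proof.
rewrite (expand_det_col _ (lshift m ord0)); apply: eq_bigr => i _.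
rewrite /simplex_mx row_mxEl mxE mul1r /cofactor addn0; congr (_ * \det _).
by apply/matrixP => j k; rewrite col'Kl thinmx0 row_thin_mx !mxE.
Qed.

(** Without vertex [i] the order in which the coordinates of ranks [i - 1] and [i] are raised is no
    longer visible. Exchanging them is an odd involution that fixes the facet, so the sum equals its
    own opposite. *)
Lemma sum_inner_facets x (i : 'I_m.+1) : (0 < i)%N -> (i < m)%N ->
  \sum_(t : 'S_m) (-1) ^+ t * \det (facet x t i) = 0.
Proof.
move=> i0 im; pose a : 'I_m := Ordinal (leq_ltn_trans (leq_pred i) im).
pose b : 'I_m := Ordinal im.
have ab : a != b by rewrite -val_eqE /=; lia.
set S := LHS; suff : S = - S by lra.
rewrite {1}/S (reindex_inj (mulIg (tperm a b))) /S -sumrN /=.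
apply: eq_bigr => t _; rewrite odd_permM odd_tperm ab addbT signrN mulNr; congr (- (_ * \det _)).
apply/matrixP => j k; rewrite !mxE; congr (phi _ 0 k).
apply/ffunP => c; rewrite !ffunE permM; congr (_ + nat_of_bool _)%N.
case: tpermP => [->|->|//] /=; rewrite /bump; lia.
Qed.

Local Notation shift_perm := (lift_perm ord0 ord_max 1 : 'S_m).

Lemma shift_permE (b : 'I_m) : shift_perm b = (if b == 0 :> nat then d else b.-1) :> nat.
Proof.
have [j ->|->] := unliftP ord0 b; last by rewrite lift_perm_id.
by rewrite lift_perm_lift perm1 lift_max lift0.
Qed.

(* The first and the last facet of a simplex lie in the neighbouring cells. *)
Let step_out (p : cell * 'S_m) : cell * 'S_m :=
  ([ffun a => inord (p.1 a + (p.2 a == ord0))], (p.2 * shift_perm)%g).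
Let step_in (p : cell * 'S_m) : cell * 'S_m :=
  ([ffun a => inord (p.1 a - (p.2 a == ord_max))], (p.2 * shift_perm^-1)%g).

(** [upper]: the facet without the lower corner lies on the boundary of the cube, the coordinate
    raised first being already in the last cell. [lower]: the same for the facet without the upper
    corner. *)
Let upper (p : cell * 'S_m) := p.1 ((p.2^-1)%g ord0) == ord_max.
Let lower (p : cell * 'S_m) := p.1 ((p.2^-1)%g ord_max) == ord0.

Lemma shift_perm_eq0 (b : 'I_m) : (shift_perm b == ord_max) = (b == ord0).
Proof.
by rewrite -[X in _ == X](lift_perm_id ord0 ord_max (1 : 'S_d)) (inj_eq perm_inj).
Qed.

Lemma shift_permV_eq_max (b : 'I_m) : ((shift_perm^-1)%g b == ord0) = (b == ord_max).
Proof. by rewrite -shift_perm_eq0 permKV. Qed.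

(** The facet without the lower corner is shared with the simplex one cell further in the coordinate
    raised first, which raises that coordinate last. The rotation of the order has sign (-1)^d;
    against the factor (-1)^m this leaves the minus sign. *)
Lemma sum_outer_facets :
  \sum_(p | ~~ upper p) (-1) ^+ p.2 * \det (facet p.1 p.2 ord0) =
  - \sum_(p | ~~ lower p) (-1) ^+ p.2 * ((-1) ^+ m * \det (facet p.1 p.2 ord_max)).
Proof.
rewrite [in RHS](reindex_onto step_out step_in) /=; last first.
  case=> x t; rewrite /lower /= => xP.
  congr pair; last by rewrite mulgKV.
  apply/ffunP => a; rewrite !ffunE /= permM /= shift_permV_eq_max.
  have xa := ltn_ord (x a); set b := t a == ord_max.
  have bx : (b <= x a)%N.
    rewrite /b; have [taE|//] := eqVneq (t a) ord_max.
    by move: xP; rewrite -taE permK -val_eqE /= lt0n.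
  have xb : (x a - b < n.+1)%N by rewrite (leq_ltn_trans (leq_subr _ _)).
  by apply: val_inj; rewrite /= inordK inordK // subnK.
rewrite -sumrN; apply: eq_big => [[x t]|[x t] xP].
  rewrite /upper /lower /step_out /step_in /= invMg permM.
  have -> : (shift_perm^-1)%g ord_max = ord0.
    by apply/eqP; rewrite shift_permV_eq_max.
  set a := (t^-1)%g ord0; have ta : t a = ord0 by rewrite permKV.
  rewrite ffunE ta eqxx addn1.
  have [xm|xm] := eqVneq (x a) ord_max.
    (* The shifted coordinate overflows and [inord] falls back to [ord0], so [step_out] yields a
       [lower] simplex and both conditions fail together. *)
    rewrite xm /= /inord /insubd insubF ?ltnn //=.
  have xa : (x a < n)%N.
    by rewrite ltn_neqAle -ltnS ltn_ord andbT.
  rewrite -val_eqE /= inordK //=; symmetry; apply/eqP; congr pair; last by rewrite mulgK.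
  apply/ffunP => b; rewrite !ffunE permM shift_perm_eq0; apply: val_inj => /=.
  have xb : (x b + (t b == ord0) < n.+1)%N.
    have [tb|_] := eqVneq (t b) ord0; last by rewrite addn0.
    by rewrite addn1 ltnS /a -tb permK in xa *.
  by rewrite inordK inordK ?addnK.
move: xP; rewrite /upper /= => xm.
set a := (t^-1)%g ord0; have ta : t a = ord0 by rewrite permKV.
have xa : (x a < n)%N.
  by rewrite ltn_neqAle -ltnS ltn_ord andbT.
have -> : facet [ffun a => inord (x a + (t a == ord0))] (t * shift_perm) ord_max =
          facet x t ord0.
  apply/matrixP => j k; rewrite !mxE; congr (phi _ 0 k); apply/ffunP => b.
  rewrite !ffunE permM shift_permE lift_max lift0 /=.
  have [tb|tb] := eqVneq (t b) ord0.
    have -> : b = a by rewrite /a -tb permK.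
    by rewrite ta /= addn1 inordK ?ltnS //= ltnNge -ltnS ltn_ord addn0.
  rewrite addn0 inord_val; congr (_ + nat_of_bool _)%N.
  move: tb; rewrite -val_eqE /= => tb; rewrite (negPf tb) -ltnS prednK ?lt0n //.
rewrite odd_permM odd_lift_perm odd_perm1 addbF /= signr_addb signr_odd exprS.
rewrite mulN1r mulNr mulrN opprK -[RHS]mulrA; congr (_ * _).
by rewrite mulrA -expr2 sqrr_sign mul1r.
Qed.

Lemma degree_boundary :
  \sum_(p : cell * 'S_m) (-1) ^+ p.2 * \det (simplex_mx p.1 p.2) =
  \sum_(p | upper p) (-1) ^+ p.2 * \det (facet p.1 p.2 ord0) +
  \sum_(p | lower p) (-1) ^+ p.2 * ((-1) ^+ m * \det (facet p.1 p.2 ord_max)).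
Proof.
under eq_bigr => p _.
  rewrite det_simplex_facets big_ord_recl expr0 mul1r big_ord_recr /= mulrDr.
  rewrite (_ : lift ord0 ord_max = ord_max); last exact: val_inj.
  rewrite mulrDr; over.
rewrite !big_split /= (bigID upper) /= sum_outer_facets.
have -> : \sum_(p : cell * 'S_m) (-1) ^+ p.2 * (\sum_(i < d)
    (-1) ^+ bump 0 i * \det (facet p.1 p.2 (lift ord0 (widen_ord (leqnSn d) i)))) = 0.
  under eq_bigr => p _ do rewrite mulr_sumr.
  rewrite exchange_big big1 //= => i _.
  rewrite -(pair_big xpredT xpredT (fun (x : cell) (t : 'S_m) => (-1) ^+ t * ((-1) ^+ bump 0 i *
    \det (facet x t (lift ord0 (widen_ord (leqnSn d) i)))))) /=.
  rewrite big1 // => x _; under eq_bigr => t _ do rewrite mulrCA.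
  by rewrite -mulr_sumr sum_inner_facets ?mulr0 // lift0 ltnS /=.
rewrite add0r [X in _ + X = _](bigID lower) /= (_ : bump 0 d = m) //.
by rewrite [X in _ + X]addrC addrA subrK.
Qed.

(** A crude count is enough: one face of the cube and one order of the coordinates. *)
Lemma card_upper : (n.+1 ^ d <= #|upper|)%N.
Proof.
pose ext (g : {ffun 'I_d -> 'I_n.+1}) : cell * 'S_m :=
  ([ffun a => oapp g ord_max (unlift ord0 a)], 1%g).
have ext_inj : injective ext.
  move=> g g' [] /ffunP gg'; apply/ffunP => b.
  by have := gg' (lift ord0 b); rewrite !ffunE liftK.
rewrite -[X in (X ^ _)%N]card_ord -[X in (_ ^ X)%N]card_ord -card_ffun.
rewrite -(card_imset _ ext_inj) subset_leq_card //.
apply/fintype.subsetP => _ /imsetP [g _ ->].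
by rewrite unfold_in /= /upper /= invg1 perm1 ffunE unlift_none.
Qed.

End KuhnTriangulation.

(** Subtracting row 0 from the others leaves a triangular block with 2 on the diagonal. The boundary
    facets of the identity map have this form once their columns are sorted by rank. *)
Lemma det_stair (R : realFieldType) d (z : 'I_(1 + d) -> R) :
  \det (\matrix_(j < 1 + d, b < 1 + d)
    (z b + (2 * ((0 < b) && (b <= j))%N%:R))) = z ord0 * 2 ^+ d.
Proof.
pose S : 'M[R]_d := \matrix_(i, j) (2 * (j <= i)%N%:R).
rewrite (_ : \matrix_(_, _) _ =
   block_mx 1%:M 0 (const_mx 1) 1%:M *m
   block_mx (const_mx (z ord0)) (\row_j z (rshift 1 j)) 0 S).
  rewrite det_mulmx det_lblock det_ublock !det1 !mul1r det_mx11 mxE.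
  congr (_ * _); rewrite det_trig; last first.
    by apply/is_trig_mxP => i j ij; rewrite mxE leqNgt ij mulr0.
  rewrite -[in RHS](card_ord d) -prodr_const; apply: eq_bigr => i _.
  by rewrite mxE leqnn mulr1.
rewrite mulmx_block !mul1mx !mul0mx !addr0; apply/matrixP => i j.
have -> : (const_mx 1 : 'cV[R]_d) *m (const_mx (z ord0) : 'M[R]_1) = const_mx (z ord0).
  by apply/matrixP => a b; rewrite !mxE big_ord1 !mxE mul1r.
case: (split_ordP i) => i' ->; case: (split_ordP j) => j' ->.
- rewrite block_mxEul !mxE !ord1 /= mulr0 addr0; congr z; exact: val_inj.
- by rewrite block_mxEur !mxE !ord1 /= mulr0 addr0.
- rewrite block_mxEdl !mxE !ord1 /= mulr0 addr0; congr z; exact: val_inj.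
- by rewrite block_mxEdr !mxE big_ord1 !mxE mul1r.
Qed.

Section IdentityFacets.
Variables (R : realFieldType) (d n : nat).
Local Notation m := d.+1.
Local Notation cell := {ffun 'I_m -> 'I_n.+1}.
Local Notation point := {ffun 'I_m -> nat}.

(* Grid points are recentred so that the cube is [-(n+1), n+1]^m. *)
Definition centred (v : point) : 'rV[R]_m :=
  \row_a (2 * (v a)%:R - n.+1%:R).

(** Sorting the columns by [t] absorbs the sign. All boundary facets of the identity contribute the
    same positive amount, so nothing cancels in its degree. *)
Lemma det_facet_upper (x : cell) (t : 'S_m) : x ((t^-1)%g ord0) = ord_max ->
  (-1) ^+ t * \det (facet centred x t ord0) = n.+1%:R * 2 ^+ d.
Proof.
move=> xm; rewrite -det_perm mulrC -det_mulmx -[X in perm_mx X]invgK -col_permE.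
have <- : (centred (vtx x t 1)) 0 ((t^-1)%g ord0) = n.+1%:R.
  rewrite mxE ffunE permKV xm /= addn1; ring.
rewrite -(@det_stair _ d (fun b => centred (vtx x t 1) 0 ((t^-1)%g b))).
congr (\det _); apply/matrixP => j b; rewrite !mxE !ffunE permKV lift0.
rewrite !natrD; case: b => [[|b] bd] /=; first by ring.
by rewrite ltnS; ring.
Qed.

Lemma det_facet_lower (x : cell) (t : 'S_m) : x ((t^-1)%g ord_max) = ord0 ->
  (-1) ^+ t * ((-1) ^+ m * \det (facet centred x t ord_max)) = n.+1%:R * 2 ^+ d.
Proof.
(* The rotation moves the coordinate of last rank to column 0, as [det_stair] requires. Its sign
   (-1)^d turns (-1)^m into -1, which the entry -(n+1) on this face compensates. *)
move=> xm; pose s : 'S_m := lift_perm ord0 ord_max 1%g.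
have -> : (-1) ^+ t * ((-1) ^+ m * \det (facet centred x t ord_max)) =
    - ((-1) ^+ (t * s^-1)%g * \det (facet centred x t ord_max)).
  rewrite odd_permM odd_permV odd_lift_perm odd_perm1 addbF /= signr_addb.
  by rewrite signr_odd exprS mulN1r mulNr mulrN !mulrA.
rewrite -det_perm mulrC -det_mulmx -[X in perm_mx X]invgK -col_permE invMg invgK.
have <- : - (centred (vtx x t 0)) 0 ((t^-1)%g ord_max) = n.+1%:R.
  by rewrite mxE ffunE permKV xm /= addn0; ring.
rewrite mulNr; congr (- _).
have <- : (s * t^-1)%g ord0 = (t^-1)%g ord_max by rewrite permM lift_perm_id.
rewrite -(@det_stair _ d (fun b => centred (vtx x t 0) 0 ((s * t^-1)%g b))).
congr (\det _); apply/matrixP => j b; rewrite !mxE !ffunE lift_max permM permKV.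
rewrite !natrD; have [b' ->|->] := unliftP ord0 b.
  by rewrite lift_perm_lift perm1 lift_max lift0 /=; ring.
by rewrite lift_perm_id /= ltnNge -ltnS ltn_ord /=; ring.
Qed.

End IdentityFacets.

Section DegreeBounds.
Variables (R : realFieldType) (d n : nat).
Local Notation m := d.+1.
Local Notation cell := {ffun 'I_m -> 'I_n.+1}.
Local Notation point := {ffun 'I_m -> nat}.
Variables (phi : point -> 'rV[R]_m).

Lemma facet_scale (w : point -> R) (x : cell) (t : 'S_m) (i : 'I_m.+1) :
  (forall j : 'I_m, phi (vtx x t (lift i j)) =
     w (vtx x t (lift i j)) *: centred R n (vtx x t (lift i j))) ->
  \det (facet phi x t i) =
  (\prod_(j < m) w (vtx x t (lift i j))) * \det (facet (@centred R d n) x t i).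
Proof.
move=> phiE; pose D := diag_mx (\row_(j < m) w (vtx x t (lift i j))).
have -> : facet phi x t i = D *m facet (@centred R d n) x t i.
  by apply/matrixP => j k; rewrite mul_diag_mx !mxE phiE !mxE.
by rewrite det_mulmx det_diag; congr (_ * _); apply: eq_bigr => j _; rewrite mxE.
Qed.

(** On the boundary [phi] is radial with factor at least [w0], so every boundary facet contributes a
    nonnegative amount. The lower facets are discarded and the upper ones counted by
    [card_upper]. *)
Lemma degree_lower (w : point -> R) (w0 : R) : 0 <= w0 ->
  (forall (v : point) a, (forall b, (v b <= n.+1)%N) ->
    (v a == 0%N) || (v a == n.+1) -> w0 <= w v /\ phi v = w v *: centred R n v) ->
  w0 ^+ m * (n.+1%:R * 2 ^+ d) * n.+1%:R ^+ d <=
  \sum_(p : cell * 'S_m) (-1) ^+ p.2 * \det (simplex_mx phi p.1 p.2).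
Proof.
move=> w0_ge0 phiE.
pose Q : R := w0 ^+ m * (n.+1%:R * 2 ^+ d).
have Q0 : 0 <= Q by rewrite !mulr_ge0 ?exprn_ge0 ?ler0n.
have prod_ge (F : 'I_m -> R) : (forall j, w0 <= F j) ->
    Q <= (\prod_(j < m) F j) * (n.+1%:R * 2 ^+ d).
  move=> F_ge; rewrite ler_wpM2r ?mulr_ge0 ?exprn_ge0 ?ler0n //.
  rewrite -[X in w0 ^+ X]card_ord -prodr_const; apply: ler_prod => j _.
  by rewrite w0_ge0 F_ge.
rewrite degree_boundary -[leLHS]addr0 lerD //; last first.
  apply: sumr_ge0 => -[x t] /= /eqP xt.
  pose a := (t^-1)%g ord_max.
  have va (j : 'I_m) : vtx x t (lift ord_max j) a == 0%N.
    by rewrite ffunE permKV xt lift_max add0n ltnNge -ltnS ltn_ord.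
  rewrite (facet_scale (w := w)); last first.
    by move=> j; apply: (phiE _ a (vtx_le _ _ _) _).2; rewrite va.
  rewrite mulrCA [X in _ * X]mulrCA mulrA [X in X * _]mulrC -mulrA.
  rewrite [X in _ * X]mulrCA (det_facet_lower R xt).
  apply: le_trans Q0 (prod_ge _ _) => j.
  by apply: (phiE _ a (vtx_le _ _ _) _).1; rewrite va.
apply: (@le_trans _ _ (\sum_(p : cell * 'S_m | p.1 ((p.2^-1)%g ord0) == ord_max) Q)).
  rewrite sumr_const -/Q -[leRHS]mulr_natr ler_wpM2l // -natrX ler_nat.
  exact: card_upper.
apply: ler_sum => -[x t] /= /eqP xt; pose a := (t^-1)%g ord0.
have va (j : 'I_m) : vtx x t (lift ord0 j) a == n.+1.
  by rewrite ffunE permKV xt lift0 addn1.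
rewrite (facet_scale (w := w)); last first.
  by move=> j; apply: (phiE _ a (vtx_le _ _ _) _).2; rewrite va orbT.
rewrite mulrCA (det_facet_upper R xt); apply: prod_ge => j.
by apply: (phiE _ a (vtx_le _ _ _) _).1; rewrite va orbT.
Qed.

Lemma degree_upper (B : R) :
  (forall (x : cell) (t : 'S_m), `|\det (simplex_mx phi x t)| <= B) ->
  \sum_(p : cell * 'S_m) (-1) ^+ p.2 * \det (simplex_mx phi p.1 p.2) <=
  n.+1%:R ^+ m * (m`!)%:R * B.
Proof.
move=> leB; apply: le_trans (ler_norm _) _; apply: le_trans (ler_norm_sum _ _ _) _.
apply: (@le_trans _ _ (\sum_(p : cell * 'S_m) B)).
  by apply: ler_sum => p _; rewrite normrM normrX normrN1 expr1n mul1r.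
by rewrite sumr_const -[leLHS]mulr_natl card_prod card_ffun !card_ord card_Sn natrM natrX.
Qed.

End DegreeBounds.

Lemma det_bound (R : realFieldType) n (M : 'M[R]_n) (e : R) :
  (forall i j, `|M i j| <= e) -> `|\det M| <= (n`!)%:R * e ^+ n.
Proof.
move=> Me; apply: le_trans (ler_norm_sum _ _ _) _.
apply: (@le_trans _ _ (\sum_(s : 'S_n) e ^+ n)).
  apply: ler_sum => s _; rewrite normrM normrX normrN1 expr1n mul1r normr_prod.
  rewrite -[X in e ^+ X]card_ord -prodr_const; apply: ler_prod => i _.
  by rewrite normr_ge0 Me.
by rewrite sumr_const card_Sn mulr_natl.
Qed.

(** For unit vectors (U_j - u) . u = - |U_j - u|^2 / 2, so the edge matrix W sends u to a vector of
    order e^2 instead of e. Writing det W = det W |u|^2 = u . adj W (W u) gives e^d from the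
    adjugate and e^2 from W u, one factor more than the generic e^(d+1). *)
Lemma det_sphere_simplex (R : realFieldType) d (U : 'M[R]_(1 + d.+1, d.+1)) (e : R) :
  (forall j, \sum_k U j k ^+ 2 = 1) -> (forall j k, `|U j k - U ord0 k| <= e) ->
  `|\det (row_mx (const_mx 1) U)| <= (d.+1 ^ 3 * d`!)%:R * e ^+ d.+2.
Proof.
set m := d.+1 => Usph Ue.
pose u : 'rV_m := row ord0 U.
pose W : 'M[R]_m := \matrix_(j, k) (U (rshift 1 j) k - u 0 k).
have e0 : 0 <= e by apply: le_trans (Ue ord0 ord0); rewrite normr_ge0.
have -> : \det (row_mx (const_mx 1) U) = \det W.
  have -> : row_mx (const_mx 1) U =
      block_mx 1%:M 0 (const_mx 1) 1%:M *m block_mx 1%:M u 0 W.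
    rewrite mulmx_block !mul1mx !mul0mx !addr0 mulmx1; apply/matrixP => i j.
    case: (split_ordP i) => i' ->; case: (split_ordP j) => j' ->.
    - by rewrite block_mxEul row_mxEl !mxE !ord1 eqxx.
    - by rewrite block_mxEur row_mxEr !mxE ord1; congr (U _ _); apply: val_inj.
    - by rewrite block_mxEdl row_mxEl !mxE.
    - by rewrite block_mxEdr row_mxEr !mxE big_ord1 !mxE mul1r addrC subrK.
  by rewrite det_mulmx det_lblock det_ublock !det1 !mul1r.
have u1 k : `|u 0 k| <= 1.
  rewrite -(@ler_pXn2r _ 2) ?nnegrE // expr1n -normrX ger0_norm ?sqr_ge0 //.
  by rewrite -(Usph ord0) (bigD1 k) //= mxE lerDl sumr_ge0 // => i _; rewrite sqr_ge0.
pose b : 'cV_m := W *m u^T.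
have b_le j : `|b j 0| <= m%:R * e ^+ 2.
  have -> : b j 0 = - 2^-1 * \sum_k (U (rshift 1 j) k - u 0 k) ^+ 2.
    have sumU : \sum_k U (rshift 1 j) k ^+ 2 = \sum_k u 0 k ^+ 2.
      by rewrite Usph -(Usph ord0); apply: eq_bigr => k _; rewrite mxE.
    suff : 2 * b j 0 = \sum_k U (rshift 1 j) k ^+ 2 - \sum_k u 0 k ^+ 2 -
        \sum_k (U (rshift 1 j) k - u 0 k) ^+ 2.
      by rewrite sumU subrr sub0r mulNr -mulrN => <-; field.
    by rewrite -!sumrB mxE mulr_sumr; apply: eq_bigr => k _; rewrite !mxE; ring.
  have S0 : 0 <= \sum_k (U (rshift 1 j) k - u 0 k) ^+ 2.
    by apply: sumr_ge0 => k _; rewrite sqr_ge0.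
  have h0 : 0 <= 2^-1 :> R by rewrite invr_ge0 ler0n.
  have h1 : 2^-1 <= 1 :> R by rewrite invf_le1 ?ler1n ?ltr0n.
  rewrite normrM normrN (ger0_norm h0) (ger0_norm S0).
  apply: le_trans (ler_piMl S0 h1) _.
  apply: (@le_trans _ _ (\sum_(k < m) e ^+ 2)); last first.
    by rewrite sumr_const card_ord mulr_natl.
  apply: ler_sum => k _; rewrite mxE -real_normK ?num_real //.
  by rewrite ler_pXn2r ?nnegrE.
have adj_le k l : `|(\adj W) k l| <= (d`!)%:R * e ^+ d.
  rewrite mxE /cofactor normrM normrX normrN1 expr1n mul1r.
  by apply: det_bound => i j; rewrite !mxE Ue.
have -> : \det W = \sum_(k < m) u 0 k * (\sum_(j < m) (\adj W) k j * b j 0).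
  transitivity (\sum_k u 0 k * (\det W * u 0 k)).
    transitivity (\det W * \sum_k u 0 k ^+ 2).
      rewrite -[LHS]mulr1 -(Usph ord0); congr (_ * _).
      by apply: eq_bigr => k _; rewrite mxE.
    by rewrite mulr_sumr; apply: eq_bigr => k _; ring.
  apply: eq_bigr => k _; congr (_ * _).
  have : (\adj W *m b) k 0 = (\det W *: u^T) k 0.
    by rewrite mulmxA mul_adj_mx mul_scalar_mx.
  by rewrite !mxE => <-.
apply: le_trans (ler_norm_sum _ _ _) _.
apply: (@le_trans _ _ (\sum_(k < m) \sum_(j < m) ((d`!)%:R * e ^+ d) * (m%:R * e ^+ 2))).
  apply: ler_sum => k _; rewrite normrM -[leRHS]mul1r.
  apply: ler_pM => //; apply: le_trans (ler_norm_sum _ _ _) _.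
  by apply: ler_sum => j _; rewrite normrM ler_pM.
rewrite !sumr_const !card_ord -mulrnA -[leLHS]mulr_natl [X in _ <= X * _]natrM.
by rewrite natrX natrM -[d.+2]addn2 exprD le_eqVlt; apply/orP; left; apply/eqP; ring.
Qed.

(* A piecewise linear degree: the signed sum of the simplex determinants depends only
   on the boundary values, where it is bounded below, whereas a Lipschitz map into the
   sphere makes each of the n^m determinants O(n^(-m-1)), since almost flat simplices
   with vertices on a sphere are thin in the radial direction. *)
Lemma no_retraction (R : archiRealFieldType) d (L : R)
    (psi : 'rV[R]_d.+1 -> 'rV[R]_d.+1) (w : 'rV[R]_d.+1 -> R) :
  (forall c : 'rV_d.+1, (forall a, `|c 0 a| <= 1) -> \sum_k psi c 0 k ^+ 2 = 1) ->
  (forall (c c' : 'rV_d.+1) e, (forall a, `|c 0 a| <= 1) -> (forall a, `|c' 0 a| <= 1) ->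
    (forall a, `|c 0 a - c' 0 a| <= e) ->
    forall k, `|psi c 0 k - psi c' 0 k| <= L * e) ->
  (forall c : 'rV_d.+1, (forall a, `|c 0 a| <= 1) -> (exists a, `|c 0 a| = 1) ->
    0 < w c /\ psi c = w c *: c) ->
  False.
Proof.
set m := d.+1 => sph lip bnd.
pose C : R := (m ^ 3 * d`!)%:R.
suff bound n : m%:R ^- m * 2 ^+ d * n.+1%:R <= (m`!)%:R * C * (L * 2) ^+ d.+2.
  pose q : R := m%:R ^- m * 2 ^+ d.
  have q0 : 0 < q by rewrite mulr_gt0 ?invr_gt0 ?exprn_gt0 ?ltr0n.
  pose K := (m`!)%:R * C * (L * 2) ^+ d.+2 / q.
  have K0 : 0 <= K.
    by rewrite divr_ge0 ?(ltW q0) // (le_trans _ (bound 0%N)) // mulr_ge0 ?(ltW q0).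
  have := archi_boundP K0; rewrite ltNge => /negP; apply.
  rewrite /K ler_pdivlMr // mulrC.
  apply: le_trans (bound _); rewrite ler_wpM2l ?(ltW q0) // ler_nat.
  exact: leqnSn.
pose N : R := n.+1%:R.
have N0 : 0 < N by rewrite ltr0n.
have cube (v : {ffun 'I_m -> nat}) : (forall b, (v b <= n.+1)%N) ->
    forall a, `|(N^-1 *: centred R n v) 0 a| <= 1.
  move=> vle a; rewrite !mxE normrM gtr0_norm ?invr_gt0 // mulrC ler_pdivrMr // mul1r.
  have va : (v a)%:R <= N by rewrite ler_nat.
  have va0 : 0 <= (v a)%:R :> R by rewrite ler0n.
  by rewrite ler_norml; apply/andP; split; rewrite -/N; lra.
pose phi v := psi (N^-1 *: centred R n v).
(* Since [psi c] has length 1 and |c|^2 <= m, one gets 1 <= m w^2 <= (m w)^2; the bound 1/m avoids a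
   square root. *)
have w_ge (c : 'rV_m) : (forall a, `|c 0 a| <= 1) -> (exists a, `|c 0 a| = 1) -> m%:R^-1 <= w c.
  move=> c1 c2; have [w0 psiE] := bnd c c1 c2; have := sph c c1.
  rewrite psiE => sum1.
  have m0 : 0 < m%:R :> R by rewrite ltr0n.
  rewrite -[leLHS]mul1r ler_pdivrMr //.
  rewrite -(@ler_pXn2r _ 2) ?nnegrE ?mulr_ge0 ?(ltW w0) ?ler0n // expr1n -[leLHS]sum1.
  apply: (@le_trans _ _ (\sum_(k < m) w c ^+ 2)).
    apply: ler_sum => k _; rewrite mxE exprMn ler_piMr ?sqr_ge0 //.
    by rewrite -real_normK ?num_real // expr_le1.
  rewrite sumr_const card_ord -[leLHS]mulr_natr exprMn ler_wpM2l ?sqr_ge0 //.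
  by rewrite expr2 ler_peMr ?ler1n ?ler0n.
have := @degree_lower R d n phi (fun v => w (N^-1 *: centred R n v) * N^-1)
  ((m%:R * N)^-1).
have w0_ge0 : 0 <= (m%:R * N)^-1 by rewrite invr_ge0 mulr_ge0 ?ler0n // ltW.
move=> /(_ w0_ge0) lower.
have upper : forall (x : {ffun 'I_m -> 'I_n.+1}) (t : 'S_m),
    `|\det (simplex_mx phi x t)| <= C * (L * (2 / N)) ^+ d.+2.
  move=> x t.
  apply: det_sphere_simplex => j.
    under eq_bigr => k _ do rewrite mxE.
    exact: sph (cube _ (vtx_le _ _ _)).
  move=> k; rewrite !mxE; apply: lip; try exact: cube (vtx_le _ _ _).
  move=> a; rewrite !mxE !ffunE -mulrBr normrM gtr0_norm ?invr_gt0 //.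
  rewrite mulrC ler_pdivrMr // divfK ?gt_eqF //.
  rewrite !natrD; case: (t a < j)%N; case: (t a < _)%N; rewrite ler_norml;
    apply/andP; split => /=; lra.
have bdry (v : {ffun 'I_m -> nat}) a : (forall b, (v b <= n.+1)%N) ->
    (v a == 0%N) || (v a == n.+1) ->
    (m%:R * N)^-1 <= w (N^-1 *: centred R n v) * N^-1 /\
    phi v = (w (N^-1 *: centred R n v) * N^-1) *: centred R n v.
  move=> vle va; have c1 := cube v vle.
  have c2 : exists a, `|(N^-1 *: centred R n v) 0 a| = 1.
    exists a; rewrite !mxE; case/orP: va => /eqP ->.
      by rewrite mulr0 sub0r mulrN mulVf ?gt_eqF // normrN normr1.
    rewrite (_ : 2 * n.+1%:R - n.+1%:R = N); last by rewrite /N; ring.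
    by rewrite mulVf ?gt_eqF // normr1.
  split; last by have [_] := bnd _ c1 c2; rewrite /phi => ->; rewrite scalerA.
  rewrite invfM; apply: ler_wpM2r (w_ge _ c1 c2).
  by rewrite invr_ge0 ltW.
have {lower} := le_trans (lower bdry) (degree_upper upper).
have N_neq0 : N != 0 by rewrite gt_eqF.
have -> : (m%:R * N)^-1 ^+ m * (n.+1%:R * 2 ^+ d) * n.+1%:R ^+ d = m%:R ^- m * 2 ^+ d.
  rewrite invfM exprMn !exprVn -/N -[RHS]mulr1 -(@mulVf _ (N ^+ m)) ?expf_neq0 //.
  by rewrite [N ^+ m]exprS; ring.
have -> : n.+1%:R ^+ m * (m`!)%:R * (C * (L * (2 / N)) ^+ d.+2) =
    (m`!)%:R * C * (L * 2) ^+ d.+2 / N.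
  rewrite -/N [L * (2 / N)]mulrA [(_ / N) ^+ _]exprMn exprVn [N ^+ d.+2]exprS -/m.
  rewrite invfM -[RHS]mulr1 -(@mulVf _ (N ^+ m)) ?expf_neq0 //.
  ring.
by rewrite ler_pdivlMr.
Qed.

Local Open Scope classical_set_scope.
Local Open Scope ring_scope.

(** * Euclidean geometry and bounded Lipschitz functions *)

Section Dot.
Variables (R : realType) (n : nat).
Implicit Types x y z : 'rV[R]_n.

Lemma dotC x y : dot x y = dot y x.
Proof. by apply: eq_bigr => i _; rewrite mulrC. Qed.

Lemma dotDl x y z : dot (x + y) z = dot x z + dot y z.
Proof. by rewrite /dot -big_split; apply: eq_bigr => i _; rewrite mxE mulrDl. Qed.

Lemma dotDr x y z : dot z (x + y) = dot z x + dot z y.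
Proof. by rewrite dotC dotDl !(dotC _ z). Qed.

Lemma dotZl (a : R) x y : dot (a *: x) y = a * dot x y.
Proof. by rewrite /dot mulr_sumr; apply: eq_bigr => i _; rewrite mxE mulrA. Qed.

Lemma dotZr (a : R) x y : dot x (a *: y) = a * dot x y.
Proof. by rewrite dotC dotZl dotC. Qed.

Lemma dotNl x y : dot (- x) y = - dot x y.
Proof. by rewrite -scaleN1r dotZl mulN1r. Qed.

Lemma dotNr x y : dot x (- y) = - dot x y.
Proof. by rewrite dotC dotNl dotC. Qed.

Lemma dot0l x : dot 0 x = 0.
Proof. by rewrite -(scale0r 0) dotZl mul0r. Qed.

Lemma dot0r x : dot x 0 = 0.
Proof. by rewrite dotC dot0l. Qed.

Lemma dotBl x y z : dot (x - y) z = dot x z - dot y z.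
Proof. by rewrite dotDl dotNl. Qed.

Lemma dotBr x y z : dot z (x - y) = dot z x - dot z y.
Proof. by rewrite dotDr dotNr. Qed.

Lemma dot_ge0 x : 0 <= dot x x.
Proof. by apply: sumr_ge0 => i _; rewrite -expr2 sqr_ge0. Qed.

Lemma dot_eq0 x : (dot x x == 0) = (x == 0).
Proof.
apply/eqP/eqP => [xx|->]; last exact: dot0l.
apply/rowP => i; rewrite mxE; apply/eqP; rewrite -sqrf_eq0 expr2.
have /eqP : dot x x = 0 by [].
rewrite /dot psumr_eq0 => [/allP /(_ i)|j _]; last by rewrite -expr2 sqr_ge0.
by rewrite mem_index_enum /= => /(_ isT).
Qed.

Lemma dot_gt0 x : x != 0 -> 0 < dot x x.
Proof. by move=> x0; rewrite lt_neqAle dot_ge0 eq_sym dot_eq0 x0. Qed.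

Lemma CauchySchwarz_dot x y : dot x y ^+ 2 <= dot x x * dot y y.
Proof.
have [->|y0] := eqVneq y 0; first by rewrite !dot0r expr0n /= mulr0.
have := dot_ge0 (dot y y *: x - dot x y *: y).
have -> : dot (dot y y *: x - dot x y *: y) (dot y y *: x - dot x y *: y) =
    dot y y * (dot x x * dot y y - dot x y ^+ 2).
  by rewrite !(dotBl, dotBr, dotZl, dotZr) (dotC y x); ring.
by rewrite pmulr_rge0 ?dot_gt0 // subr_ge0.
Qed.

(** The Euclidean norm. On row vectors the built-in norm is the maximum norm, which carries the
    topology; the two are compared in [norm_le_nrm] and [nrm_le_norm]. *)
Definition nrm x : R := Num.sqrt (dot x x).

Lemma nrm_ge0 x : 0 <= nrm x. Proof. exact: sqrtr_ge0. Qed.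

Lemma nrm_sqr x : nrm x ^+ 2 = dot x x.
Proof. by rewrite sqr_sqrtr ?dot_ge0. Qed.

Lemma nrm_eq0 x : (nrm x == 0) = (x == 0).
Proof. by rewrite -sqrf_eq0 nrm_sqr dot_eq0. Qed.

Lemma nrm_gt0 x : x != 0 -> 0 < nrm x.
Proof. by move=> x0; rewrite lt_neqAle nrm_ge0 eq_sym nrm_eq0 x0. Qed.

Lemma nrmZ (a : R) x : nrm (a *: x) = `|a| * nrm x.
Proof. by rewrite /nrm dotZl dotZr mulrA -expr2 sqrtrM ?sqr_ge0 // sqrtr_sqr. Qed.

Lemma normr_dot_le x y : `|dot x y| <= nrm x * nrm y.
Proof.
rewrite -(@ler_pXn2r _ 2) ?nnegrE ?mulr_ge0 ?nrm_ge0 ?normr_ge0 //.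
by rewrite exprMn !nrm_sqr -normrX ger0_norm ?sqr_ge0 ?CauchySchwarz_dot.
Qed.

Lemma dot_le_nrm x y : dot x y <= nrm x * nrm y.
Proof. exact: le_trans (ler_norm _) (normr_dot_le _ _). Qed.

Lemma rV_norm_le x (r : R) : 0 <= r -> (`|x| <= r) <-> (forall a, `|x 0 a| <= r).
Proof.
move=> r0; rewrite [X in X <= _ <-> _](_ : _ = mx_norm x) // mx_normrE; split => [/bigmax_leP[_ h] a|h].
  exact: (h (0, a)).
by apply/bigmax_leP; split => // -[i a] _; rewrite ord1.
Qed.

Lemma coord_le_norm x a : `|x 0 a| <= `|x|.
Proof. by apply: (rV_norm_le x (normr_ge0 _)).1. Qed.

Lemma norm_le_nrm x : `|x| <= nrm x.
Proof.
apply/(rV_norm_le x (nrm_ge0 x)) => a.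
rewrite -(@ler_pXn2r _ 2) ?nnegrE ?nrm_ge0 ?normr_ge0 // nrm_sqr.
rewrite -normrX ger0_norm ?sqr_ge0 // /dot (bigD1 a) //= -expr2 lerDl.
by apply: sumr_ge0 => i _; rewrite -expr2 sqr_ge0.
Qed.

Lemma nrm_le_norm x : nrm x <= n%:R * `|x|.
Proof.
have [n0|n0] := posnP n.
  rewrite /nrm /dot big1 ?sqrtr0 ?mulr_ge0 ?ler0n // => i _.
  by have := ltn_ord i; rewrite [in X in (_ < X)%N -> _]n0.
rewrite -(@ler_pXn2r _ 2) ?nnegrE ?nrm_ge0 ?mulr_ge0 ?ler0n // nrm_sqr exprMn.
apply: (@le_trans _ _ (\sum_(i < n) `|x| ^+ 2)).
  apply: ler_sum => i _; rewrite -expr2 -real_normK ?num_real //.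
  by rewrite ler_pXn2r ?nnegrE ?coord_le_norm.
rewrite sumr_const card_ord -[leLHS]mulr_natl ler_wpM2r ?sqr_ge0 //.
by rewrite -natrX ler_nat expnS expn1 leq_pmulr.
Qed.

End Dot.

Lemma dotMl (R : realType) p q (x : 'rV[R]_p) (M : 'M[R]_(p, q)) (y : 'rV[R]_q) :
  dot (x *m M) y = dot x (y *m M^T).
Proof.
rewrite /dot; under eq_bigr do rewrite mxE mulr_suml.
rewrite exchange_big /=; apply: eq_bigr => i _; rewrite mxE mulr_sumr.
by apply: eq_bigr => j _; rewrite mxE; ring.
Qed.

Lemma local_lip_continuous (R : realType) (W : normedModType R) (f : W -> R) x (k : R) :
  0 <= k -> (forall y, `|x - y| < 1 -> `|f x - f y| <= k * `|x - y|) ->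
  {for x, continuous f}.
Proof.
move=> k0 fk; apply/cvgrPdist_le => e e0; have k1 : 0 < k + 1 by rewrite ltr_wpDl.
have e1 : 0 < Num.min 1 (e / (k + 1)) by rewrite lt_min ltr01 divr_gt0.
apply/nbhs_normP; exists (Num.min 1 (e / (k + 1))) => // y /=.
rewrite lt_min => /andP[xy1 xy2]; apply: le_trans (fk _ xy1) _.
apply: (@le_trans _ _ ((k + 1) * `|x - y|)); first by rewrite ler_wpM2r // lerDl.
by rewrite mulrC -ler_pdivlMr // ltW.
Qed.

Section Lip.
Variables (R : realType) (n : nat).
Local Notation V := 'rV[R]_n.
Implicit Types (A : set V) (f g : V -> R).

(** Bounded and Lipschitz on [A]: the bound makes the class stable under products, and the Lipschitz
    constant is the rate that [no_retraction] needs. *)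
Definition lipb A f := exists2 k : R, 0 <= k &
  (forall x, A x -> `|f x| <= k) /\
  (forall x y, A x -> A y -> `|f x - f y| <= k * `|x - y|).

Lemma lipb_cst A (a : R) : lipb A (fun=> a).
Proof.
by exists `|a| => //; split => // x y _ _; rewrite subrr normr0 mulr_ge0.
Qed.

Lemma lipb_coord A i (r : R) : (forall x, A x -> `|x| <= r) -> 0 <= r ->
  lipb A (fun x => x 0 i).
Proof.
move=> Ar r0; exists (Num.max r 1); first by rewrite le_max r0.
split=> [x /Ar|x y _ _].
  by move=> xr; rewrite le_max (le_trans (coord_le_norm _ _) xr).
have := coord_le_norm (x - y) i; rewrite !mxE => /le_trans; apply.
by rewrite ler_peMl // le_max lexx orbT.
Qed.

Lemma lipb_add A f g : lipb A f -> lipb A g -> lipb A (fun x => f x + g x).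
Proof.
move=> [a a0 [fa fl]] [b b0 [gb gl]]; exists (a + b); first exact: addr_ge0.
split=> [x Ax|x y Ax Ay]; first exact: le_trans (ler_normD _ _) (lerD (fa x Ax) (gb x Ax)).
rewrite (_ : _ - _ = (f x - f y) + (g x - g y)); last by ring.
by rewrite mulrDl (le_trans (ler_normD _ _)) // lerD ?fl ?gl.
Qed.

Lemma lipb_mul A f g : lipb A f -> lipb A g -> lipb A (fun x => f x * g x).
Proof.
move=> [a a0 [fa fl]] [b b0 [gb gl]]; exists (a * b *+ 2).
  by rewrite mulrn_wge0 // mulr_ge0.
split=> [x Ax|x y Ax Ay].
  rewrite normrM (@le_trans _ _ (a * b)) //; first by rewrite ler_pM ?fa ?gb.
  by rewrite mulr2n lerDl mulr_ge0.
rewrite (_ : _ - _ = (f x - f y) * g x + f y * (g x - g y)); last by ring.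
rewrite (le_trans (ler_normD _ _)) // !normrM.
rewrite (@le_trans _ _ ((a * `|x - y|) * b + a * (b * `|x - y|))) //.
  by rewrite lerD // ler_pM ?fa ?gb ?fl ?gl.
by rewrite mulr2n le_eqVlt; apply/orP; left; apply/eqP; ring.
Qed.

Lemma lipb_opp A f : lipb A f -> lipb A (fun x => - f x).
Proof.
move=> [a a0 [fa fl]]; exists a => //; split=> [x Ax|x y Ax Ay].
  by rewrite normrN fa.
by rewrite -opprD normrN fl.
Qed.

Lemma lipb_sub A f g : lipb A f -> lipb A g -> lipb A (fun x => f x - g x).
Proof. by move=> fl gl; apply: lipb_add => //; apply: lipb_opp. Qed.

Lemma lipb_sum A (I : finType) (F : I -> V -> R) :
  (forall i, lipb A (F i)) -> lipb A (fun x => \sum_i F i x).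
Proof.
move=> Fl; rewrite -[X in lipb _ X]/(fun x => \sum_(i <- index_enum I) F i x).
elim: (index_enum I) => [|i s IH].
  by under eq_fun do rewrite big_nil; exact: lipb_cst.
by under eq_fun do rewrite big_cons; apply: lipb_add.
Qed.

Lemma lipb_dot A p (F G : V -> 'rV[R]_p) :
  (forall i, lipb A (fun x => F x 0 i)) -> (forall i, lipb A (fun x => G x 0 i)) ->
  lipb A (fun x => dot (F x) (G x)).
Proof. by move=> Fl Gl; apply: lipb_sum => i; apply: lipb_mul. Qed.

Lemma lipb_mulmx A p q (F : V -> 'rV[R]_p) (M : 'M[R]_(p, q)) i :
  (forall i, lipb A (fun x => F x 0 i)) -> lipb A (fun x => (F x *m M) 0 i).
Proof.
move=> Fl; under eq_fun do rewrite mxE.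
by apply: lipb_sum => j; apply: lipb_mul => //; exact: lipb_cst.
Qed.

Lemma lipb_norm A (r : R) : (forall x, A x -> `|x| <= r) -> 0 <= r ->
  lipb A (fun x => `|x|).
Proof.
move=> Ar r0; exists (Num.max r 1); first by rewrite le_max r0.
split=> [x /Ar|x y _ _]; first by rewrite normr_id le_max => ->.
rewrite (le_trans (ler_dist_dist _ _)) // ler_peMl // le_max lexx orbT //.
Qed.

Lemma lipb_max A f g : lipb A f -> lipb A g -> lipb A (fun x => Num.max (f x) (g x)).
Proof.
move=> [a a0 [fa fl]] [b b0 [gb gl]]; exists (Num.max a b); first by rewrite le_max a0.
split=> [x Ax|x y Ax Ay].
  by rewrite le_max; case: (leP (f x) (g x)) => _; rewrite ?fa ?gb ?orbT.
have hf := fl x y Ax Ay; have hg := gl x y Ax Ay.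
have h1 : a * `|x - y| <= Num.max a b * `|x - y| by rewrite ler_wpM2r // le_max lexx.
have h2 : b * `|x - y| <= Num.max a b * `|x - y| by rewrite ler_wpM2r // le_max lexx orbT.
move: hf hg; rewrite !ler_norml.
case: (leP (f x) (g x)) => ?; case: (leP (f y) (g y)) => ? /andP[? ?] /andP[? ?];
  apply/andP; split; lra.
Qed.

Lemma lipb_min A f g : lipb A f -> lipb A g -> lipb A (fun x => Num.min (f x) (g x)).
Proof.
move=> fl gl; under eq_fun do rewrite -[Num.min _ _]opprK oppr_min.
by apply: lipb_opp; apply: lipb_max; apply: lipb_opp.
Qed.

Lemma lipb_inv A f (e : R) : 0 < e -> (forall x, A x -> e <= f x) -> lipb A f ->
  lipb A (fun x => (f x)^-1).
Proof.
move=> e0 fe [a a0 [fa fl]]; exists (Num.max e^-1 (a / e ^+ 2)).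
  by rewrite le_max invr_ge0 ltW.
have f0 x : A x -> 0 < f x by move=> Ax; exact: lt_le_trans (fe x Ax).
split=> [x Ax|x y Ax Ay].
  by rewrite gtr0_norm ?invr_gt0 ?f0 // le_max lef_pV2 ?posrE ?f0 // fe.
rewrite (@le_trans _ _ (a / e ^+ 2 * `|x - y|)) //; last first.
  by rewrite ler_wpM2r // le_max lexx orbT.
have fx := f0 x Ax; have fy := f0 y Ay.
rewrite (_ : _ - _ = (f y - f x) / (f x * f y)); last by field; rewrite !gt_eqF.
rewrite normrM distrC (gtr0_norm (x := (_ * _)^-1)) ?invr_gt0 ?mulr_gt0 //.
have fxy0 : 0 < f x * f y by rewrite mulr_gt0.
have fxy : e ^+ 2 <= f x * f y by rewrite expr2 ler_pM ?fe // ltW.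
rewrite mulrAC; apply: ler_pM => //; first by rewrite invr_ge0 ltW.
  exact: fl.
by rewrite lef_pV2 ?posrE ?exprn_gt0.
Qed.

Lemma lipb_sqrt A f (e : R) : 0 < e -> (forall x, A x -> e <= f x) -> lipb A f ->
  lipb A (fun x => Num.sqrt (f x)).
Proof.
move=> e0 fe [a a0 [fa fl]]; exists (Num.max (Num.sqrt a) (a / Num.sqrt e)).
  by rewrite le_max sqrtr_ge0.
have f0 x : A x -> 0 < f x by move=> Ax; exact: lt_le_trans (fe x Ax).
split=> [x Ax|x y Ax Ay].
  rewrite ger0_norm ?sqrtr_ge0 // le_max ler_wsqrtr //.
  by rewrite (le_trans (ler_norm _)) ?fa.
rewrite (@le_trans _ _ (a / Num.sqrt e * `|x - y|)) //; last first.
  by rewrite ler_wpM2r // le_max lexx orbT.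
have sx : 0 < Num.sqrt (f x) by rewrite sqrtr_gt0 f0.
have sy : 0 < Num.sqrt (f y) by rewrite sqrtr_gt0 f0.
have se : 0 < Num.sqrt e by rewrite sqrtr_gt0.
have h : Num.sqrt e <= Num.sqrt (f x) by rewrite ler_wsqrtr // fe.
rewrite mulrAC ler_pdivlMr //.
have := fl x y Ax Ay.
rewrite -{1}(sqr_sqrtr (ltW (f0 x Ax))) -{1}(sqr_sqrtr (ltW (f0 y Ay))) subr_sqr normrM.
apply: le_trans; rewrite ler_wpM2l // ger0_norm ?addr_ge0 ?sqrtr_ge0 //.
by apply: le_trans h _; rewrite lerDl ltW.
Qed.

Lemma lipb_sub_set A B f : B `<=` A -> lipb A f -> lipb B f.
Proof.
move=> BA [a a0 [fa fl]]; exists a => //; split => [x /BA|x y /BA Ax /BA Ay]; [exact: fa|exact: fl].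
Qed.

Lemma lipb_continuous A f : lipb A f -> {within A, continuous f}.
Proof.
move=> [a a0 [_ fl]]; apply/subspace_continuousP => x Ax.
apply/cvgrPdist_le => /= e e0.
have k0 : 0 < a + 1 by rewrite ltr_wpDl.
rewrite near_withinE; near=> y => Ay.
apply: le_trans (fl _ _ Ax Ay) _.
apply: (@le_trans _ _ ((a + 1) * `|x - y|)); first by rewrite ler_wpM2r // lerDl.
rewrite mulrC -ler_pdivlMr // ltW //; near: y.
by apply: cvgr_dist_lt; rewrite ?divr_gt0.
Unshelve. all: by end_near. Qed.

Lemma compact_box (r : R) (A : set V) : closed A -> (forall x, A x -> `|x| <= r) -> compact A.
Proof.
move=> Acl Ar; apply: bounded_closed_compact => //.
by exists r; split; [exact: num_real|move=> M rM x /Ar /le_trans; apply; rewrite ltW].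
Qed.

Lemma lipb_min_attained A f : compact A -> A !=set0 -> lipb A f ->
  exists2 c, A c & forall x, A x -> f c <= f x.
Proof.
move=> Acpt A0 /lipb_continuous fc.
have [c cA h] := EVT_min_rV A0 Acpt fc; exists c; first by rewrite inE in cA.
by move=> x Ax; apply: h; rewrite inE.
Qed.

Lemma lipb_bounded_below A f : compact A -> lipb A f -> (forall x, A x -> 0 < f x) ->
  exists2 e, 0 < e & forall x, A x -> e <= f x.
Proof.
move=> Acpt fl f0; have [A0|A0] := pselect (A !=set0).
  by have [c Ac h] := lipb_min_attained Acpt A0 fl; exists (f c) => //; exact: f0.
by exists 1 => // x Ax; exfalso; apply: A0; exists x.
Qed.

Lemma lipb_ball_continuous f :
  (forall r, 0 <= r -> lipb [set x | `|x| <= r] f) -> continuous f.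
Proof.
move=> fl x; have [k k0 [_ fk]] := fl (`|x| + 1) (addr_ge0 (normr_ge0 _) ler01).
apply: (local_lip_continuous k0) => y xy; apply: fk; first by rewrite /= lerDl.
by rewrite /= -[y](subrK x) (le_trans (ler_normD _ _)) // addrC lerD // distrC ltW.
Qed.

Lemma lipb_ball_coord i r : 0 <= r -> lipb [set x : V | `|x| <= r] (fun x => x 0 i).
Proof. by move=> r0; apply: lipb_coord r0. Qed.

Lemma closed_le_fun f (a : R) : continuous f -> closed [set x | f x <= a].
Proof. by move=> /continuous_closedP /(_ _ (@closed_le _ a)). Qed.

Lemma closed_ge_fun f (a : R) : continuous f -> closed [set x | a <= f x].
Proof. by move=> /continuous_closedP /(_ _ (@closed_ge _ a)). Qed.

Lemma closed_eq_fun f (a : R) : continuous f -> closed [set x | f x = a].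
Proof. by move=> /continuous_closedP /(_ _ (@closed_eq _ a)). Qed.

Lemma continuous_dotxx : continuous (fun x : V => dot x x).
Proof.
by apply: lipb_ball_continuous => r r0; apply: lipb_dot => i; exact: lipb_ball_coord.
Qed.

Definition sphere : set V := [set x | dot x x = 1].

Lemma sphere_norm_le x : sphere x -> `|x| <= 1.
Proof. by move=> xx; apply: le_trans (norm_le_nrm _) _; rewrite /nrm xx sqrtr1. Qed.

Lemma compact_sphere : compact sphere.
Proof. exact: compact_box (closed_eq_fun continuous_dotxx) sphere_norm_le. Qed.

Lemma compact_cube r : compact [set x : V | `|x| <= r].
Proof.
apply: (@compact_box r) => //; apply: closed_le_fun.
by apply: lipb_ball_continuous => s s0; apply: lipb_norm s0.
Qed.

End Lip.

Arguments sphere {R n}.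

Lemma sphere_nonempty (R : realType) n : (0 < n)%N -> @sphere R n !=set0.
Proof.
move=> n0; exists (delta_mx 0 (Ordinal n0)).
rewrite /sphere /= /dot (bigD1 (Ordinal n0)) //= !mxE !eqxx mulr1 big1 ?addr0 // => j jn.
by rewrite !mxE (negPf jn) mulr0.
Qed.

Lemma sphere_neq0 (R : realType) n (c : 'rV[R]_n) : sphere c -> c != 0.
Proof. by move=> cc; rewrite -dot_eq0 cc oner_eq0. Qed.

Lemma lipb_near (R : realType) n (A : set 'rV[R]_n) (f : 'rV[R]_n -> R) :
  lipb A f -> exists2 k, 0 <= k & forall x y e, A x -> A y -> `|x - y| <= e ->
  `|f x - f y| <= k * e.
Proof.
move=> [k k0 [_ fk]]; exists k => // x y e Ax Ay xy.
by apply: le_trans (fk _ _ Ax Ay) _; rewrite ler_wpM2l.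
Qed.

Lemma common_bound (R : realType) (I : finType) (P : I -> R -> Prop) :
  (forall i a b, a <= b -> P i a -> P i b) -> (forall i, exists a, P i a) ->
  exists a, forall i, P i a.
Proof.
move=> Pmon Pex; have [F FP] := choice Pex.
exists (\sum_i `|F i|) => i; apply: Pmon (FP i).
by rewrite (bigD1 i) //= (le_trans (ler_norm _)) // lerDl sumr_ge0.
Qed.

(* If H had no zero, the normalised interpolation between H and the identity field
   would retract the cube of radius 2. *)
Lemma outward_field_zero (R : realType) n (H : 'rV[R]_n -> 'rV[R]_n) : (0 < n)%N ->
  (forall k, lipb [set c | `|c| <= 2] (fun c => H c 0 k)) ->
  (forall c, 1 <= `|c| -> `|c| <= 2 -> 0 < dot c (H c)) ->
  exists c, `|c| <= 1 /\ H c = 0.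
Proof.
case: n H => // d H _ Hl Hin; apply: contrapT => noz.
set Q := [set c : 'rV[R]_d.+1 | `|c| <= 2].
(* [H1] is [H] on the unit cube and the identity field where the norm of c is 2. In between, pairing
   with c shows that it has no zero, because [H] points outwards there. *)
pose a (c : 'rV[R]_d.+1) : R := Num.min 1 (2 - `|c|).
pose b (c : 'rV[R]_d.+1) : R := Num.max 0 (`|c| - 1).
pose H1 c := a c *: H c + b c *: c.
have Hn0 c : `|c| <= 2 -> H c != 0.
  move=> c2; apply/eqP => Hc; have [c1|/ltW c1] := leP `|c| 1.
    by apply: noz; exists c.
  by have := Hin c c1 c2; rewrite Hc dot0r ltxx.
have H1n0 c : Q c -> H1 c != 0.
  move=> c2; have [c1|/ltW c1] := leP `|c| 1.
    rewrite /H1 /a /b (min_idPl _) ?(max_idPl _) ?scale1r ?scale0r ?addr0 ?Hn0 //.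
      by rewrite subr_le0.
    by rewrite lerBrDr -lerBrDl (_ : 2 - 1 = 1) //; ring.
  apply/eqP => /(congr1 (dot c)); rewrite dot0r dotDr !dotZr /a /b => h.
  have cH := Hin c c1 c2.
  have cc : 0 < dot c c.
    by rewrite dot_gt0 // -normr_gt0 (lt_le_trans ltr01).
  rewrite (max_idPr _) ?subr_ge0 // in h.
  move: h c1 c2 cH cc; rewrite /Q /=.
  move: `|c| (dot c c) (dot c (H c)) => s q p; rewrite minEle.
  case: ifP => [_ h s1 _ p0 q0|_ h s1 s2 p0 q0].
    have : 0 <= (s - 1) * q by apply: mulr_ge0; [rewrite subr_ge0|exact: ltW].
    lra.
  have [s3|s3] := ltP s 2; last first.
    have s4 : s = 2 by apply/le_anti; rewrite s2 s3.
    by move: h; rewrite s4; lra.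
  have h1 : 0 < (2 - s) * p by rewrite mulr_gt0 ?subr_gt0.
  have : 0 <= (s - 1) * q by apply: mulr_ge0; [rewrite subr_ge0|exact: ltW].
  lra.
have nl : lipb Q (fun c => `|c|) by apply: (@lipb_norm _ _ _ 2).
have cl k : lipb Q (fun c => c 0 k) by apply: (@lipb_coord _ _ _ _ 2).
have al : lipb Q a.
  by apply: lipb_min; [exact: lipb_cst|apply: lipb_sub => //; exact: lipb_cst].
have bl : lipb Q b.
  by apply: lipb_max; [exact: lipb_cst|apply: lipb_sub => //; exact: lipb_cst].
have H1l k : lipb Q (fun c => H1 c 0 k).
  under eq_fun do rewrite !mxE.
  by apply: lipb_add; apply: lipb_mul.
have Nl : lipb Q (fun c => dot (H1 c) (H1 c)) by exact: lipb_dot.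
have [e e0 He] := lipb_bounded_below (@compact_cube R d.+1 2) Nl (fun c Qc => dot_gt0 (H1n0 c Qc)).
pose phi c := (nrm (H1 c))^-1 *: H1 c.
have phil k : lipb Q (fun c => phi c 0 k).
  rewrite (_ : (fun c => _) = fun c => (nrm (H1 c))^-1 * H1 c 0 k); last first.
    by apply/funext => c; rewrite !mxE.
  apply: lipb_mul => //; apply: (@lipb_inv _ _ _ (fun c => nrm (H1 c)) (Num.sqrt e)).
  - by rewrite sqrtr_gt0.
  - by move=> c Qc; rewrite ler_wsqrtr // He.
  - exact: lipb_sqrt e0 He Nl.
have [K HK] : exists K, forall k, 0 <= K /\ forall x y u, Q x -> Q y -> `|x - y| <= u ->
    `|phi x 0 k - phi y 0 k| <= K * u.
  apply: common_bound => [k u v uv [u0 h]|k].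
    split=> [|x y t Qx Qy xy]; first exact: le_trans uv.
    apply: le_trans (h _ _ _ Qx Qy xy) _.
    by rewrite ler_wpM2r // (le_trans _ xy).
  by have [K K0 h] := lipb_near (phil k); exists K.
pose w (c : 'rV[R]_d.+1) := (nrm (2 *: c))^-1 * 2.
have Q2 (c : 'rV[R]_d.+1) : (forall i, `|c 0 i| <= 1) -> Q (2 *: c).
  move=> /(rV_norm_le _ ler01) c1; rewrite /Q /= normrZ ger0_norm //.
  by rewrite -[leRHS]mulr1 ler_wpM2l.
apply: (@no_retraction R d (K * 2) (fun c => phi (2 *: c)) w).
- move=> c /Q2 Qc; rewrite -[LHS]/(\sum_k phi (2 *: c) 0 k * phi (2 *: c) 0 k).
  rewrite -/(dot _ _) /phi dotZl dotZr -nrm_sqr mulrA -expr2 -exprMn mulVf ?expr1n //.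
  by rewrite nrm_eq0 H1n0.
- move=> c c' u /Q2 Qc /Q2 Qc' cc' k; rewrite -mulrA; apply: (HK k).2 => //.
  have u0 : 0 <= u by apply: le_trans (cc' ord0).
  rewrite -scalerBr normrZ ger0_norm // ler_wpM2l //.
  by apply/(rV_norm_le _ u0) => i; rewrite !mxE.
- move=> c c1 [i ci].
  have nc : `|c| = 1.
    apply/eqP; rewrite eq_le; apply/andP; split; first exact/(rV_norm_le _ ler01).
    by rewrite -ci coord_le_norm.
  have n2c : `|2 *: c| = 2 by rewrite normrZ nc mulr1 ger0_norm.
  have c0 : 2 *: c != 0 by rewrite -normr_gt0 n2c.
  split; first by rewrite mulr_gt0 ?invr_gt0 ?nrm_gt0.
  rewrite /phi (_ : H1 (2 *: c) = 2 *: c) ?scalerA //.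
  rewrite /H1 /a /b n2c subrr (min_idPr _) ?ler01 // scale0r add0r (max_idPr _).
    by rewrite (_ : 2 - 1 = 1) ?scale1r //; ring.
  by rewrite subr_ge0 ler1n.
Qed.

(** * Smooth inverses of quadratic maps *)

(** Expansions of quadratic maps and of their inverses come with remainders of second order; this
    turns such a bound into a derivative. *)
Lemma quadratic_differentiable (R : realType) (V W : normedModType R) (f : V -> W) x
    (L : {linear V -> W}) (C : R) : continuous L -> 0 <= C ->
  (\forall h \near (0 : V), `|f (h + x) - f x - L h| <= C * `|h| ^+ 2) ->
  differentiable f x /\ forall w, 'D_w f x = L w.
Proof.
move=> Lc C0 fL.
have fo : f \o shift x = (cst (f x) + L)%R +o_ 0 id.
  apply/eqaddoP => e e0; have C1 : 0 < C + 1 by rewrite ltr_wpDl.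
  near=> h; rewrite /= opprD addrA.
  apply: (@le_trans _ _ (C * `|h| ^+ 2)); first by near: h.
  rewrite expr2 mulrA ler_wpM2r //.
  apply: (@le_trans _ _ ((C + 1) * `|h|)); first by rewrite ler_wpM2r // lerDl.
  rewrite mulrC -ler_pdivlMr // ltW //; near: h.
  by apply: nbhs0_lt; rewrite divr_gt0.
have dL := diff_unique Lc fo.
have df : differentiable f x by apply/diff_locallyP; rewrite dL.
by split=> // w; rewrite deriveE // dL.
Unshelve. all: by end_near. Qed.

(** * Differentiability of finite order *)

Section Ck.
Variables (R : realType) (V : normedModType R).
Implicit Types (W : set V) (f g : V -> R).

Lemma near_eq_differentiable f g x : (\forall y \near x, f y = g y) ->
  differentiable f x -> differentiable g x.
Proof.
move=> fg df; have fgx := nbhs_singleton fg.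
pose z := fun y => g y - f y.
have [dz _] : differentiable z x /\ forall w, 'D_w z x = (\0 : V -> R) w.
  apply: (@quadratic_differentiable _ _ _ _ _ _ 0) => //; first exact: cst_continuous.
  move: fg; rewrite (near_shift 0) subr0 => fg; near=> h.
  rewrite /= /z fgx subrr subr0 mul0r.
  have -> : f (h + x) = g (h + x) by near: h.
  by rewrite subrr subr0 normr0.
have -> : g = f + z by apply/funext => y; rewrite /z /GRing.add /= addrC subrK.
exact: differentiableD.
Unshelve. all: by end_near. Qed.

(** All iterated directional derivatives of order below [k] are differentiable on [W]; holding for
    every [k], this gives [smooth_on]. *)
Fixpoint Ck W (k : nat) f : Prop :=
  if k is k'.+1 then (forall x, W x -> differentiable f x) /\ forall w, Ck W k' ('D_w f)
  else True.

Lemma Ck_ext W k f g : open W -> (forall x, W x -> f x = g x) -> Ck W k f -> Ck W k g.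
Proof.
move=> Wo; elim: k f g => [//|k IH] f g fg [df Df].
have fg_near x : W x -> \forall y \near x, f y = g y.
  by move=> Wx; apply: filterS (open_nbhs_nbhs (conj Wo Wx)) => y /fg.
split=> [x Wx|w]; first exact: near_eq_differentiable (fg_near x Wx) (df x Wx).
by apply: IH (Df w) => x Wx; apply: near_eq_derive; exact: fg_near.
Qed.

Lemma CkS W k f : Ck W k.+1 f -> Ck W k f.
Proof. by elim: k f => [//|k IH] f [df Df]; split=> // w; apply: IH. Qed.

Lemma Ck_cst W k (a : R) : Ck W k (fun=> a).
Proof.
elim: k a => [//|k IH] a; split=> [x _|w]; first exact: differentiable_cst.
by rewrite (_ : 'D_w _ = fun=> 0) //; apply/funext => x; rewrite derive_cst.
Qed.

Lemma Ck_add W k f g : open W -> Ck W k f -> Ck W k g -> Ck W k (fun x => f x + g x).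
Proof.
move=> Wo; elim: k f g => [//|k IH] f g [df Df] [dg Dg].
split=> [x Wx|w]; first by apply: differentiableD; [exact: df|exact: dg].
apply: (@Ck_ext _ _ (fun x => 'D_w f x + 'D_w g x)) => // [x Wx|]; last by apply: IH; [exact: Df|exact: Dg].
by rewrite -deriveD //; apply: diff_derivable; [exact: df|exact: dg].
Qed.

Lemma Ck_mul W k f g : open W -> Ck W k f -> Ck W k g -> Ck W k (fun x => f x * g x).
Proof.
move=> Wo; elim: k f g => [//|k IH] f g fC gC.
have [df Df] := fC; have [dg Dg] := gC.
split=> [x Wx|w]; first by apply: differentiableM; [exact: df|exact: dg].
apply: (@Ck_ext _ _ (fun x => f x * 'D_w g x + g x * 'D_w f x)) => // [x Wx|].
  by rewrite -deriveM //; apply: diff_derivable; [exact: df|exact: dg].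
by apply: Ck_add => //; [exact: IH (CkS fC) (Dg w)|exact: IH (CkS gC) (Df w)].
Qed.

Lemma Ck_inv W k f : open W -> (forall x, W x -> f x != 0) -> Ck W k f ->
  Ck W k (fun x => (f x)^-1).
Proof.
move=> Wo f0; elim: k => [//|k IH] fC; have [df Df] := fC.
split=> [x Wx|w]; first by apply: differentiableV; [exact: df|exact: f0].
have IHk := IH (CkS fC).
apply: (@Ck_ext _ _ (fun x => -1 * ('D_w f x * ((f x)^-1 * (f x)^-1)))) => // [x Wx|].
  rewrite deriveV ?f0 //; last by apply: diff_derivable; exact: df.
  by rewrite -exprVn /GRing.scale /=; ring.
apply: (Ck_mul Wo (Ck_cst _ _ _)); apply: (Ck_mul Wo (Df w)).
exact: Ck_mul.
Qed.

Lemma Ck_sum W k (I : Type) (s : seq I) (F : I -> V -> R) : open W ->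
  (forall i, Ck W k (F i)) -> Ck W k (fun x => \sum_(i <- s) F i x).
Proof.
move=> Wo FC; elim: s => [|i s IH].
  by under eq_fun do rewrite big_nil; exact: Ck_cst.
by under eq_fun do rewrite big_cons; exact: Ck_add.
Qed.

Lemma Ck_prod W k (I : Type) (s : seq I) (F : I -> V -> R) : open W ->
  (forall i, Ck W k (F i)) -> Ck W k (fun x => \prod_(i <- s) F i x).
Proof.
move=> Wo FC; elim: s => [|i s IH].
  by under eq_fun do rewrite big_nil; exact: Ck_cst.
by under eq_fun do rewrite big_cons; exact: Ck_mul.
Qed.

Lemma Ck_det W k n (M : V -> 'M[R]_n) : open W ->
  (forall i j, Ck W k (fun x => M x i j)) -> Ck W k (fun x => \det (M x)).
Proof.
move=> Wo MC; apply: Ck_sum => // s; apply: Ck_mul => //; first exact: Ck_cst.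
exact: Ck_prod.
Qed.

Lemma Ck_invmx W k n (M : V -> 'M[R]_n) i j : open W ->
  (forall x, W x -> M x \in unitmx) ->
  (forall i j, Ck W k (fun x => M x i j)) -> Ck W k (fun x => invmx (M x) i j).
Proof.
move=> Wo Mu MC.
apply: (@Ck_ext _ _ (fun x => (\det (M x))^-1 * cofactor (M x) j i)) => // [x Wx|].
  by rewrite /invmx Mu // !mxE.
apply: Ck_mul => //.
  by apply: Ck_inv => // [x /Mu|]; [rewrite unitmxE unitfE|exact: Ck_det].
rewrite /cofactor; apply: Ck_mul => //; first exact: Ck_cst.
apply: Ck_det => // a b; under eq_fun do rewrite !mxE.
exact: MC.
Qed.

End Ck.

Lemma Ck_smooth_on (R : realType) m (W : set 'rV[R]_m) (f : 'rV[R]_m -> R) :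
  (forall k, Ck W k f) -> smooth_on W f.
Proof.
move=> fC ws; suff /(_ 1%N) [] : forall k, Ck W k (foldr (fun w h => 'D_w h) f ws) by [].
elim: ws => [//|w ws IH] k /=.
by have [_] := IH k.+1; apply.
Qed.

Lemma mulmx_norm_le (R : realType) p q (M : 'M[R]_(p, q)) :
  exists2 C : R, 0 < C & forall u : 'rV[R]_p, `|u *m M| <= C * `|u|.
Proof.
pose C := 1 + \sum_i \sum_j `|M i j|.
have S0 (i : 'I_p) : 0 <= \sum_j `|M i j| by apply: sumr_ge0.
have C0 : 0 < C by rewrite ltr_pwDl // sumr_ge0.
exists C => // u.
apply/rV_norm_le => [|j]; first by rewrite mulr_ge0 // ltW.
rewrite mxE; apply: le_trans (ler_norm_sum _ _ _) _.
apply: (@le_trans _ _ (\sum_i `|M i j| * `|u|)).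
  by apply: ler_sum => i _; rewrite normrM mulrC ler_wpM2l // coord_le_norm.
rewrite -mulr_suml ler_wpM2r // /C ler_wpDl //; apply: ler_sum => i _.
by rewrite (bigD1 j) //= lerDl sumr_ge0.
Qed.

Lemma unitmx_inj (R : fieldType) n (M : 'M[R]_n) :
  (forall u : 'rV_n, u *m M = 0 -> u = 0) -> M \in unitmx.
Proof.
move=> Minj; rewrite unitmxE unitfE; apply/negP => /det0P [u u0 /Minj uE].
by rewrite uE eqxx in u0.
Qed.

Lemma lipb_vec (R : realType) n p (A : set 'rV[R]_n) (F : 'rV[R]_n -> 'rV[R]_p) :
  (forall i, lipb A (fun x => F x 0 i)) ->
  exists2 K, 0 <= K & forall x y, A x -> A y -> `|F x - F y| <= K * `|x - y|.
Proof.
move=> Fl.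
have /choice [k kP] : forall i, exists a, 0 <= a /\
    (forall x y, A x -> A y -> `|F x 0 i - F y 0 i| <= a * `|x - y|).
  by move=> i; have [a a0 []] := Fl i; exists a.
have k0 : 0 <= \sum_i k i by apply: sumr_ge0 => i _; case: (kP i).
exists (\sum_i k i) => // x y Ax Ay; apply/rV_norm_le => [|i]; first by rewrite mulr_ge0.
rewrite !mxE; apply: le_trans ((kP i).2 x y Ax Ay) _; rewrite ler_wpM2r //.
by rewrite (bigD1 i) //= lerDl sumr_ge0 // => j _; case: (kP j).
Qed.

Lemma lipb_normv (R : realType) n p (A : set 'rV[R]_n) (F : 'rV[R]_n -> 'rV[R]_p) :
  (forall i, lipb A (fun x => F x 0 i)) -> lipb A (fun x => `|F x|).
Proof.
move=> Fl; have [K K0 FK] := lipb_vec Fl.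
have [M MP] : exists M, forall x, A x -> `|F x| <= M.
  have [[x0 Ax0]|A0] := pselect (A !=set0); last first.
    by exists 0 => x Ax; exfalso; apply: A0; exists x.
  have /choice [k kP] : forall i, exists a, 0 <= a /\ forall x, A x -> `|F x 0 i| <= a.
    by move=> i; have [a a0 []] := Fl i; exists a.
  have k0 : 0 <= \sum_i k i by apply: sumr_ge0 => i _; case: (kP i).
  exists (\sum_i k i) => x Ax; apply/rV_norm_le => // i.
  apply: le_trans ((kP i).2 x Ax) _.
  by rewrite (bigD1 i) //= lerDl sumr_ge0 // => j _; case: (kP j).
exists (Num.max K M); first by rewrite le_max K0.
split=> [x Ax|x y Ax Ay]; first by rewrite normr_id le_max MP ?orbT.
apply: le_trans (ler_dist_dist _ _) _; apply: le_trans (FK x y Ax Ay) _.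
by rewrite ler_wpM2r // le_max lexx.
Qed.

(** * Inverse function theorem for a quadratic map *)

Section QuadraticMap.
Variables (R : realType) (D : nat).
Local Notation V := 'rV[R]_D.
Variables (ell : V -> V) (beta : V -> V -> V).
Hypothesis ellP : linear ell.
Hypothesis betal : forall y, linear (beta ^~ y).
Hypothesis betar : forall x, linear (beta x).

Definition quad_map (t : V) : V := ell t + beta t t.
Definition quad_jac (t : V) : 'M[R]_D :=
  lin1_mx (fun d => ell d + beta t d + beta d t).

Lemma linear_sum_delta (f : V -> V) : linear f ->
  forall t, f t = \sum_k t 0 k *: f (delta_mx 0 k).
Proof.
move=> fl t; pose fL : {linear V -> V} := HB.pack f (GRing.isLinear.Build R V V _ f fl).
by rewrite {1}(row_sum_delta t) -[f]/(fL : V -> V) linear_sum; apply: eq_bigr => k _; rewrite linearZ.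
Qed.

Lemma mul_quad_jac t d : d *m quad_jac t = ell d + beta t d + beta d t.
Proof.
rewrite (linear_sum_delta ellP d) (linear_sum_delta (betar t) d)
  (linear_sum_delta (betal t) d) -!big_split /=.
apply/rowP => j; rewrite mxE summxE; apply: eq_bigr => k _.
by rewrite !mxE; ring.
Qed.

Lemma betaDD x y x' y' :
  beta (x + x') (y + y') = beta x y + beta x y' + beta x' y + beta x' y'.
Proof.
have Dl a b c : beta (a + b) c = beta a c + beta b c.
  by have := betal c 1 a b; rewrite !scale1r.
have Dr a b c : beta c (a + b) = beta c a + beta c b.
  by have := betar c 1 a b; rewrite !scale1r.
by rewrite Dl !Dr !addrA.
Qed.

(** The expansion is exact, so the only remainder ever to be estimated is [beta d d]. *)
Lemma quad_map_add t d : quad_map (t + d) = quad_map t + d *m quad_jac t + beta d d.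
Proof.
rewrite mul_quad_jac /quad_map betaDD.
have -> : ell (t + d) = ell t + ell d by have := ellP 1 t d; rewrite !scale1r.
by apply/rowP => j; rewrite !mxE; ring.
Qed.

Lemma beta_norm_le : exists2 C, 0 < C & forall x y, `|beta x y| <= C * `|x| * `|y|.
Proof.
pose C := 1 + \sum_k \sum_l `|beta (delta_mx 0 k) (delta_mx 0 l)|.
have S0 : 0 <= \sum_k \sum_l `|beta (delta_mx 0 k) (delta_mx 0 l)|.
  by apply: sumr_ge0 => k _; apply: sumr_ge0.
exists C => [|x y]; first by rewrite ltr_pwDl.
apply: (@le_trans _ _ ((C - 1) * `|x| * `|y|)); last first.
  by rewrite !ler_wpM2r // gerBl.
rewrite (linear_sum_delta (betal y)) /C addrC addKr !mulr_suml.
apply: le_trans (ler_norm_sum _ _ _) _; apply: ler_sum => k _.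
rewrite normrZ (linear_sum_delta (betar _)) mulr_suml mulr_suml.
apply: (@le_trans _ _ (`|x| * \sum_l `|beta (delta_mx 0 k) (delta_mx 0 l)| * `|y|)).
  apply: ler_pM => //; first exact: coord_le_norm.
  apply: le_trans (ler_norm_sum _ _ _) _; apply: ler_sum => l _.
  by rewrite normrZ mulrC ler_wpM2l // coord_le_norm.
by rewrite mulr_sumr; apply: ler_sum => l _; rewrite mulrA [`|x| * _]mulrC.
Qed.

Lemma lipb_quad_map r i : 0 <= r -> lipb [set t | `|t| <= r] (fun t => quad_map t 0 i).
Proof.
move=> r0.
rewrite (_ : (fun t => _) = fun t : V => \sum_k t 0 k * (ell (delta_mx 0 k) 0 i +
    \sum_l t 0 l * beta (delta_mx 0 k) (delta_mx 0 l) 0 i)); last first.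
  apply/funext => t; rewrite /quad_map (linear_sum_delta ellP) (linear_sum_delta (betal t)).
  rewrite -big_split summxE; apply: eq_bigr => k _.
  rewrite !mxE mulrDr (linear_sum_delta (betar _)) summxE.
  by congr (_ + _ * _); apply: eq_bigr => l _; rewrite mxE.
apply: lipb_sum => k; apply: lipb_mul; first exact: lipb_ball_coord.
apply: lipb_add; first exact: lipb_cst.
apply: lipb_sum => l; apply: lipb_mul; last exact: lipb_cst.
exact: lipb_ball_coord.
Qed.

Section LocalInverse.
Variable t0 : V.
Hypothesis J0 : quad_jac t0 \in unitmx.

(** Surjectivity comes from minimising the residual |quad_map t - z| over the closed ball of radius
    [rho]. On its boundary the separation bound keeps the image at distance at least [kappa * rho]
    from the image of [t0], twice the radius allowed to z, so the minimiser is interior; a nonzero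
    residual could be lowered by a short Newton step. *)
Lemma quad_local_inverse : exists rho r kappa, [/\ 0 < rho, 0 < r, 0 < kappa &
  [/\ forall t t', `|t - t0| <= rho -> `|t' - t0| <= rho ->
        kappa * `|t - t'| <= `|quad_map t - quad_map t'|,
      forall t, `|t - t0| <= rho -> quad_jac t \in unitmx &
      forall z, `|z - quad_map t0| < r ->
        exists2 t, `|t - t0| < rho & quad_map t = z]].
Proof.
have [C C0 betaC] := beta_norm_le.
have [B B0 KB] := mulmx_norm_le (invmx (quad_jac t0)).
(* Here C rho = 1 / (8 B). Within [rho] the Jacobian loses at most a quarter of its lower bound 1 /
   B, the quadratic term costs another quarter, and half of it, [kappa], remains. *)
pose rho := (B * 8 * C)^-1; pose kappa := (2 * B)^-1.
have rho0 : 0 < rho by rewrite invr_gt0 !mulr_gt0.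
have kappa0 : 0 < kappa by rewrite invr_gt0 mulr_gt0.
have Jlow (t d : V) : `|t - t0| <= rho -> B^-1 * `|d| - 2 * (C * rho) * `|d| <= `|d *m quad_jac t|.
  move=> trho.
  have h0 : B^-1 * `|d| <= `|d *m quad_jac t0|.
    by have := KB (d *m quad_jac t0); rewrite mulmxK // mulrC -ler_pdivrMr // mulrC.
  have h1 : d *m quad_jac t0 = d *m quad_jac t - (beta (t - t0) d + beta d (t - t0)).
    rewrite !mul_quad_jac -{1 2}[t](subrK t0).
    have -> : beta (t - t0 + t0) d = beta (t - t0) d + beta t0 d.
      by have := betal d 1 (t - t0) t0; rewrite !scale1r.
    have -> : beta d (t - t0 + t0) = beta d (t - t0) + beta d t0.
      by have := betar d 1 (t - t0) t0; rewrite !scale1r.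
    by apply/rowP => j; rewrite !mxE; ring.
  have h2 : `|beta (t - t0) d| <= C * rho * `|d|.
    by apply: le_trans (betaC _ _) _; rewrite ler_wpM2r // ler_wpM2l // ltW.
  have h3 : `|beta d (t - t0)| <= C * rho * `|d|.
    apply: le_trans (betaC _ _) _; rewrite -!mulrA ler_wpM2l ?(ltW C0) // mulrC ler_wpM2r //.
  have h4 : `|d *m quad_jac t0| <= `|d *m quad_jac t| + (C * rho * `|d| + C * rho * `|d|).
    rewrite h1; apply: le_trans (ler_normB _ _) _; rewrite lerD2l.
    by apply: le_trans (ler_normD _ _) _; rewrite lerD.
  lra.
have CrB : C * rho = B^-1 / 8.
  by rewrite /rho; field; rewrite !gt_eqF.
have kB : kappa = B^-1 / 2 by rewrite /kappa; field; rewrite gt_eqF.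
have Bi0 : 0 < B^-1 by rewrite invr_gt0.
have sep (t t' : V) : `|t - t0| <= rho -> `|t' - t0| <= rho ->
    kappa * `|t - t'| <= `|quad_map t - quad_map t'|.
  move=> tr tr'; set d := t - t'.
  have -> : t = t' + d by rewrite /d addrC subrK.
  rewrite quad_map_add; set m := d *m _.
  have -> : quad_map t' + m + beta d d - quad_map t' = m + beta d d.
    by apply/rowP => j; rewrite !mxE; ring.
  have h1 := Jlow t' d tr'; rewrite -/m in h1.
  have dr : `|d| <= 2 * rho.
    rewrite /d (_ : t - t' = (t - t0) - (t' - t0)).
      by apply: le_trans (ler_normB _ _) _; lra.
    by rewrite opprB addrA subrK.
  have h2 : `|beta d d| <= 2 * (C * rho) * `|d|.
    apply: le_trans (betaC _ _) _; rewrite ler_wpM2r // mulrCA ler_wpM2l ?(ltW C0) //.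
  have h3 : `|m| <= `|m + beta d d| + `|beta d d|.
    by rewrite -{1}[m](addrK (beta d d)) ler_normB.
  rewrite CrB in h1 h2; rewrite kB.
  have d0 : 0 <= `|d| by [].
  lra.
have junit (t : V) : `|t - t0| <= rho -> quad_jac t \in unitmx.
  move=> tr; apply: unitmx_inj => u uJ; have := Jlow t u tr.
  rewrite uJ normr0 CrB => h; apply/eqP; rewrite -normr_le0.
  have : B^-1 * `|u| <= 0 by lra.
  by rewrite pmulr_rle0.
exists rho, (kappa * rho / 2), kappa; split=> //; first by rewrite !mulr_gt0.
split=> // z zr.
pose A := [set t : V | `|t - t0| <= rho].
pose q t := `|quad_map t - z|.
have Acpt : compact A.
  apply: (@compact_box _ _ (rho + `|t0|)).
    rewrite (_ : A = [set t | `|t - t0| <= rho]) //.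
    apply: closed_le_fun; apply: lipb_ball_continuous => s s0.
    apply: lipb_normv => i.
    rewrite (_ : (fun t => _) = fun t : V => t 0 i - t0 0 i); last first.
      by apply/funext => t; rewrite !mxE.
    by apply: lipb_sub; [exact: lipb_ball_coord|exact: lipb_cst].
  by move=> t At; rewrite -[t](subrK t0) (le_trans (ler_normD _ _)) // lerD2r.
have ql : lipb A q.
  apply: (@lipb_sub_set _ _ [set t | `|t| <= rho + `|t0|]).
    by move=> t At; rewrite /= -[t](subrK t0) (le_trans (ler_normD _ _)) // lerD2r.
  apply: lipb_normv => i.
  rewrite (_ : (fun t => _) = fun t : V => quad_map t 0 i - z 0 i); last first.
    by apply/funext => t; rewrite !mxE.
  apply: lipb_sub; last exact: lipb_cst.
  by apply: lipb_quad_map; rewrite addr_ge0 // ltW.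
have A0 : A !=set0 by exists t0; rewrite /A /= subrr normr0 ltW.
have [t At tmin] := lipb_min_attained Acpt A0 ql.
have At0 : A t0 by rewrite /A /= subrr normr0 ltW.
have qt : q t < kappa * rho / 2.
  by apply: le_lt_trans (tmin t0 At0) _; rewrite /q distrC.
have tint : `|t - t0| < rho.
  rewrite -(ltr_pM2l kappa0); apply: le_lt_trans (sep _ _ At At0) _.
  have -> : quad_map t - quad_map t0 = (quad_map t - z) + (z - quad_map t0).
    by rewrite addrA subrK.
  by apply: le_lt_trans (ler_normD _ _) _; rewrite -/(q t); lra.
exists t => //; apply/eqP; rewrite -subr_eq0 -normr_le0 leNgt; apply/negP => e0.
pose e := quad_map t - z; rewrite -/e in e0.
pose d := - e *m invmx (quad_jac t).
have dJ : d *m quad_jac t = - e by rewrite mulmxKV ?junit // ltW.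
(* The three bounds keep the step convex, keep it inside the ball, and make the error s^2 |beta d d|
   smaller than the gain s |e|. *)
pose s := Num.min 1 (Num.min ((rho - `|t - t0|) / (`|d| + 1)) (`|e| / (2 * (`|beta d d| + 1)))).
have s0 : 0 < s.
  have h1 : 0 < `|d| + 1 by rewrite ltr_wpDl.
  have h2 : 0 < `|beta d d| + 1 by rewrite ltr_wpDl.
  by rewrite !lt_min ltr01 !divr_gt0 ?subr_gt0 ?mulr_gt0.
have [s1 s2 s3] : [/\ s <= 1, s * (`|d| + 1) <= rho - `|t - t0| &
    s * (2 * (`|beta d d| + 1)) <= `|e|].
  have h1 : 0 < `|d| + 1 by rewrite ltr_wpDl.
  have h2 : 0 < 2 * (`|beta d d| + 1) by rewrite mulr_gt0 // ltr_wpDl.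
  by rewrite -!ler_pdivlMr //; split; rewrite /s !ge_min lexx ?orbT.
have Ats : A (t + s *: d).
  rewrite /A /= addrAC (le_trans (ler_normD _ _)) // normrZ gtr0_norm //.
  by have d0 : 0 <= `|d| by []; nra.
have := tmin _ Ats; rewrite /q quad_map_add -scalemxAl dJ.
have -> : beta (s *: d) (s *: d) = s ^+ 2 *: beta d d.
  have Zl a x y : beta (a *: x) y = a *: beta x y.
    have b0 : beta 0 y = 0.
      by have := betal y (-1) 0 0; rewrite scaler0 addr0 scaleN1r addNr.
    by have := betal y a x 0; rewrite !addr0 b0 addr0.
  have Zr a x y : beta x (a *: y) = a *: beta x y.
    have b0 : beta x 0 = 0.
      by have := betar x (-1) 0 0; rewrite scaler0 addr0 scaleN1r addNr.
    by have := betar x a y 0; rewrite !addr0 b0 addr0.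
  by rewrite Zl Zr scalerA expr2.
have -> : quad_map t + s *: - e + s ^+ 2 *: beta d d - z = (1 - s) *: e + s ^+ 2 *: beta d d.
  by apply/rowP => j; rewrite /e !mxE; ring.
rewrite -/e; apply/negP; rewrite -ltNge.
apply: le_lt_trans (ler_normD _ _) _; rewrite !normrZ.
have -> : `|1 - s| = 1 - s by rewrite ger0_norm ?subr_ge0.
rewrite (gtr0_norm s0).
rewrite -mulrA.
set b := `|beta d d| in s3 *; have b0 : 0 <= s * b by rewrite mulr_ge0 ?normr_ge0 // ltW.
have h : s * b < `|e| by lra.
have : s * (s * b) < s * `|e| by rewrite ltr_pM2l.
lra.
Qed.

End LocalInverse.

Section SmoothInverse.
Variables (m : nat) (E : 'M[R]_(m, D)) (k0 : V) (W : set 'rV[R]_m).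
Variables (theta : 'rV[R]_m -> V) (kappa : R).
Hypothesis Wo : open W.
Hypothesis kappa0 : 0 < kappa.
Hypothesis thetaP : forall y, W y -> quad_map (theta y) = y *m E + k0.
Hypothesis thetaJ : forall y, W y -> quad_jac (theta y) \in unitmx.
Hypothesis thetaL : forall y y', W y -> W y' ->
  kappa * `|theta y - theta y'| <= `|quad_map (theta y) - quad_map (theta y')|.

(** Solving the exact expansion for the increment d of [theta] leaves the error [beta d d *m K],
    which is of second order in h because [thetaL] bounds |d| by a multiple of |h|. *)
Lemma quad_inverse_derive y i : W y -> differentiable (fun y => theta y 0 i) y /\
  forall w, 'D_w (fun y => theta y 0 i) y = (w *m (E *m invmx (quad_jac (theta y)))) 0 i.
Proof.
move=> Wy; set K := invmx _.
pose L (w : 'rV[R]_m) : R := (w *m (E *m K)) 0 i.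
have Llin : linear (L : 'rV[R]_m -> R).
  by move=> a u v; rewrite /L mulmxDl -scalemxAl !mxE.
pose LL : {linear 'rV[R]_m -> R} := HB.pack L (GRing.isLinear.Build R _ R _ L Llin).
have Lc : continuous L.
  apply: lipb_ball_continuous => r r0.
  by apply: lipb_mulmx => j; exact: lipb_ball_coord.
have [C C0 betaC] := beta_norm_le.
have [B B0 KB] := mulmx_norm_le K.
have [B1 B10 EB] := mulmx_norm_le E.
pose M := B1 / kappa.
have M0 : 0 < M by rewrite divr_gt0.
apply: (@quadratic_differentiable _ _ _ _ _ LL (B * C * M ^+ 2)) => //.
  by apply: mulr_ge0; [apply: mulr_ge0; exact: ltW|exact: sqr_ge0].
have Wnear : \forall z \near y, W z by exact: open_nbhs_nbhs.
move: Wnear; rewrite (near_shift 0) subr0.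
apply: filterS => h /= Wh.
set d := theta (h + y) - theta y.
have hE : h *m E = d *m quad_jac (theta y) + beta d d.
  have : quad_map (theta (h + y)) = quad_map (theta y) + d *m quad_jac (theta y) + beta d d.
    by rewrite -quad_map_add /d [theta y + _]addrC subrK.
  rewrite !thetaP // mulmxDl => e.
  by apply: (addrI (y *m E + k0)); rewrite addrA -e addrC addrA addrAC.
have dM : `|d| <= M * `|h|.
  have := thetaL Wh Wy; rewrite -/d !thetaP // mulmxDl.
  have -> : h *m E + y *m E + k0 - (y *m E + k0) = h *m E.
    by rewrite -[h *m E + _ + _]addrA addrK.
  move=> hk; rewrite /M mulrAC ler_pdivlMr // mulrC; exact: le_trans hk (EB h).
have -> : theta (h + y) 0 i - theta y 0 i - L h = - (beta d d *m K) 0 i.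
  have -> : L h = (d + beta d d *m K) 0 i.
    by rewrite /L mulmxA hE mulmxDl mulmxK ?thetaJ.
  by rewrite /d !mxE; ring.
rewrite normrN; apply: le_trans (coord_le_norm _ _) _.
apply: le_trans (KB _) _; rewrite -!mulrA ler_wpM2l ?(ltW B0) //.
apply: le_trans (betaC _ _) _; rewrite -mulrA ler_wpM2l ?(ltW C0) //.
by apply: le_trans (ler_pM _ _ dM dM) _ => //; rewrite le_eqVlt; apply/orP; left; apply/eqP; rewrite /M; ring.
Qed.

Lemma Ck_quad_jac k i j : (forall i, Ck W k (fun y => theta y 0 i)) ->
  Ck W k (fun y => quad_jac (theta y) i j).
Proof.
move=> tC.
rewrite (_ : (fun y => _) = fun y => ell (delta_mx 0 i) 0 j +
   (\sum_l theta y 0 l * beta (delta_mx 0 l) (delta_mx 0 i) 0 j +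
    \sum_l theta y 0 l * beta (delta_mx 0 i) (delta_mx 0 l) 0 j)); last first.
  apply/funext => y; rewrite !mxE -addrA; congr (_ + (_ + _)).
    by rewrite (linear_sum_delta (betal _)) summxE; apply: eq_bigr => l _; rewrite mxE.
  by rewrite (linear_sum_delta (betar _)) summxE; apply: eq_bigr => l _; rewrite mxE.
apply: Ck_add => //; first exact: Ck_cst.
by apply: Ck_add => //; apply: Ck_sum => // l; apply: Ck_mul => //; exact: Ck_cst.
Qed.

(** Bootstrapping: the derivative of [theta] is a rational function of [theta], so each order of
    differentiability yields the next. *)
Lemma quad_inverse_smooth k i : Ck W k (fun y => theta y 0 i).
Proof.
elim: k i => [//|k IH] i; split=> [y Wy|w]; first by case: (quad_inverse_derive i Wy).
pose F y := (w *m (E *m invmx (quad_jac (theta y)))) 0 i.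
apply: (@Ck_ext _ _ _ _ F) => // [y Wy|].
  by case: (quad_inverse_derive i Wy) => _ ->.
rewrite (_ : F = fun y => \sum_j (w *m E) 0 j * invmx (quad_jac (theta y)) j i); last first.
  by apply/funext => y; rewrite /F mulmxA mxE.
apply: Ck_sum => // j; apply: Ck_mul => //; first exact: Ck_cst.
by apply: Ck_invmx => // a b; apply: Ck_quad_jac.
Qed.

End SmoothInverse.

End QuadraticMap.

(** * The optimal point in a given direction *)

Lemma le0_of_quadratic (R : realType) (a b : R) :
  (forall t, 0 < t -> t <= 1 -> 0 <= 2 * t * a + t ^+ 2 * b) -> 0 <= a.
Proof.
move=> h; rewrite leNgt; apply/negP => a0.
have h1 : 0 < `|b| + 1 by rewrite ltr_wpDl.
pose t := Num.min 1 (- a / (`|b| + 1)).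
have t0 : 0 < t by rewrite lt_min ltr01 divr_gt0 ?oppr_gt0.
have t1 : t <= 1 by rewrite ge_min lexx.
have t2 : t * (`|b| + 1) <= - a by rewrite -ler_pdivlMr // ge_min lexx orbT.
have := h t t0 t1.
have bb : b <= `|b| by exact: ler_norm.
have : t * b <= - a by nra.
have -> : 2 * t * a + t ^+ 2 * b = t * (2 * a + t * b) by ring.
rewrite pmulr_rge0 //; lra.
Qed.

(** Minimise the convex function x B x - 2 u . x over the ball, which is convex, instead of the
    sphere. Its free minimiser [w] lies outside, so half the gradient g at the constrained minimiser
    x is nonzero; testing the variational inequality with - g / |g| forces equality in
    Cauchy-Schwarz, that is g = - |g| x and |x| = 1. The multiplier [nu] is |g|. *)
Lemma ball_minimizer (R : realType) n (B : 'M[R]_n) (e : R) (u w : 'rV[R]_n) :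
  B^T = B -> 0 < e -> (forall z, e * dot z z <= dot (z *m B) z) ->
  w *m B = u -> 1 < dot w w ->
  exists x nu, [/\ 0 <= nu, dot x x = 1 & x *m (B + nu%:M) = u].
Proof.
move=> Bsym e0 Bpos wB w1.
have symB x y : dot (x *m B) y = dot (y *m B) x by rewrite dotMl Bsym dotC.
pose A := [set x : 'rV[R]_n | dot x x <= 1].
have A1 x : A x -> `|x| <= 1.
  by move=> Ax; apply: le_trans (norm_le_nrm _) _; rewrite -sqrtr1 ler_wsqrtr.
have Acpt : compact A by apply: compact_box A1; exact: closed_le_fun (@continuous_dotxx R n).
pose q x := dot (x *m B) x - 2 * dot u x.
have cl i : lipb A (fun x => x 0 i) by apply: lipb_coord A1 ler01.
have ql : lipb A q.
  apply: lipb_sub; first by apply: lipb_dot => // i; exact: lipb_mulmx.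
  apply: lipb_mul; first exact: lipb_cst.
  by apply: lipb_dot => // i; exact: lipb_cst.
have A0 : A !=set0 by exists 0; rewrite /A /= dot0l ler01.
have [x Ax xmin] := lipb_min_attained Acpt A0 ql.
pose g := x *m B - u.
have var y : A y -> 0 <= dot g (y - x).
  move=> Ay; apply: (@le0_of_quadratic _ _ (dot ((y - x) *m B) (y - x))) => t t0 t1.
  have At : A (x + t *: (y - x)).
    have -> : x + t *: (y - x) = (1 - t) *: x + t *: y.
      by apply/rowP => j; rewrite !mxE; ring.
    rewrite /A /= !(dotDl, dotDr, dotZl, dotZr) (dotC y x).
    have xx : dot x x <= 1 by []. have yy : dot y y <= 1 by [].
    have xy : dot x y <= 1.
      have : 0 <= dot (x - y) (x - y) by exact: dot_ge0.
      rewrite !(dotBl, dotBr) (dotC y x); lra.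
    have h1 : (1 - t) * ((1 - t) * dot x x) <= (1 - t) * ((1 - t) * 1).
      by rewrite !ler_wpM2l // subr_ge0.
    have h2 : (1 - t) * (t * dot x y) <= (1 - t) * (t * 1).
      by rewrite !ler_wpM2l // ?subr_ge0 // ltW.
    have h3 : t * (t * dot y y) <= t * (t * 1) by rewrite !ler_wpM2l // ltW.
    have h4 : t * ((1 - t) * dot x y) <= t * ((1 - t) * 1).
      by rewrite !ler_wpM2l // ?subr_ge0 // ltW.
    lra.
  have := xmin _ At; rewrite -subr_ge0; congr (0 <= _).
  rewrite /q /g; move: (y - x) => d.
  rewrite mulmxDl -scalemxAl !(dotDl, dotDr, dotZl, dotZr, dotNl) (symB d x).
  ring.
have Binj (z : 'rV[R]_n) : z *m B = 0 -> z = 0.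
  move=> zB; apply/eqP; rewrite -dot_eq0 eq_le dot_ge0 andbT.
  by have := Bpos z; rewrite zB dot0l pmulr_rle0.
have g0 : g != 0.
  apply/eqP => g0; have : x - w = 0 by apply: Binj; rewrite mulmxBl wB.
  by move=> /eqP; rewrite subr_eq0 => /eqP xw; move: w1; rewrite -xw ltNge Ax.
have ng := nrm_gt0 g0.
have gx : dot g x <= - nrm g.
  have : A (- (nrm g)^-1 *: g).
    rewrite /A /= dotZl dotZr -nrm_sqr.
    by rewrite (_ : _ * _ = 1) // ; field; rewrite gt_eqF.
  move=> /var; rewrite dotBr dotZr -nrm_sqr subr_ge0 => /le_trans; apply.
  by rewrite le_eqVlt; apply/orP; left; apply/eqP; field; rewrite gt_eqF.
have gdef : g = x *m B - u by [].
move: g gdef g0 ng gx {var} => g gdef g0 ng gx.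
have gE : g = - nrm g *: x.
  apply/eqP; rewrite -subr_eq0 -dot_eq0 eq_le dot_ge0 andbT scaleNr opprK.
  rewrite !(dotDl, dotDr, dotZl, dotZr) (dotC x g) -nrm_sqr.
  have xx : dot x x <= 1 by [].
  set a := nrm g in ng gx *; set b := dot g x in gx *; set s := dot x x in xx *.
  have h1 : a * (a * s) <= a * (a * 1) by rewrite !ler_wpM2l // ltW.
  have h2 : a * b <= a * - a by rewrite ler_wpM2l // ltW.
  nra.
exists x, (nrm g); split; first exact: nrm_ge0.
  have := nrm_sqr g; rewrite {2 3}gE dotZl dotZr mulrA mulrNN -expr2.
  move=> /esym/eqP; rewrite -[X in _ == X]mulr1 (inj_eq (mulfI _)) => [/eqP //|].
  by rewrite sqrf_eq0 gt_eqF.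
rewrite mulmxDr mul_mx_scalar; have := gE; rewrite {1}gdef scaleNr => /eqP.
by rewrite subr_eq => /eqP ->; rewrite addrAC addNr add0r.
Qed.

Lemma quadform_bound (R : realType) n (M : 'M[R]_n) :
  exists2 C, 0 < C & forall z, `|dot (z *m M) z| <= C * dot z z.
Proof.
have [B B0 MB] := mulmx_norm_le M.
exists ((n%:R + 1) * B) => [|z]; first by rewrite mulr_gt0 // ltr_wpDl.
apply: le_trans (normr_dot_le _ _) _; rewrite -nrm_sqr expr2 mulrA ler_wpM2r ?nrm_ge0 //.
apply: le_trans (nrm_le_norm _) _.
apply: (@le_trans _ _ (n%:R * (B * nrm z))).
  rewrite ler_wpM2l //; apply: le_trans (MB z) _.
  by rewrite ler_wpM2l ?norm_le_nrm // ltW.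
rewrite mulrDl mul1r mulrDl mulrA lerDl mulr_ge0 ?nrm_ge0 // ltW //.
Qed.

Lemma interior_normP (R : realType) (W : normedModType R) (S : set W) x :
  (S°) x <-> exists2 e, 0 < e & forall y, `|x - y| < e -> S y.
Proof.
split=> [/nbhs_normP [e e0 h]|[e e0 h]]; first by exists e.
by apply/nbhs_normP; exists e.
Qed.

Lemma left_kernel_ex (R : fieldType) p q (B : 'M[R]_(p, q)) : (q < p)%N ->
  exists2 u : 'rV[R]_p, u != 0 & u *m B = 0.
Proof.
move=> qp; have : kermx B != 0.
  rewrite -mxrank_eq0 mxrank_ker subn_eq0 -ltnNge.
  exact: leq_ltn_trans (rank_leq_col _) qp.
move=> /rowV0Pn [u uB u0]; exists u => //; exact/sub_kermxP.
Qed.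

Lemma unit_scale (R : realType) n (c : 'rV[R]_n) : c != 0 ->
  dot ((nrm c)^-1 *: c) ((nrm c)^-1 *: c) = 1.
Proof.
move=> c0; rewrite dotZl dotZr -nrm_sqr.
by have := nrm_gt0 c0 => h; field; rewrite gt_eqF.
Qed.

Section Pencil.
Variables (R : realType) (m N : nat).
Variables (A : 'I_m -> 'M[R]_N) (v : 'I_m -> 'rV[R]_N).
Local Notation Vm := 'rV[R]_m.
Local Notation VN := 'rV[R]_N.
Implicit Types (c d y : Vm) (x z : VN) (mu s t : R).

Definition mcomb c : 'M[R]_N := \sum_i c 0 i *: A i.
Definition vcomb c : VN := \sum_i c 0 i *: v i.
Definition pencil c mu : 'M[R]_N := mcomb c + mu%:M.
(** The map f in real form, where its two linear terms coincide. *)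
Definition qmap x : Vm := \row_i (dot (x *m A i) x - 2 * dot (v i) x).

Lemma mcombD c d : mcomb (c + d) = mcomb c + mcomb d.
Proof. by rewrite /mcomb -big_split; apply: eq_bigr => i _; rewrite mxE scalerDl. Qed.
Lemma mcombZ s c : mcomb (s *: c) = s *: mcomb c.
Proof. by rewrite /mcomb scaler_sumr; apply: eq_bigr => i _; rewrite mxE scalerA. Qed.
Lemma vcombD c d : vcomb (c + d) = vcomb c + vcomb d.
Proof. by rewrite /vcomb -big_split; apply: eq_bigr => i _; rewrite mxE scalerDl. Qed.
Lemma vcombZ s c : vcomb (s *: c) = s *: vcomb c.
Proof. by rewrite /vcomb scaler_sumr; apply: eq_bigr => i _; rewrite mxE scalerA. Qed.
Lemma pencilD c d s t : pencil (c + d) (s + t) = pencil c s + pencil d t.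
Proof. by rewrite /pencil mcombD raddfD addrACA. Qed.
Lemma pencilZ s c t : pencil (s *: c) (s * t) = s *: pencil c t.
Proof. by rewrite /pencil mcombZ scalerDr scale_scalar_mx. Qed.

Lemma pencilDr c s t : pencil c (s + t) = pencil c s + t%:M.
Proof. by rewrite /pencil raddfD addrA. Qed.

Lemma mul_pencil x c mu : x *m pencil c mu = x *m mcomb c + mu *: x.
Proof. by rewrite mulmxDr mul_mx_scalar. Qed.

Lemma dot_suml n (I : finType) (F : I -> 'rV[R]_n) (x : 'rV[R]_n) :
  dot (\sum_i F i) x = \sum_i dot (F i) x.
Proof.
by elim/big_ind2 : _ => [|a b c d <- <-|i _]; rewrite ?dot0l ?dotDl.
Qed.

Lemma dot_qmap c x : dot c (qmap x) = dot (x *m mcomb c) x - 2 * dot (vcomb c) x.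
Proof.
rewrite /mcomb mulmx_sumr /vcomb !dot_suml mulr_sumr -sumrB.
by apply: eq_bigr => i _; rewrite mxE -scalemxAr !dotZl; ring.
Qed.

End Pencil.

(** * The stationarity equations as one quadratic map *)

Section Lagrange.
Variables (R : realType) (m N : nat).
Variables (A : 'I_m -> 'M[R]_N) (v : 'I_m -> 'rV[R]_N).
Local Notation Vm := 'rV[R]_m.
Local Notation VN := 'rV[R]_N.
Local Notation VD := 'rV[R]_((m + 1) + (N + 1)).
Implicit Types (c d y : Vm) (x z : VN) (mu s : R) (t : VD).

Definition pack c mu x s : VD := row_mx (row_mx c mu%:M) (row_mx x s%:M).
Definition pc t : Vm := lsubmx (lsubmx t).
Definition pm t : R := rsubmx (lsubmx t) 0 0.
Definition px t : VN := lsubmx (rsubmx t).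
Definition ps t : R := rsubmx (rsubmx t) 0 0.

Lemma pcK c mu x s : pc (pack c mu x s) = c.
Proof. by rewrite /pc !row_mxKl. Qed.
Lemma pmK c mu x s : pm (pack c mu x s) = mu.
Proof. by rewrite /pm row_mxKl row_mxKr mxE eqxx mulr1n. Qed.
Lemma pxK c mu x s : px (pack c mu x s) = x.
Proof. by rewrite /px row_mxKr row_mxKl. Qed.
Lemma psK c mu x s : ps (pack c mu x s) = s.
Proof. by rewrite /ps !row_mxKr mxE eqxx mulr1n. Qed.
Lemma packK t : pack (pc t) (pm t) (px t) (ps t) = t.
Proof. by rewrite /pack /pc /pm /px /ps -!mx11_scalar !hsubmxK. Qed.

Lemma pcP (a : R) t t' : pc (a *: t + t') = a *: pc t + pc t'.
Proof. by rewrite /pc !linearP. Qed.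
Lemma pmP (a : R) t t' : pm (a *: t + t') = a * pm t + pm t'.
Proof. by rewrite /pm !linearP !mxE. Qed.
Lemma pxP (a : R) t t' : px (a *: t + t') = a *: px t + px t'.
Proof. by rewrite /px !linearP. Qed.
Lemma psP (a : R) t t' : ps (a *: t + t') = a * ps t + ps t'.
Proof. by rewrite /ps !linearP !mxE. Qed.

Lemma packP (a : R) c mu x s c' mu' x' s' :
  pack (a *: c + c') (a * mu + mu') (a *: x + x') (a * s + s') =
  a *: pack c mu x s + pack c' mu' x' s'.
Proof.
rewrite -[RHS]packK pcP pmP pxP psP !pcK !pmK !pxK !psK //.
Qed.

Lemma packD c mu x s c' mu' x' s' :
  pack c mu x s + pack c' mu' x' s' = pack (c + c') (mu + mu') (x + x') (s + s').
Proof. by rewrite -[X in X + _]scale1r -packP !scale1r !mul1r. Qed.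

Lemma packB c mu x s c' mu' x' s' :
  pack c mu x s - pack c' mu' x' s' = pack (c - c') (mu - mu') (x - x') (s - s').
Proof.
by rewrite addrC -scaleN1r -packP !scaleN1r !mulN1r ![- _ + _]addrC.
Qed.

Lemma pack0 : pack 0 0 0 0 = 0.
Proof. by rewrite -[RHS](subrr (pack 0 0 0 0)) packB !subr0. Qed.

Lemma pack_inj c mu x s c' mu' x' s' : pack c mu x s = pack c' mu' x' s' ->
  [/\ c = c', mu = mu', x = x' & s = s'].
Proof.
move=> h; split.
- by have := congr1 pc h; rewrite !pcK.
- by have := congr1 pm h; rewrite !pmK.
- by have := congr1 px h; rewrite !pxK.
- by have := congr1 ps h; rewrite !psK.
Qed.

Lemma row_mx_norm_le (p q : nat) (a : 'rV[R]_p) (b : 'rV[R]_q) r : 0 <= r ->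
  (`|row_mx a b| <= r) <-> (`|a| <= r /\ `|b| <= r).
Proof.
move=> r0; split=> [h|[ha hb]].
  split; apply/rV_norm_le => // i.
    by rewrite -(row_mxEl a b); apply: le_trans (coord_le_norm _ _) h.
  by rewrite -(row_mxEr a b); apply: le_trans (coord_le_norm _ _) h.
apply/rV_norm_le => // i; case: (split_ordP i) => j ->.
  by rewrite row_mxEl; apply: le_trans (coord_le_norm _ _) ha.
by rewrite row_mxEr; apply: le_trans (coord_le_norm _ _) hb.
Qed.

Lemma scalar11_norm_le (s r : R) : 0 <= r -> (`|s%:M : 'rV[R]_1| <= r) <-> (`|s| <= r).
Proof.
move=> r0; split=> [/(rV_norm_le _ r0) /(_ 0)|h]; first by rewrite mxE eqxx mulr1n.
by apply/rV_norm_le => // i; rewrite ord1 mxE eqxx mulr1n.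
Qed.

Lemma pack_norm_le c mu x s r : 0 <= r ->
  (`|pack c mu x s| <= r) <-> [/\ `|c| <= r, `|mu| <= r, `|x| <= r & `|s| <= r].
Proof.
move=> r0; rewrite /pack; split.
  move=> /(row_mx_norm_le _ _ r0) [/(row_mx_norm_le _ _ r0) [h1 h2] /(row_mx_norm_le _ _ r0) [h3 h4]].
  by split=> //; [exact: (scalar11_norm_le _ r0).1|exact: (scalar11_norm_le _ r0).1].
move=> [h1 h2 h3 h4]; apply/row_mx_norm_le => //; split; apply/row_mx_norm_le => //.
  by split=> //; apply/scalar11_norm_le.
by split=> //; apply/scalar11_norm_le.
Qed.

Lemma part_norm_le t : [/\ `|pc t| <= `|t|, `|pm t| <= `|t|, `|px t| <= `|t| & `|ps t| <= `|t|].
Proof. by apply: (pack_norm_le _ _ _ _ (normr_ge0 t)).1; rewrite packK. Qed.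

Variable c0 : Vm.

(* Solutions of quad_map t = pack y 1 0 1 are the c, mu, x, s with
   c . c0 = 1, |x| = 1, x stationary for c . qmap with multiplier mu, and
   y = qmap x + s c0. *)
Definition lag_lin t : VD :=
  pack (ps t *: c0 - 2 *: (\row_i dot (v i) (px t))) (dot (pc t) c0) (- vcomb v (pc t)) 0.
Definition lag_bil t t' : VD :=
  pack (\row_i dot (px t *m A i) (px t')) 0 (px t *m mcomb A (pc t') + pm t' *: px t)
    (dot (px t) (px t')).

Lemma lag_lin_linear : linear lag_lin.
Proof.
move=> a t t'; rewrite /lag_lin pcP pxP psP -packP; congr pack.
- by apply/rowP => i; rewrite !mxE dotDr dotZr; ring.
- by rewrite dotDl dotZl.
- by rewrite vcombD vcombZ opprD scalerN.
- by rewrite mulr0 addr0.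
Qed.

Lemma lag_bil_linearl t' : linear (lag_bil ^~ t').
Proof.
move=> a t t2; rewrite /lag_bil pxP -packP; congr pack.
- by apply/rowP => i; rewrite !mxE mulmxDl -scalemxAl dotDl dotZl.
- by rewrite mulr0 addr0.
- rewrite mulmxDl -scalemxAl scalerDr; apply/rowP => j; rewrite !mxE; ring.
- by rewrite dotDl dotZl.
Qed.

Lemma lag_bil_linearr t : linear (lag_bil t).
Proof.
move=> a t1 t2; rewrite /lag_bil pxP pcP pmP -packP; congr pack.
- by apply/rowP => i; rewrite !mxE dotDr dotZr.
- by rewrite mulr0 addr0.
- rewrite mcombD mcombZ mulmxDr -scalemxAr; apply/rowP => j; rewrite !mxE; ring.
- by rewrite dotDr dotZr.
Qed.

Definition lag := quad_map lag_lin lag_bil.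
Definition lag_jac := quad_jac lag_lin lag_bil.

Lemma lagE c mu x s : lag (pack c mu x s) =
  pack (qmap A v x + s *: c0) (dot c c0) (x *m pencil A c mu - vcomb v c) (dot x x).
Proof.
rewrite /lag /quad_map /lag_lin /lag_bil !pcK !pmK !pxK !psK packD; congr pack.
- by apply/rowP => i; rewrite !mxE; ring.
- by rewrite addr0.
- by rewrite mul_pencil addrC.
- by rewrite add0r.
Qed.

Definition dqmap x z : Vm := \row_i (2 * (dot (x *m A i) z - dot (v i) z)).

Lemma dot_dqmap d x z : dot d (dqmap x z) =
  2 * (dot (x *m mcomb A d) z - dot (vcomb v d) z).
Proof.
rewrite /mcomb mulmx_sumr /vcomb !dot_suml -sumrB mulr_sumr.
by apply: eq_bigr => i _; rewrite mxE -scalemxAr !dotZl; ring.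
Qed.

Hypothesis Asym : forall i, (A i)^T = A i.

Lemma lag_jacE c mu x s d nu z u : pack d nu z u *m lag_jac (pack c mu x s) =
  pack (dqmap x z + u *: c0) (dot d c0)
    (z *m pencil A c mu + (x *m pencil A d nu - vcomb v d)) (2 * dot x z).
Proof.
rewrite /lag_jac mul_quad_jac; last 3 first.
- exact: lag_lin_linear.
- exact: lag_bil_linearl.
- exact: lag_bil_linearr.
rewrite /lag_lin /lag_bil !pcK !pmK !pxK !psK !packD; congr pack.
- apply/rowP => i; rewrite !mxE.
  have -> : dot (z *m A i) x = dot (x *m A i) z by rewrite dotMl Asym dotC.
  ring.
- by rewrite !addr0.
- rewrite !mul_pencil; apply/rowP => j; rewrite !mxE; ring.
- by rewrite (dotC z x); ring.
Qed.

End Lagrange.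

Lemma open_norm_ball (R : realType) (V : normedModType R) (p : V) r :
  open [set y | `|y - p| < r].
Proof.
rewrite openE => y /= yr; apply/interior_normP; exists (r - `|y - p|); first by rewrite subr_gt0.
move=> z yz; rewrite /= (_ : z - p = (y - p) - (y - z)).
  by apply: le_lt_trans (ler_normB _ _) _; lra.
by rewrite opprB [RHS]addrC addrA subrK.
Qed.

Lemma derive_lincomb (R : realType) (V : normedModType R) n (f : 'I_n -> V -> R)
    (a : 'I_n -> R) x w : (forall i, differentiable (f i) x) ->
  'D_w (fun y => \sum_i f i y * a i) x = \sum_i 'D_w (f i) x * a i.
Proof.
move=> df; rewrite (_ : (fun y => _) = \sum_(i < n) (a i *: f i)); last first.
  by apply/funext => y; rewrite fct_sumE; apply: eq_bigr => i _; rewrite mulrC.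
rewrite derive_sum => [|i]; last by apply: derivableZ; exact: diff_derivable.
by apply: eq_bigr => i _; rewrite deriveZ; [rewrite mulrC|exact: diff_derivable].
Qed.

Lemma derive_at_max (R : realType) (V : normedModType R) (f : V -> R) p w r : 0 < r ->
  (forall y, `|y - p| < r -> differentiable f y) ->
  (forall y, `|y - p| < r -> f y <= f p) -> 'D_w f p = 0.
Proof.
move=> r0 df fmax; pose phi (t : R) := f (t *: w + p).
pose e := r / (`|w| + 1).
have w1 : 0 < `|w| + 1 by rewrite ltr_wpDl.
have e_gt0 : 0 < e by rewrite divr_gt0.
have near_p t : t \in `]- e, e[ -> `|t *: w + p - p| < r.
  rewrite in_itv /= -ltr_norml addrK normrZ /e ltr_pdivlMr // => te.
  by apply: le_lt_trans te; rewrite ler_wpM2l // lerDl.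
have shiftE t : (fun h : R => h^-1 *: (phi (h *: 1 + t) - phi t)) =
    (fun h : R => h^-1 *: (f (h *: w + (t *: w + p)) - f (t *: w + p))).
  apply/funext => h; rewrite /phi; congr (_ *: (f _ - _)).
  by rewrite scalerDl addrA -[h *: (1 : R)]/(h * 1) mulr1.
have [_] : is_derive (0 : R) 1 phi 0.
  apply: (@derive1_at_max _ phi (- e) e 0).
  - by rewrite ge0_cp // ltW.
  - move=> t te; rewrite /derivable shiftE.
    have : derivable f (t *: w + p) w by apply: diff_derivable; exact/df/near_p.
    by [].
  - by rewrite in_itv /= oppr_lt0 e_gt0.
  - by move=> t te; rewrite /phi scale0r add0r; apply: fmax; exact: near_p.
by rewrite /derive shiftE scale0r add0r.
Qed.

Lemma convex_setP (R : realType) m (S : set 'rV[R]_m) : @convex_set R 'rV[R]_m S <->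
  (forall x y (a : R), 0 <= a -> a <= 1 -> S x -> S y -> S (a *: x + (1 - a) *: y)).
Proof.
split=> [h x y a a0 a1 Sx Sy|h x y a /set_mem Sx /set_mem Sy].
  exact: set_mem (h x y (Itv01 a0 a1) (mem_set Sx) (mem_set Sy)).
have a0 : 0 <= a%:num by [].
have a1 : a%:num <= 1 by [].
exact: mem_set (h x y a%:num a0 a1 Sx Sy).
Qed.

Lemma derive_translate (R : realType) m (f : 'rV[R]_m -> R) p w x :
  'D_w (fun u : 'rV[R]_m => f (p + u)) x = 'D_w f (p + x).
Proof.
rewrite /derive; apply: (congr1 (fun F : R -> R => lim (F h @[h --> 0^']))).
by apply/funext => h; rewrite /= addrCA.
Qed.

Lemma Ck_shift (R : realType) m (W : set 'rV[R]_m) (p : 'rV[R]_m) k g :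
  Ck W k g -> Ck [set u | W (p + u)] k (fun u => g (p + u)).
Proof.
elim: k g => [//|k IH] g [dg Dg]; split=> [x Wx|w].
  apply: (@differentiable_comp _ _ _ _ (fun u => p + u) g); last exact: dg.
  by apply: differentiableD.
rewrite (_ : 'D_w _ = fun u => 'D_w g (p + u)); first exact: IH (Dg w).
by apply/funext => x; rewrite derive_translate.
Qed.

Section RealSystem.
Variables (R : realType) (m N : nat).
Variables (A : 'I_m -> 'M[R]_N) (v : 'I_m -> 'rV[R]_N).
Local Notation Vm := 'rV[R]_m.
Local Notation VN := 'rV[R]_N.
Local Notation mcomb := (mcomb A).
Local Notation vcomb := (vcomb v).
Local Notation pencil := (pencil A).
Local Notation qmap := (qmap A v).
Implicit Types (c d y : Vm) (x z : VN) (mu s t : R).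

Hypothesis Asym : forall i, (A i)^T = A i.

Lemma mcomb_sym c : (mcomb c)^T = mcomb c.
Proof.
by rewrite /mcomb linear_sum; apply: eq_bigr => i _; rewrite linearZ /= Asym.
Qed.

Lemma pencil_sym c mu : (pencil c mu)^T = pencil c mu.
Proof. by rewrite /pencil linearD /= mcomb_sym tr_scalar_mx. Qed.

Lemma pencil_dotC c mu x z : dot (x *m pencil c mu) z = dot (z *m pencil c mu) x.
Proof. by rewrite dotMl pencil_sym dotC. Qed.

(** On the sphere mu |x|^2 is constant and the linear terms cancel because x is stationary.
    Uniqueness of the optimal point, its Lipschitz dependence on c and the support inequality all
    rest on this identity. *)
Lemma qmap_gap c mu x z : dot x x = 1 -> dot z z = 1 -> x *m pencil c mu = vcomb c ->
  dot c (qmap z) - dot c (qmap x) = dot ((z - x) *m pencil c mu) (z - x).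
Proof.
move=> xx zz xM; rewrite mulmxBl xM !(dotBl, dotBr) (pencil_dotC c mu z x) xM.
rewrite !dot_qmap.
have -> : dot (z *m mcomb c) z = dot (z *m pencil c mu) z - mu.
  by rewrite mul_pencil dotDl dotZl zz; ring.
have -> : dot (x *m mcomb c) x = dot (vcomb c) x - mu.
  by rewrite -xM mul_pencil dotDl dotZl xx; ring.
ring.
Qed.

Lemma qmap_lip : exists2 L, 0 < L &
  forall x z, sphere x -> sphere z -> nrm (qmap x - qmap z) <= L * nrm (x - z).
Proof.
have [K K0 HK] : exists2 K : R, 0 <= K & forall x z, sphere x -> sphere z ->
    `|qmap x - qmap z| <= K * `|x - z|.
  apply: lipb_vec => i; rewrite (_ : (fun x => _) =
    fun x => dot (x *m A i) x - 2 * dot (v i) x); last by apply/funext => x; rewrite mxE.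
  have cl j : lipb sphere (fun x : VN => x 0 j).
    exact: lipb_coord (@sphere_norm_le _ _) ler01.
  apply: lipb_sub; first by apply: lipb_dot => // j; exact: lipb_mulmx.
  apply: lipb_mul; first exact: lipb_cst.
  by apply: lipb_dot => // j; exact: lipb_cst.
exists (m%:R * K + 1) => [|x z xS zS]; first by rewrite ltr_wpDl // mulr_ge0.
apply: le_trans (nrm_le_norm _) _.
apply: (@le_trans _ _ (m%:R * K * nrm (x - z))); last first.
  by rewrite ler_wpM2r ?nrm_ge0 // lerDl.
rewrite -mulrA ler_wpM2l //; apply: le_trans (HK x z xS zS) _.
by rewrite ler_wpM2l // norm_le_nrm.
Qed.

Variable e0 : R.
Hypothesis e0_gt0 : 0 < e0.
Hypothesis m_gt0 : (0 < m)%N.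
(** The hypothesis of the theorem at epsilon = [e0]: [lam] stands for the smallest eigenvalue, of
    which only the lower bound on the form is kept, and [w] for the resolvent applied to c . v. *)
Hypothesis coercive : forall c, dot c c = 1 -> exists lam w,
  [/\ forall z, lam * dot z z <= dot (z *m mcomb c) z,
      w *m pencil c (e0 - lam) = vcomb c & 1 < dot w w].

(** The factor [nrm c] makes the condition invariant under positive scaling of (c, mu), so it can be
    stated for all c; at c = 0 every unit vector is optimal, with mu = 0. *)
Definition optimal c x mu := [/\ dot x x = 1, x *m pencil c mu = vcomb c &
  forall z, e0 * nrm c * dot z z <= dot (z *m pencil c mu) z].

Lemma optimal_unit_ex c : dot c c = 1 -> exists x mu, optimal c x mu.
Proof.
move=> cc; have [lam [w [lamP wP w1]]] := coercive cc.
have Bpos z : e0 * dot z z <= dot (z *m pencil c (e0 - lam)) z.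
  by rewrite mul_pencil dotDl dotZl; have := lamP z; lra.
have [x [nu [nu0 xx xP]]] := ball_minimizer (pencil_sym c (e0 - lam)) e0_gt0 Bpos wP w1.
exists x, (e0 - lam + nu); split=> // [|z].
  by rewrite pencilDr.
rewrite /nrm cc sqrtr1 mulr1 pencilDr mulmxDr mul_mx_scalar dotDl dotZl; apply: le_trans (Bpos z) _.
by rewrite lerDl mulr_ge0 // dot_ge0.
Qed.

Lemma optimal_ex c : exists p : VN * R, optimal c p.1 p.2.
Proof.
have [->|c0] := eqVneq c 0.
  pose c1 : Vm := delta_mx 0 (Ordinal m_gt0).
  have c1n : c1 != 0.
    apply/eqP => /rowP /(_ (Ordinal m_gt0)); rewrite !mxE !eqxx /= => /eqP.
    by rewrite oner_eq0.
  have [x [mu [xx _ _]]] := optimal_unit_ex (unit_scale c1n).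
  have p0 : pencil 0 0 = 0.
    by rewrite /pencil raddf0 addr0 -(scale0r 0) mcombZ scale0r.
  exists (x, 0); split=> //=.
    by rewrite p0 mulmx0 -[X in vcomb X](scale0r (0 : Vm)) vcombZ scale0r.
  by move=> z; rewrite p0 mulmx0 dot0l /nrm dot0l sqrtr0 mulr0 mul0r.
have [x [mu [xx xM pos]]] := optimal_unit_ex (unit_scale c0).
have nc := nrm_gt0 c0.
have cE : c = nrm c *: ((nrm c)^-1 *: c) by rewrite scalerA mulfV ?gt_eqF // scale1r.
have pE : pencil c (nrm c * mu) = nrm c *: pencil ((nrm c)^-1 *: c) mu.
  by rewrite -pencilZ -cE.
exists (x, nrm c * mu); split=> //=.
  by rewrite pE -scalemxAr xM -vcombZ -cE.
move=> z; rewrite pE -scalemxAr dotZl mulrAC mulrC ler_wpM2l ?nrm_ge0 //.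
have := pos z; rewrite nrmZ normfV ger0_norm ?nrm_ge0 // mulVf ?gt_eqF //.
by rewrite mulr1.
Qed.

Definition argopt c : VN := (projT1 (cid (optimal_ex c))).1.
Definition mult c : R := (projT1 (cid (optimal_ex c))).2.

Lemma optimalP c : optimal c (argopt c) (mult c).
Proof. exact: projT2 (cid (optimal_ex c)). Qed.

Local Notation X := argopt.

Lemma pencil_argopt_posdef c z : c != 0 -> z != 0 -> 0 < dot (z *m pencil c (mult c)) z.
Proof.
move=> c0 z0; have [_ _ pos] := optimalP c; apply: lt_le_trans (pos z).
by rewrite !mulr_gt0 ?nrm_gt0 ?dot_gt0.
Qed.

Lemma argopt_gap c z : dot z z = 1 ->
  e0 * nrm c * dot (z - X c) (z - X c) <= dot c (qmap z) - dot c (qmap (X c)).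
Proof.
move=> zz; have [xx xM pos] := optimalP c.
by rewrite (qmap_gap xx zz xM).
Qed.

(** If x and [X c] differed, the gap identity would give each a smaller value of dot c than the
    other. Only positive definiteness is assumed, whereas [X c] is coercive with constant
    [e0 * nrm c]: identifying the two is the self-improvement used below. *)
Lemma argopt_unique c x mu : c != 0 -> dot x x = 1 -> x *m pencil c mu = vcomb c ->
  (forall z, z != 0 -> 0 < dot (z *m pencil c mu) z) -> X c = x /\ mult c = mu.
Proof.
move=> c0 xx xM pos; have [yy yM ypos] := optimalP c.
have xy : X c = x.
  apply/eqP; rewrite -subr_eq0; apply/negPn/negP => d0.
  have := pos _ d0; rewrite -(qmap_gap xx yy xM) => h1.
  have := argopt_gap c xx; have := dot_ge0 (x - X c).
  have := nrm_gt0 c0 => h2 h3 h4.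
  have : 0 <= e0 * nrm c * dot (x - X c) (x - X c).
    by rewrite !mulr_ge0 // ?nrm_ge0 // ltW.
  lra.
split=> //; have : x *m pencil c (mult c) = x *m pencil c mu by rewrite -{1}xy yM xM.
rewrite !mul_pencil => /addrI /eqP; rewrite -subr_eq0 -scalerBl scaler_eq0.
case/orP => [|/eqP x0]; first by rewrite subr_eq0 => /eqP.
by move: xx; rewrite x0 dot0l => /eqP; rewrite eq_sym oner_eq0.
Qed.

Lemma argopt_sphere c : sphere (X c). Proof. by case: (optimalP c). Qed.

Lemma dot_argopt c : dot (X c) (X c) = 1. Proof. exact: argopt_sphere. Qed.

Lemma argopt_neq0 c : X c != 0.
Proof. by rewrite -dot_eq0 dot_argopt oner_eq0. Qed.

Lemma argoptZ s c : 0 < s -> c != 0 -> X (s *: c) = X c /\ mult (s *: c) = s * mult c.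
Proof.
move=> s0 c0; have [xx xM pos] := optimalP c.
apply: argopt_unique => //.
- by rewrite scaler_eq0 negb_or c0 gt_eqF.
- by rewrite pencilZ -scalemxAr xM vcombZ.
- by move=> z z0; rewrite pencilZ -scalemxAr dotZl mulr_gt0 ?pencil_argopt_posdef.
Qed.

(* The kernel of (c, mu) |-> X c *m pencil c mu - vcomb c is one-dimensional: along a
   line through the optimal pencil, positive definiteness self-improves to coercivity,
   so it could never be lost; but a nonconstant pencil cannot stay positive in both
   directions. *)
Lemma pencil_line_coercive c mu d nu : c != 0 -> optimal c (X c) mu ->
  X c *m pencil d nu = vcomb d -> dot c d = 0 ->
  forall s z, e0 * nrm (c + s *: d) * dot z z <=
    dot (z *m pencil (c + s *: d) (mu + s * nu)) z.
Proof.
move=> c0 [xx xM pos] xD cd.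
pose good s := forall z, e0 * nrm (c + s *: d) * dot z z <=
    dot (z *m pencil (c + s *: d) (mu + s * nu)) z.
have nge s : nrm c <= nrm (c + s *: d).
  rewrite ler_wsqrtr // !(dotDl, dotDr, dotZl, dotZr) (dotC d c) cd.
  by rewrite !mulr0 addr0 add0r lerDl mulrA -expr2 mulr_ge0 ?sqr_ge0 ?dot_ge0.
have cs0 s : c + s *: d != 0 by rewrite -nrm_eq0 gt_eqF // (lt_le_trans (nrm_gt0 c0)).
have [L L0 LP] := quadform_bound (pencil d nu).
(* A parameter step this short cannot destroy positive definiteness, which [argopt_unique] then
   upgrades to full coercivity. The admissible length does not shrink from step to step, since d is
   orthogonal to c and hence |c + s d| >= |c|. *)
have step s t : good s -> `|t - s| * L < e0 * nrm c -> good t.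
  move=> gs ts.
  have pE : pencil (c + t *: d) (mu + t * nu) =
      pencil (c + s *: d) (mu + s * nu) + (t - s) *: pencil d nu.
    rewrite -pencilZ -pencilD; congr pencil; last by ring.
    by rewrite scalerBl -addrA [s *: d + _]addrC subrK.
  have tpos z : z != 0 -> 0 < dot (z *m pencil (c + t *: d) (mu + t * nu)) z.
    move=> z0; rewrite pE mulmxDr -scalemxAr dotDl dotZl.
    have zz := dot_gt0 z0.
    have h1 : e0 * nrm c * dot z z <= dot (z *m pencil (c + s *: d) (mu + s * nu)) z.
      apply: le_trans (gs z); rewrite ler_wpM2r ?(ltW zz) //.
      by rewrite ler_wpM2l ?nge // ltW.
    have h2 : `|(t - s) * dot (z *m pencil d nu) z| <= `|t - s| * L * dot z z.
      by rewrite normrM -mulrA ler_wpM2l.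
    have h3 : `|t - s| * L * dot z z < e0 * nrm c * dot z z by rewrite ltr_pM2r.
    have := ler_norm (- ((t - s) * dot (z *m pencil d nu) z)); rewrite normrN; lra.
  have xM' : X c *m pencil (c + t *: d) (mu + t * nu) = vcomb (c + t *: d).
    by rewrite pencilD pencilZ mulmxDr -scalemxAr xM xD vcombD vcombZ.
  have [Xt Ut] := argopt_unique (cs0 t) xx xM' tpos.
  by move=> z; have [_ _] := optimalP (c + t *: d); rewrite Ut; apply.
have good0 : good 0.
  by move=> z; rewrite scale0r addr0 mul0r addr0.
move=> s; have nc : 0 < e0 * nrm c by rewrite mulr_gt0 ?nrm_gt0.
have q0 : 0 <= `|s| * L / (e0 * nrm c).
  by apply: divr_ge0; [apply: mulr_ge0 => //; exact: ltW|exact: ltW].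
have := archi_boundP q0; set n := Num.bound _ => nP.
have n0 : 0 < n%:R :> R by apply: le_lt_trans nP.
have good_k k : good (s * (k%:R / n%:R)).
  elim: k => [|k IH]; first by rewrite mul0r mulr0.
  apply: step IH _.
  have -> : s * (k.+1%:R / n%:R) - s * (k%:R / n%:R) = s / n%:R.
    by rewrite -[k.+1]addn1 natrD; field; rewrite gt_eqF.
  rewrite normrM [`|n%:R^-1|]ger0_norm ?invr_ge0 ?(ltW n0) //.
  by rewrite mulrAC ltr_pdivrMr // [e0 * _ * _]mulrC -ltr_pdivrMr.
by have := good_k n; rewrite divff ?mulr1 // gt_eqF.
Qed.

Lemma normal_unique c d nu : c != 0 -> X c *m pencil d nu = vcomb d ->
  exists a, d = a *: c /\ nu = a * mult c.
Proof.
move=> c0 xd; have opt := optimalP c; have [xx xM _] := opt.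
have cc := dot_gt0 c0.
pose a := dot c d / dot c c; exists a.
pose d' := d - a *: c; pose nu' := nu - a * mult c.
have pE : pencil d' nu' = pencil d nu - a *: pencil c (mult c).
  by rewrite -scaleNr -pencilZ -pencilD; congr pencil; rewrite /d' /nu' ?scaleNr ?mulNr.
have xd' : X c *m pencil d' nu' = vcomb d'.
  by rewrite pE mulmxBr -scalemxAr xd xM /d' -!scaleNr vcombD vcombZ.
have cd' : dot c d' = 0.
  by rewrite /d' dotBr dotZr /a mulfVK ?gt_eqF // subrr.
have dE : d = d' + a *: c by rewrite /d' subrK.
have nuE : nu = nu' + a * mult c by rewrite /nu' subrK.
clearbody d' nu'.
have good := pencil_line_coercive c0 opt xd' cd'.
(* The value of the pencil of c at [X c]. Adding the coercivity bounds at s and -s cancels the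
   linear term and bounds e0 s |d'| by [K] for all s >= 0. *)
pose K := dot (X c *m mcomb c) (X c) + dot (X c *m (mult c)%:M) (X c).
have d'0 : d' = 0.
  apply/eqP; rewrite -nrm_eq0 eq_le nrm_ge0 andbT leNgt; apply/negP => nd.
  have low s : 0 <= s -> s * nrm d' <= nrm (c + s *: d') /\ s * nrm d' <= nrm (c + - s *: d').
    move=> s0; rewrite -[s * nrm d'](_ : nrm (s *: d') = _); last by rewrite nrmZ ger0_norm.
    rewrite !ler_wsqrtr // !(dotDl, dotDr, dotZl, dotZr) (dotC d' c) cd' !mulr0 !addr0 !add0r.
      by rewrite !mulrA mulrNN lerDr dot_ge0.
    by rewrite lerDr dot_ge0.
  have bnd s : 0 <= s -> e0 * (s * nrm d') <= K.
    move=> s0; have [l1 l2] := low s s0.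
    have := good s (X c); have := good (- s) (X c).
    rewrite !pencilD !pencilZ !mulmxDr -!scalemxAr !dotDl !dotZl xx -/K !mulr1 => g1 g2.
    have h1 : e0 * (s * nrm d') <= e0 * nrm (c + s *: d') by rewrite ler_wpM2l // ltW.
    have h2 : e0 * (s * nrm d') <= e0 * nrm (c + - s *: d') by rewrite ler_wpM2l // ltW.
    lra.
  have K0 : 0 <= K by have := bnd 0 (lexx _); rewrite mul0r mulr0.
  have := bnd ((K + 1) / (e0 * nrm d')).
  have -> : e0 * ((K + 1) / (e0 * nrm d') * nrm d') = K + 1.
    by field; rewrite !gt_eqF.
  move=> h; have : K + 1 <= K.
    by apply: h; apply: divr_ge0; [exact: addr_ge0|apply: mulr_ge0; exact: ltW].
  lra.
split; first by rewrite dE d'0 add0r.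
move: xd'; rewrite d'0 mul_pencil.
have m0 : mcomb 0 = 0 by rewrite -[X in mcomb X](scale0r (0 : Vm)) mcombZ scale0r.
have v0 : vcomb 0 = 0 by rewrite -[X in vcomb X](scale0r (0 : Vm)) vcombZ scale0r.
rewrite m0 v0 mulmx0 add0r => /eqP; rewrite scaler_eq0 (negPf (argopt_neq0 c)) orbF.
by rewrite nuE => /eqP ->; rewrite add0r.
Qed.

(** Add the gap inequalities of c and c', each at the optimal point of the other: the right-hand
    sides sum to (c - c') . (f(X c') - f(X c)), and one factor |X c - X c'| cancels. Keeping the
    norms on the left makes the estimate valid up to c = 0. *)
Lemma argopt_lip : exists2 L, 0 < L & forall c c',
  e0 * (nrm c + nrm c') * nrm (X c - X c') <= L * nrm (c - c').
Proof.
have [L L0 LP] := qmap_lip; exists L => // c c'.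
have [/eqP|d0] := eqVneq (nrm (X c - X c')) 0.
  by move=> /eqP ->; rewrite mulr0 mulr_ge0 ?nrm_ge0 // ltW.
have dpos : 0 < nrm (X c - X c') by rewrite lt_neqAle eq_sym d0 nrm_ge0.
rewrite -(ler_pM2r dpos).
have h1 := argopt_gap c (dot_argopt c'); have h2 := argopt_gap c' (dot_argopt c).
rewrite -nrm_sqr in h2.
have e : dot (X c' - X c) (X c' - X c) = nrm (X c - X c') ^+ 2.
  by rewrite nrm_sqr -[X c' - X c]opprB dotNl dotNr opprK.
rewrite e in h1.
have h3 := dot_le_nrm (c - c') (qmap (X c') - qmap (X c)).
have h4 : nrm (c - c') * nrm (qmap (X c') - qmap (X c)) <= nrm (c - c') * (L * nrm (X c - X c')).
  rewrite ler_wpM2l ?nrm_ge0 //; have := LP _ _ (argopt_sphere c') (argopt_sphere c).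
  by rewrite -(opprB (X c)) {2}/nrm dotNl dotNr opprK.
rewrite !(dotBl, dotBr) in h3.
have -> : e0 * (nrm c + nrm c') * nrm (X c - X c') * nrm (X c - X c') =
  e0 * nrm c * nrm (X c - X c') ^+ 2 + e0 * nrm c' * nrm (X c - X c') ^+ 2 by ring.
lra.
Qed.

(* [c] is an inner normal, so this is the minimum (and not the maximum) of [dot c]. *)
Definition supp c : R := dot c (qmap (X c)).
Definition body : set Vm := [set y | forall c, supp c <= dot c y].

Lemma supp_le c z : dot z z = 1 -> supp c <= dot c (qmap z).
Proof.
move=> zz; rewrite -subr_ge0; apply: le_trans (argopt_gap c zz).
by rewrite !mulr_ge0 ?nrm_ge0 ?dot_ge0 // ltW.
Qed.

Lemma qmap_body z : dot z z = 1 -> body (qmap z).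
Proof. by move=> zz c; exact: supp_le. Qed.

Lemma suppZ s c : 0 < s -> supp (s *: c) = s * supp c.
Proof.
move=> s0; have [->|c0] := eqVneq c 0.
  by rewrite /supp scaler0 !dot0l mulr0.
by rewrite /supp (argoptZ s0 c0).1 dotZl.
Qed.

(* supp is differentiable at c with gradient qmap (X c), so a point of the body
   attaining supp in the direction c must be that gradient. *)
Lemma body_touch c q : c != 0 -> body q -> dot c q = supp c -> q = qmap (X c).
Proof.
move=> c0 Cq cq.
have [L L0 LP] := qmap_lip; have [L' L0' LP'] := argopt_lip.
have nc := nrm_gt0 c0.
suff key d : dot d (qmap (X c)) <= dot d q.
  apply/eqP; rewrite eq_sym -subr_eq0 -dot_eq0 eq_le dot_ge0 andbT.
  by have := key (qmap (X c) - q); rewrite dotBr subr_le0.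
rewrite leNgt; apply/negP => dq.
pose K := nrm d * (L * (L' * nrm d / (e0 * nrm c))).
have K0 : 0 <= K.
  rewrite /K !mulr_ge0 ?nrm_ge0 ?(ltW L0) ?(ltW L0') //.
  by rewrite invr_ge0 mulr_ge0 ?nrm_ge0 // ltW.
(* Combine the support inequality in the direction c + t d at q with that in the direction c at the
   point of c + t d; then apply the Lipschitz bounds. *)
have bnd t : 0 < t -> dot d (qmap (X c)) - dot d q <= K * t.
  move=> t0; set ct := c + t *: d.
  have h1 := Cq ct; rewrite /supp {2}/ct !dotDl !dotZl cq /supp in h1.
  have h2 := supp_le c (dot_argopt ct); rewrite /supp in h2.
  have h3 : dot d (qmap (X ct)) <= dot d q.
    by rewrite -(ler_pM2l t0); lra.
  have h4 := dot_le_nrm d (qmap (X c) - qmap (X ct)).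
  have h5 := LP _ _ (argopt_sphere c) (argopt_sphere ct).
  have h6 := LP' c ct.
  have h7 : e0 * nrm c * nrm (X c - X ct) <= L' * (t * nrm d).
    have -> : t * nrm d = nrm (c - ct).
      by rewrite /ct opprD addrA subrr add0r -scaleNr nrmZ normrN gtr0_norm.
    apply: le_trans h6; rewrite ler_wpM2r ?nrm_ge0 // ler_wpM2l ?(ltW e0_gt0) //.
    by rewrite lerDl nrm_ge0.
  have h8 : nrm (X c - X ct) <= L' * nrm d / (e0 * nrm c) * t.
    by rewrite mulrAC ler_pdivlMr ?mulr_gt0 // mulrC -[L' * _ * _]mulrA [nrm d * t]mulrC.
  rewrite dotBr in h4.
  have h9 : nrm d * nrm (qmap (X c) - qmap (X ct)) <= nrm d * (L * (L' * nrm d / (e0 * nrm c) * t)).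
    rewrite ler_wpM2l ?nrm_ge0 //; apply: le_trans h5 _.
    by rewrite ler_wpM2l // ltW.
  rewrite /K; lra.
set D := dot d (qmap (X c)) - dot d q in bnd.
have D0 : 0 < D by rewrite subr_gt0.
have := bnd (D / (2 * (K + 1))).
have h : 0 < D / (2 * (K + 1)) by rewrite divr_gt0 // mulr_gt0 // ltr_wpDl.
move=> /(_ h) h1.
have h2 : D * (2 * (K + 1)) <= K * D.
  by rewrite -ler_pdivlMr ?mulr_gt0 ?ltr_wpDl // -mulrA.
have h3 : 0 <= K * D by rewrite mulr_ge0 // ltW.
lra.
Qed.

Lemma lipb_argopt_sphere i : lipb sphere (fun c => X c 0 i).
Proof.
have [L L0 LP] := argopt_lip.
pose K := L / (2 * e0) * m%:R + 1.
have K0 : 0 <= L / (2 * e0) * m%:R.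
  by apply: mulr_ge0 => //; apply: divr_ge0; [exact: ltW|apply: mulr_ge0 => //; exact: ltW].
exists K; first by rewrite addr_ge0.
split=> [c _|c c' cc cc'].
  apply: (@le_trans _ _ 1); last by rewrite lerDr.
  by apply: le_trans (coord_le_norm _ _) _; apply: sphere_norm_le; exact: argopt_sphere.
have n1 : nrm c = 1 by rewrite /nrm cc sqrtr1.
have n1' : nrm c' = 1 by rewrite /nrm cc' sqrtr1.
have := LP c c'; rewrite n1 n1' => h.
have h1 : `|X c 0 i - X c' 0 i| <= nrm (X c - X c').
  have := coord_le_norm (X c - X c') i; rewrite !mxE => /le_trans; apply.
  exact: norm_le_nrm.
apply: le_trans h1 _.
have h2 : nrm (X c - X c') <= L / (2 * e0) * nrm (c - c').
  rewrite mulrAC ler_pdivlMr ?mulr_gt0 // mulrC; apply: le_trans h.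
  by rewrite le_eqVlt; apply/orP; left; apply/eqP; ring.
apply: le_trans h2 _.
apply: (@le_trans _ _ (L / (2 * e0) * (m%:R * `|c - c'|))).
  apply: ler_wpM2l (nrm_le_norm _).
  by apply: divr_ge0; [exact: ltW|apply: mulr_ge0 => //; exact: ltW].
by rewrite mulrA ler_wpM2r // lerDl.
Qed.

Lemma sphere_coord n i : lipb sphere (fun c : 'rV[R]_n => c 0 i).
Proof. exact: lipb_coord (@sphere_norm_le _ _) ler01. Qed.

Lemma lipb_qmap (S : set Vm) (F : Vm -> VN) i : (forall j, lipb S (fun c => F c 0 j)) ->
  lipb S (fun c => qmap (F c) 0 i).
Proof.
move=> Fl; rewrite (_ : (fun c => _) = fun c => dot (F c *m A i) (F c) - 2 * dot (v i) (F c)).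
  apply: lipb_sub; first by apply: lipb_dot => // j; exact: lipb_mulmx.
  apply: lipb_mul; first exact: lipb_cst.
  by apply: lipb_dot => // j; exact: lipb_cst.
by apply/funext => c; rewrite mxE.
Qed.

Lemma body_strict_interior y : (forall c, sphere c -> supp c < dot c y) -> (body°) y.
Proof.
move=> strict.
have hl : lipb sphere (fun c => dot c y - supp c).
  apply: lipb_sub; apply: lipb_dot => i; try exact: sphere_coord.
    exact: lipb_cst.
  by apply: lipb_qmap => j; exact: lipb_argopt_sphere.
have [|e e_gt0 He] := lipb_bounded_below (@compact_sphere R m) hl.
  by move=> c cS; rewrite subr_gt0; exact: strict.
apply/interior_normP; exists (e / (m%:R + 1)); first by rewrite divr_gt0 // ltr_wpDl.
move=> z; rewrite ltr_pdivlMr ?ltr_wpDl // => yz c.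
have [->|c0] := eqVneq c 0; first by rewrite /supp !dot0l.
have nc := nrm_gt0 c0.
have cE : c = nrm c *: ((nrm c)^-1 *: c) by rewrite scalerA mulfV ?gt_eqF // scale1r.
rewrite cE suppZ // dotZl ler_wpM2l ?(ltW nc) //.
set u := _ *: c; have uS : sphere u by exact: unit_scale.
have h1 := He u uS.
have h2 := dot_le_nrm u (y - z); rewrite dotBr {1}/nrm uS sqrtr1 mul1r in h2.
have h3 := nrm_le_norm (y - z).
have h4 : 0 <= `|y - z| by [].
lra.
Qed.

Lemma body_touch_not_interior S c q : c != 0 -> (forall y, S y -> body y) ->
  dot c q = supp c -> ~ (S°) q.
Proof.
move=> c0 SC cq /interior_normP [e e_gt0 He].
pose t := e / (`|c| + 1) / 2.
have nc : 0 <= `|c| by [].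
have n1 : 0 < `|c| + 1 by rewrite ltr_wpDl.
have t0 : 0 < t by rewrite !divr_gt0.
have : S (q - t *: c).
  apply: He => /=; rewrite opprB addrC subrK normrZ gtr0_norm //.
  have : t * (`|c| + 1) = e / 2 by rewrite /t; field; rewrite gt_eqF.
  lra.
move=> /SC /(_ c); rewrite dotBr dotZr cq lerBrDr gerDl.
by rewrite pmulr_rle0 // leNgt dot_gt0.
Qed.

Lemma closed_body : closed body.
Proof.
rewrite (_ : body = \bigcap_c [set y | supp c <= dot c y]); last first.
  by apply/seteqP; split=> y h c; [move=> _; exact: h|exact: (h c I)].
apply: closed_bigI => c _; apply: closed_ge_fun.
apply: lipb_ball_continuous => r r0; apply: lipb_dot => i; first exact: lipb_cst.
exact: lipb_ball_coord.
Qed.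

Lemma frontier_body : frontier body = [set y | exists2 c, sphere c & y = qmap (X c)].
Proof.
rewrite /frontier -(closure_id body).1; last exact: closed_body.
apply/seteqP; split=> y /=.
  move=> [Cy nint]; apply: contrapT => no; apply: nint; apply: body_strict_interior => c cS.
  rewrite lt_neqAle Cy andbT; apply/negP => /eqP e; apply: no; exists c => //.
  by apply: body_touch => //; exact: sphere_neq0.
move=> [c cS ->]; split; first by apply: qmap_body; exact: dot_argopt.
by apply: (body_touch_not_interior (c := c)) => //; exact: sphere_neq0.
Qed.

(** * The range fills the body when m < N *)

Definition qrange : set Vm := [set qmap x | x in sphere].

Lemma dot_vcomb_argopt c : c != 0 -> 0 < dot (vcomb c) (X c).
Proof.
move=> c0; have [_ xM _] := optimalP c; rewrite -xM.
exact: pencil_argopt_posdef c0 (argopt_neq0 c).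
Qed.

(* Coning X from q gives a nullhomotopy of X in VN \ 0, because X c lies in the open
   half-space of vcomb c while q lies on its boundary. *)
Definition cone q c : VN := Num.min 1 `|c| *: X c + (1 - Num.min 1 `|c|) *: q.

(** [X] is constant on rays and need not be continuous at 0, but its local Lipschitz constant grows
    only like 1/|c|, which the factor [Num.min 1] of the norm compensates. *)
Lemma lipb_cone q i : lipb [set c | `|c| <= 2] (fun c => cone q c 0 i).
Proof.
have cl j : lipb [set c : Vm | `|c| <= 2] (fun c => c 0 j) by apply: lipb_ball_coord.
have nl : lipb [set c : Vm | `|c| <= 2] (fun c => `|c|) by apply: (@lipb_norm _ _ _ 2).
have sl : lipb [set c : Vm | `|c| <= 2] (fun c => Num.min 1 `|c|).
  by apply: lipb_min => //; exact: lipb_cst.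
rewrite (_ : (fun c => _) = fun c => Num.min 1 `|c| * X c 0 i +
    (1 - Num.min 1 `|c|) * q 0 i); last by apply/funext => c; rewrite !mxE.
apply: lipb_add; last first.
  by apply: lipb_mul; [apply: lipb_sub => //; exact: lipb_cst|exact: lipb_cst].
have [k k0 [_ sk]] := sl.
have [L L0 LP] := argopt_lip.
have X1 c : `|X c 0 i| <= 1.
  by apply: le_trans (coord_le_norm _ _) _; apply: sphere_norm_le; exact: argopt_sphere.
have s_ge0 c : 0 <= Num.min 1 `|c| by rewrite le_min ler01 normr_ge0.
have Lm0 : 0 <= L / e0 * m%:R.
  by apply: mulr_ge0 => //; apply: divr_ge0; exact: ltW.
exists (k + L / e0 * m%:R + 1); first by rewrite !addr_ge0.
split=> [c _|c c' cQ cQ'].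
  rewrite normrM ger0_norm //; apply: (@le_trans _ _ (1 * 1)).
    by rewrite ler_pM // ge_min lexx.
  by rewrite mulr1 lerDr addr_ge0.
rewrite (_ : _ - _ = (Num.min 1 `|c| - Num.min 1 `|c'|) * X c 0 i +
   Num.min 1 `|c'| * (X c 0 i - X c' 0 i)); last by ring.
apply: le_trans (ler_normD _ _) _; rewrite !normrM.
have h1 : `|Num.min 1 `|c| - Num.min 1 `|c'| | * `|X c 0 i| <= k * `|c - c'|.
  rewrite -[leRHS]mulr1; apply: ler_pM => //; exact: sk.
have h2 : `|Num.min 1 `|c'| | * `|X c 0 i - X c' 0 i| <= L / e0 * m%:R * `|c - c'|.
  rewrite ger0_norm //.
  apply: (@le_trans _ _ (L / e0 * nrm (c - c'))); last first.
    rewrite -[leRHS]mulrA; apply: ler_wpM2l (nrm_le_norm _).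
    by apply: divr_ge0; exact: ltW.
  rewrite mulrAC ler_pdivlMr //; apply: le_trans (LP c c').
  have h3 : `|X c 0 i - X c' 0 i| <= nrm (X c - X c').
    have := coord_le_norm (X c - X c') i; rewrite !mxE => /le_trans; apply.
    exact: norm_le_nrm.
  have h4 : Num.min 1 `|c'| <= nrm c + nrm c'.
    apply: (@le_trans _ _ (nrm c')); last by rewrite lerDr nrm_ge0.
    by apply: le_trans (norm_le_nrm _); rewrite ge_min lexx orbT.
  have h6 := ler_pM (s_ge0 c') (normr_ge0 _) h4 h3.
  have := ler_wpM2l (ltW e0_gt0) h6; lra.
have h5 : 0 <= `|c - c'| by [].
lra.
Qed.

Lemma body_sub_qrange : (m < N)%N -> body `<=` qrange.
Proof.
move=> mN y Cy; apply: contrapT => nFy.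
have strict c : c != 0 -> supp c < dot c y.
  move=> c0; rewrite lt_neqAle Cy andbT; apply/negP => /eqP e; apply: nFy.
  exists (X c); first exact: argopt_sphere.
  by rewrite -(body_touch c0 Cy).
pose B : 'M[R]_(N, m) := \matrix_(j, i) v i 0 j.
have [q1 q10 q1B] := left_kernel_ex B mN.
pose q := (nrm q1)^-1 *: q1.
have qS : dot q q = 1.
  by rewrite /q dotZl dotZr -nrm_sqr; have := nrm_gt0 q10 => h; field; rewrite gt_eqF.
have qv c : dot (vcomb c) q = 0.
  rewrite /vcomb dot_suml big1 // => i _; rewrite dotZl /q dotZr dotC.
  have -> : dot q1 (v i) = (q1 *m B) 0 i.
    by rewrite mxE; apply: eq_bigr => j _; rewrite mxE.
  by rewrite q1B mxE !mulr0.
clearbody q; pose E := cone q.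
have E0 c : E c != 0.
  have [->|c0] := eqVneq c 0.
    rewrite /E /cone normr0 (min_idPr ler01) scale0r add0r subr0 scale1r.
    exact: sphere_neq0.
  apply/eqP => /(congr1 (dot (vcomb c))); rewrite dot0r /E /cone dotDr !dotZr qv mulr0 addr0.
  move=> /eqP; rewrite mulf_eq0 => /orP[/eqP h|/eqP h]; last first.
    by have := dot_vcomb_argopt c0; rewrite h ltxx.
  have : 0 < Num.min 1 `|c| by rewrite lt_min ltr01 normr_gt0.
  by rewrite h ltxx.
(* This is |E|^2 (y - f(E / |E|)), multiplied out; where the norm of c is at least 1 it equals y -
   f(X c). *)
pose H c : Vm := \row_i (dot (E c) (E c) * y 0 i -
  (dot (E c *m A i) (E c) - 2 * (nrm (E c) * dot (v i) (E c)))).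
have El i : lipb [set c | `|c| <= 2] (fun c => E c 0 i) by exact: lipb_cone.
have EEl : lipb [set c | `|c| <= 2] (fun c => dot (E c) (E c)) by exact: lipb_dot.
have [e e_gt0 Ee] := lipb_bounded_below (@compact_cube R m 2) EEl (fun c _ => dot_gt0 (E0 c)).
have [||c [c1 Hc]] := @outward_field_zero R m H m_gt0.
- move=> i; rewrite (_ : (fun c => _) = fun c => dot (E c) (E c) * y 0 i -
    (dot (E c *m A i) (E c) - 2 * (nrm (E c) * dot (v i) (E c)))); last first.
    by apply/funext => c; rewrite mxE.
  apply: lipb_sub; first by apply: lipb_mul => //; exact: lipb_cst.
  apply: lipb_sub; first by apply: lipb_dot => // j; exact: lipb_mulmx.
  apply: lipb_mul; first exact: lipb_cst.
  apply: lipb_mul; first exact: lipb_sqrt e_gt0 Ee EEl.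
  by apply: lipb_dot => // j; exact: lipb_cst.
- move=> c c1 c2; have c0 : c != 0 by rewrite -normr_gt0 (lt_le_trans ltr01).
  have -> : H c = y - qmap (X c).
    have EX : E c = X c by rewrite /E /cone (min_idPl c1) scale1r subrr scale0r addr0.
    apply/rowP => i; rewrite !mxE EX /nrm dot_argopt sqrtr1; ring.
  by rewrite dotBr subr_gt0 strict.
apply: nFy; exists ((nrm (E c))^-1 *: E c); first exact: unit_scale.
have sE := nrm_gt0 (E0 c); apply/rowP => i.
have := congr1 (fun u : Vm => u 0 i) Hc; rewrite !mxE -nrm_sqr.
rewrite -!scalemxAl !(dotZl, dotZr).
set s := nrm (E c) in sE *; move=> /eqP; rewrite subr_eq0 => /eqP h.
apply: (@mulfI _ (s ^+ 2)); first by rewrite sqrf_eq0 gt_eqF.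
by rewrite h; field; rewrite gt_eqF.
Qed.

(** * Smooth charts of the boundary *)

Lemma pencil_small : exists2 L, 0 < L & forall d nu z r, `|d| <= r -> `|nu| <= r ->
  `|dot (z *m pencil d nu) z| <= L * r * dot z z.
Proof.
have /choice [k kP] : forall i, exists a, 0 <= a /\
    forall z, `|dot (z *m A i) z| <= a * dot z z.
  by move=> i; have [a a0 h] := quadform_bound (A i); exists a; split=> //; exact: ltW.
exists (\sum_i k i + 1) => [|d nu z r dr nur].
  by rewrite ltr_wpDl // sumr_ge0 // => i _; case: (kP i).
rewrite mul_pencil dotDl dotZl; apply: le_trans (ler_normD _ _) _.
rewrite mulrDl mul1r mulrDl lerD //; last first.
  by rewrite normrM (ger0_norm (dot_ge0 z)) ler_wpM2r ?dot_ge0.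
rewrite mulmx_sumr dot_suml; apply: le_trans (ler_norm_sum _ _ _) _.
rewrite !mulr_suml; apply: ler_sum => i _.
rewrite -scalemxAr dotZl normrM mulrAC mulrC.
apply: ler_pM => //; first exact: (kP i).2.
exact: le_trans (coord_le_norm _ _) dr.
Qed.

Local Notation VD := 'rV[R]_((m + 1) + (N + 1)).

Section Chart.
Variable c0 : Vm.
Hypothesis c0S : dot c0 c0 = 1.
Local Notation x0 := (X c0).
Local Notation mu0 := (mult c0).
Local Notation p := (qmap x0).
Local Notation t0 := (pack c0 mu0 x0 0).
Local Notation lag := (lag A v c0).
Local Notation lag_jac := (lag_jac A v c0).

Let c0_neq0 : c0 != 0. Proof. by rewrite -dot_eq0 c0S oner_eq0. Qed.
Let x0M : x0 *m pencil c0 mu0 = vcomb c0. Proof. by case: (optimalP c0). Qed.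

(** For a kernel vector (d, nu, z, s), pairing the first block with c0 gives s = 0. Pairing it with
    d and the third block with z leaves (c0 . A + mu0)[z, z] = 0, so z = 0. Then (d, nu) is a
    multiple of (c0, mu0) by [normal_unique], and d . c0 = 0 makes it zero. *)
Lemma lag_jac_unit : lag_jac t0 \in unitmx.
Proof.
apply: unitmx_inj => u uJ.
rewrite -[u]packK in uJ *; move: (pc u) (pm u) (px u) (ps u) uJ => d nu z s.
rewrite lag_jacE // => uJ.
have e : pack (dqmap A v x0 z + s *: c0) (dot d c0)
    (z *m pencil c0 mu0 + (x0 *m pencil d nu - vcomb d)) (2 * dot x0 z) = pack 0 0 0 0.
  by rewrite uJ pack0.
have [e1 e2 e3 e4] := pack_inj e.
have xz : dot x0 z = 0 by apply/eqP; have /eqP := e4; rewrite mulf_eq0 pnatr_eq0.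
have s0 : s = 0.
  have := congr1 (dot c0) e1; rewrite dotDr dotZr c0S dot_dqmap dot0r.
  by rewrite -x0M mul_pencil dotDl dotZl xz; lra.
have zM : dot (z *m pencil c0 mu0) z = 0.
  have := congr1 (fun y : VN => dot y z) e3; have := congr1 (dot d) e1.
  rewrite s0 scale0r addr0 dot_dqmap !dot0r dot0l dotDl dotBl mul_pencil.
  rewrite dotDl dotZl (mul_pencil _ x0) dotDl dotZl xz; lra.
have z0 : z = 0.
  apply/eqP/negPn/negP => zn; have := pencil_argopt_posdef c0_neq0 zn.
  by rewrite zM ltxx.
move: e3; rewrite z0 mul0mx add0r => /eqP; rewrite subr_eq0 => /eqP e3.
have [a [da nua]] := normal_unique c0_neq0 e3.
have a0 : a = 0 by move: e2; rewrite da dotZl c0S mulr1.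
by rewrite da nua a0 scale0r mul0r s0 pack0.
Qed.

Lemma mult_bound : exists2 L, 0 < L & forall c, dot c c = 1 -> `|mult c| <= L.
Proof.
have [L L0 LP] := pencil_small.
have [L' L0' LP'] : exists2 L', 0 < L' & forall c, dot c c = 1 -> nrm (vcomb c) <= L'.
  have [C C0 VC] := mulmx_norm_le (\matrix_(i, j) v i 0 j).
  exists (N%:R * C + 1) => [|c cc]; first by rewrite ltr_wpDl // mulr_ge0 // ltW.
  have -> : vcomb c = c *m (\matrix_(i, j) v i 0 j).
    rewrite mulmx_sum_row; apply: eq_bigr => i _; congr (_ *: _).
    by apply/rowP => j; rewrite !mxE.
  apply: le_trans (nrm_le_norm _) _; apply: (@le_trans _ _ (N%:R * C)); last by rewrite lerDl.
  rewrite ler_wpM2l //; apply: le_trans (VC c) _; rewrite ler_piMr ?(ltW C0) //.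
  exact: sphere_norm_le.
exists (L + L') => [|c cc]; first exact: addr_gt0.
have [xx xM _] := optimalP c.
have -> : mult c = dot (vcomb c) (X c) - dot (X c *m pencil c 0) (X c).
  by rewrite -xM !mul_pencil dotDl dotZl xx scale0r addr0; ring.
apply: le_trans (ler_normB _ _) _; rewrite addrC lerD //.
  have := LP c 0 (X c) 1; rewrite xx !mulr1; apply; last by rewrite normr0.
  exact: sphere_norm_le.
apply: le_trans (normr_dot_le _ _) _; rewrite {2}/nrm xx sqrtr1 mulr1.
exact: LP'.
Qed.

Lemma pencil_mul_bound : exists2 L, 0 < L & forall d nu z r, `|d| <= r -> `|nu| <= r ->
  `|z *m pencil d nu| <= L * r * `|z|.
Proof.
have /choice [k kP] : forall i, exists a, 0 <= a /\ forall z, `|z *m A i| <= a * `|z|.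
  by move=> i; have [a a0 h] := mulmx_norm_le (A i); exists a; split=> //; exact: ltW.
exists (\sum_i k i + 1) => [|d nu z r dr nur].
  by rewrite ltr_wpDl // sumr_ge0 // => i _; case: (kP i).
rewrite mul_pencil; apply: le_trans (ler_normD _ _) _.
rewrite mulrDl mul1r mulrDl lerD //; last by rewrite normrZ ler_wpM2r.
rewrite mulmx_sumr; apply: le_trans (ler_norm_sum _ _ _) _.
rewrite !mulr_suml; apply: ler_sum => i _.
rewrite -scalemxAr normrZ mulrAC mulrC.
apply: ler_pM => //; first exact: (kP i).2.
exact: le_trans (coord_le_norm _ _) dr.
Qed.

(** The part of (c, mult c) transverse to (c0, mu0) solves the linearised system at [t0] with a
    right-hand side of the order of X c - x0, so the inverse Jacobian bounds it. This holds for
    every unit c, not only near c0. *)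
Lemma normal_lip : exists2 C, 0 < C & forall c, dot c c = 1 ->
  let a := dot c c0 in
  `|c - a *: c0| <= C * `|X c - x0| /\ `|mult c - a * mu0| <= C * `|X c - x0|.
Proof.
have [B B0 KB] := mulmx_norm_le (invmx (lag_jac t0)).
have [L L0 LP] := pencil_mul_bound.
have [M M0 MP] := mult_bound.
exists (B * (L * (M + 1))) => [|c cc a]; first by rewrite !mulr_gt0 // ltr_wpDl // ltW.
set d := c - a *: c0; set nu := mult c - a * mu0.
have dc0 : dot d c0 = 0 by rewrite /d dotBl dotZl c0S mulr1 subrr.
have [_ xM _] := optimalP c.
pose r := x0 *m pencil d nu - vcomb d.
have rE : r = - ((X c - x0) *m pencil c (mult c)).
  have pE : pencil d nu = pencil c (mult c) - a *: pencil c0 mu0.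
    by rewrite -scaleNr -pencilZ -pencilD; congr pencil; rewrite /d /nu ?scaleNr ?mulNr.
  have vE : vcomb d = vcomb c - a *: vcomb c0.
    by rewrite /d -!scaleNr vcombD vcombZ.
  rewrite /r pE vE mulmxBr -scalemxAr x0M mulmxBl xM opprB addrA subrK //.
  by apply/rowP => j; rewrite !mxE; ring.
have rb : `|r| <= L * (M + 1) * `|X c - x0|.
  rewrite rE normrN; apply: LP.
    by rewrite (le_trans (sphere_norm_le cc)) // lerDr ltW.
  by rewrite (le_trans (MP c cc)) // lerDl.
have jE : pack d nu (0 : VN) 0 *m lag_jac t0 = pack 0 0 r 0.
  rewrite lag_jacE // dc0 mul0mx add0r dot0r mulr0 scale0r addr0 -/r; congr pack.
  by apply/rowP => i; rewrite !mxE !dot0r subrr mulr0.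
have pb : `|pack d nu (0 : VN) 0| <= B * (L * (M + 1)) * `|X c - x0|.
  have := KB (pack d nu (0 : VN) 0 *m lag_jac t0); rewrite mulmxK ?lag_jac_unit // jE => h.
  apply: le_trans h _.
  rewrite -mulrA ler_wpM2l ?(ltW B0) //.
  have r0 : 0 <= L * (M + 1) * `|X c - x0|.
    by rewrite !mulr_ge0 ?addr_ge0 ?(ltW L0) ?(ltW M0).
  by apply/pack_norm_le => //; split=> //; rewrite normr0.
have r1 : 0 <= B * (L * (M + 1)) * `|X c - x0| by exact: le_trans pb.
by have [h1 h2 _ _] := (pack_norm_le _ _ _ _ r1).1 pb; split.
Qed.

(** Nearby boundary points have nearby normalised data. This puts the data of every boundary point
    close to p into the ball where the local solution of the system is unique. *)
Lemma normals_close (eps : R) : 0 < eps -> exists2 del, 0 < del &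
  forall c, dot c c = 1 -> `|qmap (X c) - p| < del ->
  let a := dot c c0 in [/\ 0 < a, `|a^-1 *: c - c0| < eps,
    `|a^-1 * mult c - mu0| < eps & `|X c - x0| < eps].
Proof.
move=> eps0; have [C C0 CP] := normal_lip; have [L L0 LP] := pencil_small.
pose q0 := dot (x0 *m pencil c0 mu0) x0.
have n0 : nrm c0 = 1 by rewrite /nrm c0S sqrtr1.
have q0e : e0 <= q0.
  by have [_ _ /(_ x0)] := optimalP c0; rewrite dot_argopt n0 !mulr1.
have q0_gt0 : 0 < q0 by exact: lt_le_trans q0e.
(* Coercivity of the pencil of c, tested on x0, gives e0 <= a q0 + L r; the choice of [eta] makes L
   r at most e0 / 2, so a >= [a0]. In particular c is not close to - c0. *)
pose a0 := e0 / (2 * q0).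
have a0_gt0 : 0 < a0 by rewrite divr_gt0 // mulr_gt0.
pose eta := Num.min eps (Num.min (e0 / (2 * L * C)) (eps * a0 / (2 * C))).
have eta0 : 0 < eta by rewrite !lt_min eps0 !(divr_gt0, mulr_gt0).
have eta1 : eta <= eps by rewrite /eta ge_min lexx.
have eta2 : eta * (2 * L * C) <= e0.
  by rewrite -ler_pdivlMr ?(mulr_gt0, ltr0n) // /eta !ge_min lexx !orbT.
have eta3 : eta * (2 * C) <= eps * a0.
  by rewrite -ler_pdivlMr ?(mulr_gt0, ltr0n) // /eta !ge_min lexx !orbT.
exists (e0 * eta ^+ 2 / (m%:R + 1)).
  by rewrite divr_gt0 ?ltr_wpDl // mulr_gt0 ?exprn_gt0.
move=> c cc; rewrite ltr_pdivlMr ?ltr_wpDl // => near a.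
have xclose : `|X c - x0| < eta.
  apply: le_lt_trans (norm_le_nrm _) _.
  rewrite -(@ltr_pXn2r _ 2) ?nnegrE ?nrm_ge0 ?(ltW eta0) // nrm_sqr -(ltr_pM2l e0_gt0).
  have := argopt_gap c0 (dot_argopt c); rewrite n0 mulr1 -dotBr => h.
  apply: le_lt_trans h _; apply: le_lt_trans (dot_le_nrm _ _) _; rewrite n0 mul1r.
  apply: le_lt_trans (nrm_le_norm _) _; apply: le_lt_trans near.
  by rewrite mulrC ler_wpM2l // lerDl.
have [h1 h2] := CP c cc; rewrite -/a in h1 h2.
set r := C * `|X c - x0| in h1 h2.
have rC : r < C * eta by rewrite /r ltr_pM2l.
have aq : e0 <= a * q0 + L * r.
  have [_ _ /(_ x0)] := optimalP c; rewrite dot_argopt {1}/nrm cc sqrtr1 !mulr1.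
  move=> /le_trans; apply.
  have -> : pencil c (mult c) = a *: pencil c0 mu0 + pencil (c - a *: c0) (mult c - a * mu0).
    by rewrite -pencilZ -pencilD; congr pencil; rewrite addrC subrK.
  rewrite mulmxDr -scalemxAr dotDl dotZl lerD2l; apply: le_trans (ler_norm _) _.
  by have := LP _ _ x0 _ h1 h2; rewrite dot_argopt mulr1.
have Lr : L * r <= L * (C * eta) by rewrite ler_wpM2l ?(ltW L0) // ltW.
have a_ge : a0 <= a.
  rewrite /a0 ler_pdivrMr ?mulr_gt0 //; lra.
have a_gt0 : 0 < a by exact: lt_le_trans a_ge.
have rea : r < eps * a.
  have : eps * a0 <= eps * a by rewrite ler_wpM2l // ltW.
  have : 0 < C * eta by rewrite mulr_gt0.
  lra.
split=> //.
- have -> : a^-1 *: c - c0 = a^-1 *: (c - a *: c0).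
    by rewrite scalerBr scalerA mulVf ?scale1r // gt_eqF.
  rewrite normrZ gtr0_norm ?invr_gt0 // mulrC ltr_pdivrMr //.
  exact: le_lt_trans rea.
- have -> : a^-1 * mult c - mu0 = a^-1 * (mult c - a * mu0).
    by field; rewrite gt_eqF.
  rewrite normrM gtr0_norm ?invr_gt0 // mulrC ltr_pdivrMr //.
  exact: le_lt_trans rea.
- exact: lt_le_trans eta1.
Qed.

Lemma lag_t0 : lag t0 = pack p 1 0 1.
Proof. by rewrite lagE scale0r addr0 c0S x0M subrr dot_argopt. Qed.

Definition embed : 'M[R]_(m, (m + 1) + (N + 1)) := row_mx (row_mx 1%:M 0) 0.

Lemma mul_embed (w : Vm) : w *m embed = pack w 0 0 0.
Proof. by rewrite /embed !mul_mx_row mulmx1 !mulmx0 /pack !raddf0 row_mx0. Qed.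

Lemma lag_optimal c : dot c c0 != 0 ->
  lag (pack ((dot c c0)^-1 *: c) ((dot c c0)^-1 * mult c) (X c) 0) = pack (qmap (X c)) 1 0 1.
Proof.
move=> a0; have [xx xM _] := optimalP c.
rewrite lagE scale0r addr0 dotZl mulVf // pencilZ -scalemxAr xM vcombZ subrr.
by rewrite xx.
Qed.

Local Notation W r := [set y : Vm | `|y - p| < r].

(** The last two clauses make s a defining function: it vanishes at the points of optimal vectors,
    because their data lie on the branch, and it grows at unit rate along c0, because s c0 enters
    only the first equation. *)
Lemma lag_chart : exists r (th : Vm -> VD), 0 < r /\ th p = t0 /\
  [/\ forall y, W r y -> lag (th y) = pack y 1 0 1,
      forall y, W r y -> forall z, z != 0 ->
        0 < dot (z *m pencil (pc (th y)) (pm (th y))) z,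
      forall y, W r y -> lag_jac (th y) \in unitmx,
      exists2 K, 0 < K & forall y y', W r y -> W r y' ->
        K * `|th y - th y'| <= `|lag (th y) - lag (th y')| &
      (forall c, dot c c = 1 -> W r (qmap (X c)) -> ps (th (qmap (X c))) = 0) /\
      forall y s, W r y -> W r (y + s *: c0) -> th (y + s *: c0) = th y + pack 0 0 0 s].
Proof.
have [rho [r [kappa [rho0 r0 kappa0 [sep junit solv]]]]] := quad_local_inverse
  (lag_lin_linear v c0) (lag_bil_linearl A) (lag_bil_linearr A) lag_jac_unit.
have [L L0 LP] := pencil_small.
(* The second bound keeps the pencil positive definite on the branch: there it differs from that of
   c0 by at most e0 / 4. *)
pose rho1 := Num.min rho (e0 / (2 * L)).
have rho1_gt0 : 0 < rho1 by rewrite lt_min rho0 !(divr_gt0, mulr_gt0).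
have rho1_rho : rho1 <= rho by rewrite ge_min lexx.
have rho1_L : rho1 * (2 * L) <= e0.
  by rewrite -ler_pdivlMr ?(mulr_gt0, ltr0n) // ge_min lexx orbT.
have [del del0 delP] := normals_close rho1_gt0.
(* In this order: the system is solvable; the data of boundary points lie within [rho1] of [t0]; the
   branch stays within rho1 / 2; and a translation by s c0 inside the chart has |s| <= rho1 / 2,
   hence stays in the ball of uniqueness. *)
pose r1 := Num.min (Num.min r del) (Num.min (kappa * rho1 / 2) (rho1 / (4 * (m%:R + 1)))).
have m1 : 0 < m%:R + 1 :> R by rewrite ltr_wpDl.
have r1_gt0 : 0 < r1 by rewrite !lt_min r0 del0 !(divr_gt0, mulr_gt0).
have r1_r : r1 <= r by rewrite !ge_min lexx.
have r1_del : r1 <= del by rewrite !ge_min lexx !orbT.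
have r1_k : r1 <= kappa * rho1 / 2 by rewrite !ge_min lexx !orbT.
have r1_m : r1 * (4 * (m%:R + 1)) <= rho1.
  by rewrite -ler_pdivlMr ?(mulr_gt0, ltr0n) // !ge_min lexx !orbT.
have lag0 := lag_t0.
have packW y y' : `|pack y 1 0 1 - pack y' 1 (0 : VN) 1| <= `|y - y'|.
  rewrite packB !subrr; apply/pack_norm_le => //; split=> //; rewrite normr0 //.
have ex y : exists t : VD, W r1 y -> `|t - t0| < rho /\ lag t = pack y 1 0 1.
  have [yW|yW] := pselect (W r1 y); last by exists 0.
  have [t tr tE] : exists2 t : VD, `|t - t0| < rho & lag t = pack y 1 0 1.
    apply: solv; rewrite -/(lag t0) lag0; apply: le_lt_trans (packW _ _) _.
    exact: lt_le_trans r1_r.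
  by exists t.
have [th thP] := choice ex.
have thW y : W r1 y -> `|th y - t0| < rho1 / 2.
  move=> yW; have [tr tE] := thP y yW.
  have t00 : `|t0 - t0| <= rho by rewrite subrr normr0 ltW.
  have := sep _ _ (ltW tr) t00; rewrite -/(lag _) -/(lag t0) tE lag0.
  move=> /le_trans /(_ (packW _ _)) h.
  rewrite -(ltr_pM2l kappa0); apply: le_lt_trans h _; apply: lt_le_trans yW _.
  by rewrite mulrA.
have thr y : W r1 y -> `|th y - t0| <= rho by move=> /thP [/ltW].
have inj (t t' : VD) : `|t - t0| <= rho -> `|t' - t0| <= rho -> lag t = lag t' -> t = t'.
  move=> tr tr' tt'; have := sep t t' tr tr'.
  rewrite -/(lag t) -/(lag t') tt' subrr normr0 pmulr_rle0 // normr_le0 subr_eq0.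
  by move=> /eqP.
have pW : W r1 p by rewrite /= subrr normr0.
exists r1, th; split=> //; split.
  apply: inj; [exact: thr|by rewrite subrr normr0 ltW|].
  by rewrite (thP p pW).2 lag0.
split.
- by move=> y /thP [].
- move=> y yW z z0; set t := th y.
  have [h1 h2 _ _] := part_norm_le (t - t0).
  have tt : `|t - t0| < rho1 / 2 by exact: thW.
  have c_le : `|pc t - c0| <= rho1 / 2.
    by rewrite -{1}[c0](pcK c0 mu0 x0 0) -[X in `|X|](_ : pc (t - t0) = _) ?(le_trans h1) ?ltW //
      -scaleN1r addrC pcP scaleN1r addrC.
  have m_le : `|pm t - mu0| <= rho1 / 2.
    by rewrite -{1}[mu0](pmK c0 mu0 x0 0) -[X in `|X|](_ : pm (t - t0) = _) ?(le_trans h2) ?ltW //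
      -scaleN1r addrC pmP mulN1r addrC.
  have -> : pencil (pc t) (pm t) = pencil c0 mu0 + pencil (pc t - c0) (pm t - mu0).
    by rewrite -pencilD; congr pencil; rewrite addrC subrK.
  rewrite mulmxDr dotDl.
  have := LP _ _ z _ c_le m_le; have zz := dot_gt0 z0.
  have [_ _ /(_ z)] := optimalP c0; rewrite /nrm c0S sqrtr1 mulr1 => h3 h4.
  have h5 := ler_norm (- dot (z *m pencil (pc t - c0) (pm t - mu0)) z).
  rewrite normrN in h5.
  have h6 : L * (rho1 / 2) * dot z z <= e0 / 4 * dot z z by rewrite ler_wpM2r ?(ltW zz) //; lra.
  have h7 : 0 < e0 * dot z z by rewrite mulr_gt0.
  lra.
- by move=> y yW; apply: junit; exact: thr.
- exists kappa => // y y' yW yW'.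
  by apply: sep; exact: thr.
split.
  move=> c cc cW; have [|a_gt0 a1 a2 a3] := delP c cc.
    exact: lt_le_trans r1_del.
  suff -> : th (qmap (X c)) = pack ((dot c c0)^-1 *: c) ((dot c c0)^-1 * mult c) (X c) 0.
    by rewrite psK.
  apply: inj; first exact: thr.
    rewrite packB subrr; apply/pack_norm_le; first exact: ltW.
    by split; rewrite ?normr0 ?(ltW rho0) // (le_trans _ rho1_rho) // ltW.
  by rewrite (thP _ cW).2 lag_optimal // gt_eqF.
move=> y s yW ysW; apply: inj; first exact: thr.
  rewrite addrAC; apply: le_trans (ler_normD _ _) _.
  have sb : `|s| <= rho1 / 2.
    have : `|s| <= m%:R * `|s *: c0|.
      by apply: le_trans (nrm_le_norm _); rewrite nrmZ /nrm c0S sqrtr1 mulr1.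
    have : `|s *: c0| <= 2 * r1.
      have -> : s *: c0 = (y + s *: c0 - p) - (y - p) by apply/rowP => j; rewrite !mxE; ring.
      apply: le_trans (ler_normB _ _) _; move: yW ysW => /=; lra.
    move=> h1 /le_trans; apply; apply: (@le_trans _ _ ((m%:R + 1) * (2 * r1))).
      by apply: ler_pM => //; rewrite lerDl.
    lra.
  have sp : `|pack 0 0 (0 : VN) s : VD| <= rho1 / 2.
    have r2 : 0 <= rho1 / 2 by apply: divr_ge0 => //; exact: ltW.
    by apply/pack_norm_le => //; split=> //; rewrite normr0.
  have := thW y yW; lra.
rewrite (thP _ ysW).2; have := (thP _ yW).2.
rewrite -{1 2}[th y]packK; move: (pc (th y)) (pm (th y)) (px (th y)) (ps (th y)) => c mu x u.
rewrite packD !addr0 !lagE scalerDl addrA => /pack_inj [<- -> -> ->].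
by [].
Qed.

End Chart.

Section Chart.
Variable c0 : Vm.
Hypothesis c0S : dot c0 c0 = 1.
Local Notation x0 := (X c0).
Local Notation mu0 := (mult c0).
Local Notation p := (qmap x0).
Local Notation t0 := (pack c0 mu0 x0 0).
Local Notation lag := (lag A v c0).
Local Notation lag_jac := (lag_jac A v c0).
Local Notation W r := [set y : Vm | `|y - p| < r].

Lemma open_chart r : open (W r).
Proof. exact: open_norm_ball. Qed.

Lemma lag_chart_smooth : exists r (th : Vm -> VD), 0 < r /\ th p = t0 /\
  [/\ forall y, W r y -> lag (th y) = pack y 1 0 1,
      forall y, W r y -> forall z, z != 0 ->
        0 < dot (z *m pencil (pc (th y)) (pm (th y))) z,
      forall k i, Ck (W r) k (fun y => th y 0 i),
      forall y w, W r y -> exists T : VD, [/\ T = w *m (embed *m invmx (lag_jac (th y))),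
        forall i, 'D_w (fun y => th y 0 i) y = T 0 i &
        T *m lag_jac (th y) = pack w 0 0 0] &
      (forall c, dot c c = 1 -> W r (qmap (X c)) -> ps (th (qmap (X c))) = 0) /\
      forall y s, W r y -> W r (y + s *: c0) -> th (y + s *: c0) = th y + pack 0 0 0 s].
Proof.
have [r [th [r0 [thp [lagth pos junit [K K0 sep] rest]]]]] := lag_chart c0S.
exists r, th; split=> //; split=> //.
have Wo : open (W r) by exact: open_chart.
have thE y : W r y -> quad_map (lag_lin v c0) (lag_bil A) (th y) =
    y *m embed + pack 0 1 0 1.
  by move=> /lagth; rewrite mul_embed packD !add0r addr0.
have sm := quad_inverse_smooth (lag_lin_linear v c0) (lag_bil_linearl A) (lag_bil_linearr A)
   Wo K0 thE junit sep.
have dr := quad_inverse_derive (lag_lin_linear v c0) (lag_bil_linearl A) (lag_bil_linearr A)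
   Wo K0 thE junit sep.
split=> // y w yW; exists (w *m (embed *m invmx (lag_jac (th y)))); split=> //.
  by move=> i; have [_ ->] := dr y i yW.
by rewrite -mulmxA mulmxKV ?junit // mul_embed.
Qed.

Lemma psE (t : VD) : ps t = t 0 (rshift (m + 1) (rshift N 0)).
Proof. by rewrite /ps !mxE. Qed.
Lemma pcE (t : VD) j : pc t 0 j = t 0 (lshift (N + 1) (lshift 1 j)).
Proof. by rewrite /pc !mxE. Qed.
Lemma pxE (t : VD) j : px t 0 j = t 0 (rshift (m + 1) (lshift 1 j)).
Proof. by rewrite /px !mxE. Qed.

Lemma boundary_chart : exists r (g : Vm -> R), 0 < r /\
  [/\ forall k, Ck (W r) k g,
      forall y, W r y -> frontier body y <-> g y = 0,
      'D_c0 g p = 1,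
      forall w, dot c0 w = 0 -> w != 0 -> 'D_w ('D_w g) p < 0 &
      forall y s, W r y -> W r (y + s *: c0) -> g (y + s *: c0) = g y + s].
Proof.
have [r [th [r0 [thp [lagth pos thC thD [th0 ths]]]]]] := lag_chart_smooth.
pose g y := ps (th y).
have Wo : open (W r) by exact: open_chart.
have gE : g = fun y => th y 0 (rshift (m + 1) (rshift N 0)).
  by apply/funext => y; rewrite /g psE.
have pW : W r p by rewrite /= subrr normr0.
have sys y : W r y -> [/\ qmap (px (th y)) + g y *: c0 = y, dot (pc (th y)) c0 = 1,
    px (th y) *m pencil (pc (th y)) (pm (th y)) = vcomb (pc (th y)) & dot (px (th y)) (px (th y)) = 1].
  move=> /lagth; rewrite -{1}[th y]packK lagE => /pack_inj [h1 h2 h3 h4]; split=> //.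
  by apply/eqP; rewrite -subr_eq0 h3.
(* Envelope identity: pair the first block of the linearised system with the normal. The variation
   of x contributes nothing, since x is stationary and its variation is tangent to the sphere. *)
have Dg y w : W r y -> 'D_w g y = dot (pc (th y)) w.
  move=> yW; have [T [_ TD TJ]] := thD y w yW; have [h1 h2 h3 h4] := sys y yW.
  rewrite gE TD -psE; move: TJ.
  rewrite -[T in T *m _]packK -[X in lag_jac X]packK lag_jacE //.
  move=> /pack_inj [e1 e2 e3 e4].
  have xz : dot (px (th y)) (px T) = 0.
    by apply/eqP; have /eqP := e4; rewrite mulf_eq0 pnatr_eq0.
  have := congr1 (dot (pc (th y))) e1; rewrite dotDr dotZr h2 mulr1 dot_dqmap.
  rewrite -h3 mul_pencil dotDl dotZl xz; lra.
exists r, g; split=> //; split.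
- by move=> k; rewrite gE.
- move=> y yW; split; first by rewrite frontier_body => -[c cS yE]; rewrite yE /g th0 // -yE.
  move=> gy; have [h1 h2 h3 h4] := sys y yW; rewrite gy scale0r addr0 in h1.
  have cn0 : pc (th y) != 0.
    by apply/eqP => c_0; move: h2; rewrite c_0 dot0l => /eqP; rewrite eq_sym oner_eq0.
  have [Xx _] := argopt_unique cn0 h4 h3 (pos y yW).
  rewrite frontier_body /=; exists ((nrm (pc (th y)))^-1 *: pc (th y)); first exact: unit_scale.
  by rewrite (argoptZ _ cn0).1 ?invr_gt0 ?nrm_gt0 // Xx.
- by rewrite Dg // thp pcK.
- move=> w wc0 w0.
  have [T [_ TD TJ]] := thD p w pW.
  have -> : 'D_w ('D_w g) p = dot (pc T) w.
    have -> : 'D_w ('D_w g) p = 'D_w (fun y => \sum_j th y 0 (lshift (N + 1) (lshift 1 j)) * w 0 j) p.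
      apply: near_eq_derive; apply: filterS (open_nbhs_nbhs (conj Wo pW)) => y yW.
      by rewrite Dg // /dot; apply: eq_bigr => j _; rewrite pcE.
    rewrite (@derive_lincomb _ _ _ (fun j y => th y 0 (lshift (N + 1) (lshift 1 j)))).
      by apply: eq_bigr => j _; rewrite TD pcE.
    by move=> j; have [df _] := thC 1%N (lshift (N + 1) (lshift 1 j)); exact: df.
  move: TJ; rewrite -[T in T *m _]packK thp lag_jacE // => /pack_inj [e1 e2 e3 e4].
  have xz : dot x0 (px T) = 0 by apply/eqP; have /eqP := e4; rewrite mulf_eq0 pnatr_eq0.
  (* The first block expresses w through the variation z of x, and the third, paired with z, brings
     in the pencil. If z were 0, then w would be a multiple of c0, hence 0 by orthogonality. *)
  have wE : dot (pc T) w = - 2 * dot (px T *m pencil c0 mu0) (px T).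
    rewrite -{1}e1 dotDr dotZr e2 mulr0 addr0 dot_dqmap.
    have := congr1 (fun u : VN => dot u (px T)) e3; rewrite !dotDl dotNl dot0l.
    rewrite (mul_pencil _ x0) dotDl dotZl xz; lra.
  rewrite wE mulNr oppr_lt0 mulr_gt0 //; apply: pencil_argopt_posdef.
    exact: sphere_neq0.
  apply/eqP => z0; move: w0; rewrite -e1 z0.
  have dq0 : dqmap A v x0 0 = 0 by apply/rowP => i; rewrite !mxE !dot0r subrr mulr0.
  have := congr1 (dot c0) e1; rewrite z0 dq0 add0r dotZr c0S wc0 mulr1 => ->.
  by rewrite scale0r eqxx.
- by move=> y s yW ysW; rewrite /g ths // -{1}[th y]packK packD psK.
Qed.

(** At the maximum, the component z' of z tangent to the sphere is orthogonal to the image of the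
    differential of X. That differential is injective on the complement of c0, of dimension m - 1,
    which is the dimension of the tangent space as N = m; so z' = 0. *)
Lemma argopt_stationary z : N = m -> (forall c, dot c c = 1 -> dot z (X c) <= dot z x0) ->
  z = dot z x0 *: x0.
Proof.
move=> Nm zmax.
have [r [th [r0 [thp [lagth pos thC thD [th0 ths]]]]]] := lag_chart_smooth.
have Wo : open (W r) by exact: open_chart.
have pW : W r p by rewrite /= subrr normr0.
pose Pr : 'M[R]_((m + 1) + (N + 1), N) := col_mx 0 (col_mx 1%:M 0).
have PrE (t : VD) : t *m Pr = px t.
  rewrite -{1}[t]packK /pack /Pr !mul_row_col !mulmx0 mulmx1 addr0 add0r //.
(* The matrix of the differential at p of the x-component of the solution, completed
   on the line of c0. *)
pose G := embed *m invmx (lag_jac (th p)) *m Pr + c0^T *m x0.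
pose z' := z - dot z x0 *: x0.
have z'x : dot x0 z' = 0.
  by rewrite /z' dotBr dotZr dot_argopt mulr1 dotC subrr.
have key (w : Vm) (T : VD) : T = w *m (embed *m invmx (lag_jac (th p))) ->
    w *m G = px T + dot w c0 *: x0.
  move=> ->; rewrite /G mulmxDr -PrE !mulmxA; congr (_ + _).
  rewrite (_ : w *m c0^T = (dot w c0)%:M) ?mul_scalar_mx //.
  apply/rowP => j; rewrite ord1 !mxE eqxx mulr1n; apply: eq_bigr => k _.
  by rewrite mxE.
have stat (w : Vm) : dot (w *m G) z' = 0.
  have [T [TE TD TJ]] := thD p w pW.
  move: TJ; rewrite -[T in T *m _]packK {1}thp lag_jacE // => /pack_inj [e1 e2 e3 e4].
  have xz : dot x0 (px T) = 0 by apply/eqP; have /eqP := e4; rewrite mulf_eq0 pnatr_eq0.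
  rewrite (key w T TE) dotDl dotZl z'x mulr0 addr0 /z' dotBr dotZr (dotC (px T) x0) xz mulr0 subr0.
  have -> : dot (px T) z =
      'D_w (fun y => \sum_j th y 0 (rshift (m + 1) (lshift 1 j)) * z 0 j) p.
    rewrite (@derive_lincomb _ _ _ (fun j y => th y 0 (rshift (m + 1) (lshift 1 j)))).
      by apply: eq_bigr => j _; rewrite TD pxE.
    by move=> j; have [df _] := thC 1%N (rshift (m + 1) (lshift 1 j)); exact: df.
  have sumE y : \sum_j th y 0 (rshift (m + 1) (lshift 1 j)) * z 0 j = dot z (px (th y)).
    by rewrite dotC; apply: eq_bigr => j _; rewrite pxE.
  apply: (@derive_at_max _ _ _ p w r r0) => y yW.
    have : Ck (W r) 1 (fun y => \sum_j th y 0 (rshift (m + 1) (lshift 1 j)) * z 0 j).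
      by apply: Ck_sum => // j; apply: Ck_mul => //; exact: Ck_cst.
    by move=> [df _]; exact: df.
  rewrite !sumE thp pxK.
  move: (lagth y yW); rewrite -{1}[th y]packK lagE => /pack_inj [h1 h2 h3 h4].
  have cn0 : pc (th y) != 0.
    by apply/eqP => c_0; move: h2; rewrite c_0 dot0l => /eqP; rewrite eq_sym oner_eq0.
  have h3' : px (th y) *m pencil (pc (th y)) (pm (th y)) = vcomb (pc (th y)).
    by apply/eqP; rewrite -subr_eq0 h3.
  have [Xx _] := argopt_unique cn0 h4 h3' (pos y yW).
  have := zmax _ (unit_scale cn0).
  by rewrite (argoptZ _ cn0).1 ?invr_gt0 ?nrm_gt0 // Xx.
have Ginj (w : Vm) : w *m G = 0 -> w = 0.
  have [T [TE TD TJ]] := thD p w pW.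
  move: TJ; rewrite -[T in T *m _]packK {1}thp lag_jacE // => /pack_inj [e1 e2 e3 e4].
  have xz : dot x0 (px T) = 0 by apply/eqP; have /eqP := e4; rewrite mulf_eq0 pnatr_eq0.
  rewrite (key w T TE) => wG.
  have wc : dot w c0 = 0.
    have := congr1 (dot x0) wG; rewrite dotDr dotZr xz add0r dot_argopt mulr1 => ->.
    exact: dot0r.
  have pxT : px T = 0 by move: wG; rewrite wc scale0r addr0.
  have dq0 : dqmap A v x0 0 = 0 by apply/rowP => i; rewrite !mxE !dot0r subrr mulr0.
  move: e1; rewrite pxT dq0 add0r => e1.
  have := congr1 (dot c0) e1; rewrite dotZr c0S mulr1 dotC wc => sT.
  by rewrite -e1 sT scale0r.
have rankG : \rank G = m.
  apply/eqP; rewrite -[_ == _]/(row_free G) -kermx_eq0; apply/eqP/row_matrixP => i.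
  by rewrite row0; apply: Ginj; rewrite -row_mul mulmx_ker row0.
have Gz : G *m z'^T = 0.
  apply/matrixP => i j; rewrite ord1 [RHS]mxE; have := stat (delta_mx 0 i).
  by rewrite -rowE => <-; rewrite mxE; apply: eq_bigr => k _; rewrite !mxE.
have : \rank z'^T == 0%N.
  have := mulmx0_rank_max Gz; rewrite rankG; move: (\rank _) => k; lia.
rewrite mxrank_eq0 => /eqP z0; apply/eqP; rewrite -subr_eq0 -/z'.
by rewrite -[z']trmxK z0 trmx0.
Qed.

End Chart.

Lemma argopt_surj z : N = m -> dot z z = 1 -> exists2 c, dot c c = 1 & z = X c.
Proof.
move=> Nm zz.
have zl : lipb sphere (fun c => - dot z (X c)).
  by apply: lipb_opp; apply: lipb_dot => i; [exact: lipb_cst|exact: lipb_argopt_sphere].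
have [c0 c0S c0max] := lipb_min_attained (@compact_sphere R m) (sphere_nonempty R m_gt0) zl.
exists c0 => //.
have zmax c : dot c c = 1 -> dot z (X c) <= dot z (X c0).
  by move=> cc; have := c0max c cc; rewrite lerN2.
have zE := argopt_stationary c0S Nm zmax.
set a := dot z (X c0) in zE zmax.
have a2 : a ^+ 2 = 1 by rewrite expr2 -zz zE dotZl dotZr dot_argopt mulr1.
have : (a - 1) * (a + 1) = 0 by rewrite -subr_sqr_1 a2 subrr.
move=> /eqP; rewrite mulf_eq0 => /orP[|]; rewrite ?subr_eq0 ?addr_eq0 => /eqP a1.
  by rewrite zE a1 scale1r.
(* If the maximum of z . X is -1, then X is constantly -z; but (c . v) . X(c) > 0 both at c0 and at
   - c0, which is absurd. *)
have Xz c : dot c c = 1 -> X c = - z.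
  move=> cc; apply/eqP; rewrite -subr_eq0 opprK -dot_eq0 eq_le dot_ge0 andbT.
  rewrite !(dotDl, dotDr) dot_argopt zz (dotC (X c) z).
  by have := zmax c cc; rewrite a1; lra.
have c0S' : dot (- c0) (- c0) = 1 by rewrite dotNl dotNr opprK.
have h1 := dot_vcomb_argopt (sphere_neq0 c0S).
have h2 := dot_vcomb_argopt (sphere_neq0 c0S').
have vN : vcomb (- c0) = - vcomb c0 by rewrite -scaleN1r vcombZ scaleN1r.
move: h1 h2; rewrite (Xz _ c0S) (Xz _ c0S') vN dotNl => a0.
by rewrite oppr_gt0 => /(lt_trans a0); rewrite ltxx.
Qed.

(** * Geometry of the body and of the range *)

Lemma body_bounded : exists2 K, 0 <= K & forall y, body y -> `|y| <= K.
Proof.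
pose k i : R := `|supp (delta_mx 0 i)| + `|supp (- delta_mx 0 i)|.
have k0 : 0 <= \sum_i k i by apply: sumr_ge0 => i _; exact: addr_ge0.
exists (\sum_i k i) => // y yB; apply/rV_norm_le => // i.
have di : dot (delta_mx 0 i) y = y 0 i.
  rewrite /dot (bigD1 i) //= mxE !eqxx mul1r big1 ?addr0 // => j ji.
  by rewrite mxE (negPf ji) mul0r.
have h1 := yB (delta_mx 0 i); have h2 := yB (- delta_mx 0 i).
rewrite dotNl di in h2; rewrite di in h1.
apply: (@le_trans _ _ (k i)); last first.
  by rewrite (bigD1 i) //= lerDl; apply: sumr_ge0 => j _; exact: addr_ge0.
rewrite /k; move: (supp _) (supp _) h1 h2 => a b h1 h2.
have h3 := ler_norm (- a); have h4 := ler_norm (- b); rewrite !normrN in h3 h4.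
have h5 := normr_ge0 a; have h6 := normr_ge0 b.
by rewrite ler_norml; apply/andP; split; lra.
Qed.

Lemma compact_body : compact body.
Proof. by have [K K0 h] := body_bounded; exact: compact_box closed_body h. Qed.

Lemma convex_body : @convex_set R 'rV[R]_m body.
Proof.
apply/convex_setP => x y a a0 a1 xB yB c; rewrite dotDr !dotZr.
have -> : supp c = a * supp c + (1 - a) * supp c by ring.
by rewrite lerD // ler_wpM2l ?subr_ge0.
Qed.

Lemma supports_body c q : supports body c q -> dot c c = 1 /\ q = qmap (X c).
Proof.
move=> [cc qB h]; split=> //; apply: body_touch => //; first exact: sphere_neq0.
by apply/eqP; rewrite eq_le qB andbT; apply: h; apply: qmap_body; exact: dot_argopt.
Qed.

Lemma strictly_convex_body : strictly_convex body.
Proof.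
split; [exact: compact_body|exact: convex_body|move=> c q cq].
have [cc qE] := supports_body cq; have [_ qB _] := cq.
apply/seteqP; split=> y /=; last by move=> ->.
move=> [yB yq]; rewrite qE; apply: body_touch => //; first exact: sphere_neq0.
by rewrite yq qE.
Qed.

Lemma smooth_boundary_body : smooth_boundary body.
Proof.
move=> q qF; have [c cS qE] : exists2 c, sphere c & q = qmap (X c).
  by move: qF; rewrite frontier_body.
have [r [g [r0 [gC gB Dg _ _]]]] := boundary_chart cS.
exists [set y | `|y - q| < r], g; rewrite qE; split.
- exact: open_chart.
- by rewrite /= subrr normr0.
- exact: Ck_smooth_on.
- by exists c; rewrite Dg oner_neq0.
- by apply/seteqP; split=> y [h yW]; split=> //; [exact: (gB y yW).1|exact: (gB y yW).2].
Qed.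

Lemma strongly_convex_body : strongly_convex body.
Proof.
split; first exact: strictly_convex_body.
move=> c q /supports_body [cc qE].
have [r [g [r0 [gC gB Dg DDg gshift]]]] := boundary_chart cc.
rewrite -qE in gC gB Dg DDg gshift.
(* As g grows at unit rate along c, the point q + u + s c is on the boundary exactly when s = - g (q
   + u), as long as both points are in the chart. *)
pose h u : R := -1 * g (q + u).
have W'o : open [set u : Vm | `|q + u - q| < r].
  rewrite (_ : mkset _ = [set u : Vm | `|u - 0| < r]); first exact: open_norm_ball.
  by apply/seteqP; split=> u /=; rewrite [q + u]addrC addrK subr0.
have hC k : Ck [set u : Vm | `|q + u - q| < r] k h.
  by apply: Ck_mul => //; [exact: Ck_cst|exact: (Ck_shift q (gC k))].
have W'0 : [set u : Vm | `|q + u - q| < r] 0 by rewrite /= addr0 subrr normr0.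
(* Projection along c onto the supporting hyperplane enlarges the maximum norm by at most the factor
   m + 1, so it maps this smaller ball into the chart. *)
pose r' := r / (m%:R + 1).
have m1 : 0 < m%:R + 1 :> R by rewrite ltr_wpDl.
have r'0 : 0 < r' by rewrite divr_gt0.
have proj y : `|y - q| < r' -> `|(y - q) - dot c (y - q) *: c| < r.
  rewrite /r' ltr_pdivlMr // => yr; apply: le_lt_trans yr.
  apply: le_trans (ler_normB _ _) _; rewrite mulrDr mulr1 addrC lerD2r normrZ.
  have c1 : `|c| <= 1 by exact: sphere_norm_le.
  have h1 : `|dot c (y - q)| <= m%:R * `|y - q|.
    by apply: le_trans (normr_dot_le _ _) _; rewrite {1}/nrm cc sqrtr1 mul1r nrm_le_norm.
  by rewrite -[leRHS]mulr1 ler_pM // mulrC.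
have r'r : r' <= r by rewrite /r' ler_pdivrMr //; apply: ler_peMr; [exact: ltW|rewrite lerDr].
exists [set y | `|y - q| < r'], h; split.
- exact: open_norm_ball.
- by rewrite /= subrr normr0.
- split.
    apply: filterS (open_nbhs_nbhs (conj W'o W'0)) => u uW.
    by have [dh _] := hC 1%N; exact: dh.
  by move=> u; have [_ /(_ u) [dh _]] := hC 2%N; exact: dh.
- apply/seteqP; split=> y /= [yF yU]; split=> //.
    pose s := dot c (y - q); exists ((y - q) - s *: c).
      by rewrite /= dotBr dotZr cc mulr1 subrr.
    have yW : `|y - q| < r by exact: lt_le_trans r'r.
    have uW : `|q + ((y - q) - s *: c) - q| < r.
      by rewrite [q + _]addrC addrK; exact: proj.
    have yE : y = q + ((y - q) - s *: c) + s *: c.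
      by apply/rowP => j; rewrite !mxE; ring.
    have := (gB y yW).1 yF; rewrite {1}yE gshift //; last by rewrite -yE.
    move=> gy; have -> : h (y - q - s *: c) = s by rewrite /h; lra.
    by rewrite -yE.
  case: yF => u uc yE.
  have sE : dot c (y - q) = h u.
    rewrite -yE (_ : _ - q = u + h u *: c); last by apply/rowP => j; rewrite !mxE; ring.
    by rewrite dotDr dotZr uc cc mulr1 add0r.
  have yW : `|y - q| < r by exact: lt_le_trans r'r.
  have uE : u = (y - q) - dot c (y - q) *: c.
    by rewrite sE -yE; apply/rowP => j; rewrite !mxE; ring.
  have uW : `|q + u - q| < r by rewrite [q + _]addrC addrK uE; exact: proj.
  apply: (gB y yW).2; rewrite -yE gshift //; last by rewrite yE.
  by rewrite /h; ring.
move=> u uc u0.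
have gtC k : Ck [set u : Vm | `|q + u - q| < r] k (fun u => g (q + u)).
  exact: (Ck_shift q (gC k)).
have DhE : \forall x \near (0 : Vm), 'D_u h x = -1 * 'D_u g (q + x).
  apply: filterS (open_nbhs_nbhs (conj W'o W'0)) => x xW.
  rewrite /h deriveMl ?derive_translate //.
  by apply: diff_derivable; have [dg _] := gtC 1%N; exact: dg.
have tE : (fun y => 'D_u g (q + y)) = 'D_u (fun y => g (q + y)).
  by apply/funext => y; rewrite derive_translate.
have dd : derivable ('D_u (fun y => g (q + y))) 0 u.
  by apply: diff_derivable; have [_ /(_ u) [dg _]] := gtC 2%N; exact: dg.
have -> : 'D_u ('D_u h) 0 = - 'D_u ('D_u g) q.
  rewrite (near_eq_derive _ DhE) (_ : (fun y => _) = -1 \*o 'D_u (fun y => g (q + y))).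
    by rewrite deriveMl // -tE (derive_translate ('D_u g)) addr0 mulN1r.
  by apply/funext => y; rewrite /= derive_translate.
by rewrite oppr_gt0; exact: DDg.
Qed.

(** Take the point of the body on the line y + R d that is farthest in the direction d. It is not
    interior, so by [body_strict_interior] some support inequality is an equality there. *)
Lemma body_exit d y : d != 0 -> body y -> exists t, [/\ 0 <= t, body (y + t *: d) &
  exists2 c, dot c c = 1 & dot c (y + t *: d) = supp c].
Proof.
move=> d0 yB; have dd := dot_gt0 d0.
(* The line through y along d as a closed set: z - y equals its orthogonal projection on d, cleared
   of the denominator d . d. *)
pose S := body `&` \bigcap_j [set z : Vm | (z 0 j - y 0 j) * dot d d - dot d (z - y) * d 0 j = 0].
have Scl : closed S.
  apply: closedI; first exact: closed_body.
  apply: closed_bigI => j _; apply: closed_eq_fun; apply: lipb_ball_continuous => r r0.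
  have cl k : lipb [set z : Vm | `|z| <= r] (fun z : Vm => z 0 k) by exact: lipb_ball_coord.
  apply: lipb_sub; apply: lipb_mul; try exact: lipb_cst.
    by apply: lipb_sub => //; exact: lipb_cst.
  apply: lipb_dot => k; first exact: lipb_cst.
  rewrite (_ : (fun z : Vm => _) = fun z : Vm => z 0 k - y 0 k); last first.
    by apply/funext => z; rewrite !mxE.
  by apply: lipb_sub => //; exact: lipb_cst.
have [K K0 KB] := body_bounded.
have SK (z : Vm) : S z -> `|z| <= K by move=> [/KB].
have Scpt : compact S by exact: compact_box Scl SK.
have onS t : body (y + t *: d) -> S (y + t *: d).
  move=> tB; split=> // j _ /=; rewrite addrAC subrr add0r !mxE dotZr; ring.
have Sy : S y by have := onS 0; rewrite scale0r addr0; apply.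
have Sl : lipb S (fun z : Vm => - dot d z).
  apply: lipb_opp; apply: lipb_dot => i; first exact: lipb_cst.
  exact: lipb_coord SK K0.
have [z [zB zline] zmin] := lipb_min_attained Scpt (ex_intro _ y Sy) Sl.
pose t := dot d (z - y) / dot d d.
have zE : z = y + t *: d.
  apply/rowP => j; rewrite !mxE; apply/eqP; rewrite -subr_eq0 opprD addrA; apply/eqP.
  apply: (@mulIf _ (dot d d)); first by rewrite gt_eqF.
  rewrite mul0r -[RHS](zline j I) /t; field; rewrite gt_eqF //.
have t0 : 0 <= t.
  by have := zmin y Sy; rewrite lerN2 /t => h; rewrite divr_ge0 ?(ltW dd) // dotBr subr_ge0.
exists t; rewrite -zE; split=> //; apply: contrapT => no.
have : (body°) z.
  apply: body_strict_interior => c cS; rewrite lt_neqAle zB andbT; apply/negP => /eqP e.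
  by apply: no; exists c.
move=> /interior_normP [e e_gt0 he].
have nd : 0 < `|d| + 1 by rewrite ltr_wpDl.
pose s := e / (`|d| + 1) / 2.
have s0 : 0 < s by rewrite !divr_gt0.
have sB : body (y + (t + s) *: d).
  rewrite scalerDl addrA -zE; apply: he; rewrite opprD addrA subrr add0r normrN normrZ gtr0_norm //.
  have : s * (`|d| + 1) = e / 2 by rewrite /s; field; rewrite gt_eqF.
  lra.
have := zmin _ (onS _ sB); rewrite lerN2 zE !dotDr !dotZr lerD2l ler_pM2r //.
by rewrite leNgt ltrDl s0.
Qed.

Lemma qrange_argopt : N = m -> qrange = [set y | exists2 c, sphere c & y = qmap (X c)].
Proof.
move=> Nm; apply/seteqP; split=> y /=.
  by move=> [z zS <-]; have [c cc ->] := argopt_surj Nm zS; exists c.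
by move=> [c cS ->]; exists (X c) => //; exact: argopt_sphere.
Qed.

(** Any line through a point of the body leaves it, on both sides, at points where a support
    inequality is an equality. Such points belong to the range, so the given point lies on a chord
    of the range. *)
Lemma hull_body : N = m -> conv_hull qrange = body.
Proof.
move=> Nm; apply/seteqP; split.
  apply: smallest_sub; first exact: convex_body.
  by move=> _ [z zS <-]; exact: qmap_body.
move=> y yB C [Cconv rC].
have touchC c q : dot c c = 1 -> body q -> dot c q = supp c -> C q.
  move=> cc qB cq; apply: rC; rewrite qrange_argopt //; exists c => //.
  by apply: body_touch => //; exact: sphere_neq0.
pose d : Vm := delta_mx 0 (Ordinal m_gt0).
have d0 : d != 0.
  apply/eqP => /rowP /(_ (Ordinal m_gt0)); rewrite !mxE !eqxx /= => /eqP.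
  by rewrite oner_eq0.
have [t1 [t10 t1B [c1 c1c t1E]]] := body_exit d0 yB.
have d0' : - d != 0 by rewrite oppr_eq0.
have [t2 [t20 t2B [c2 c2c t2E]]] := body_exit d0' yB.
have C1 := touchC _ _ c1c t1B t1E; have C2 := touchC _ _ c2c t2B t2E.
have [t12|t12] := eqVneq (t1 + t2) 0.
  have t1z : t1 = 0 by lra.
  by move: C1; rewrite t1z scale0r addr0.
have tp : 0 < t1 + t2 by rewrite lt_neqAle eq_sym t12 addr_ge0.
have a0 : 0 <= t2 / (t1 + t2) by rewrite divr_ge0 // ltW.
have a1 : t2 / (t1 + t2) <= 1 by rewrite ler_pdivrMr // mul1r lerDr.
have := (convex_setP C).1 Cconv _ _ _ a0 a1 C1 C2; congr (C _).
by apply/rowP => j; rewrite !mxE; field.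
Qed.

Lemma qrange_frontier_hull : N = m -> qrange = frontier (conv_hull qrange).
Proof. by move=> Nm; rewrite hull_body // frontier_body qrange_argopt. Qed.

Lemma qrange_body : (m < N)%N -> qrange = body.
Proof.
move=> mN; apply/seteqP; split; last exact: body_sub_qrange.
by move=> _ [z zS <-]; exact: qmap_body.
Qed.

Lemma qrange_geometry :
  ((m < N)%N -> strongly_convex qrange /\ smooth_boundary qrange) /\
  (N = m -> qrange = frontier (conv_hull qrange)).
Proof.
split=> [mN|]; last exact: qrange_frontier_hull.
by rewrite qrange_body //; split; [exact: strongly_convex_body|exact: smooth_boundary_body].
Qed.

End RealSystem.

(** * Reduction to real scalars *)

Section Scalars.
Variables (R : realType) (k : scalar_kind).
Local Notation K := (scalar_field R k).
Local Notation rho := (of_real k : R -> K).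

Lemma of_realD : {morph rho : x y / x + y}.
Proof. by case: k => //= x y; rewrite rmorphD. Qed.

Lemma of_realB : {morph rho : x y / x - y}.
Proof. by case: k => //= x y; rewrite rmorphB. Qed.

Lemma of_real_inj : injective rho.
Proof. by case: k => //= x y; exact: complexI. Qed.

Lemma adjointD p q (M P : 'M[K]_(p, q)) : adjoint (M + P) = adjoint M + adjoint P.
Proof.
rewrite /adjoint; case: k M P => /= M P; last by rewrite map_mxD linearD.
by apply/matrixP => i j; rewrite !mxE.
Qed.

Lemma adjointM p q r (M : 'M[K]_(p, q)) (P : 'M[K]_(q, r)) :
  adjoint (M *m P) = adjoint P *m adjoint M.
Proof.
rewrite /adjoint; case: k M P => /= M P; last by rewrite map_mxM trmx_mul.
by rewrite -trmx_mul; congr trmx; apply/matrixP => i j; rewrite !mxE; apply: eq_bigr => l _; rewrite !mxE.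
Qed.

Lemma adjointK p q (M : 'M[K]_(p, q)) : adjoint (adjoint M) = M.
Proof.
rewrite /adjoint; case: k M => /= M; apply/matrixP => i j; rewrite !mxE //.
exact: conjcK.
Qed.

Lemma adjointZ p q r (M : 'M[K]_(p, q)) : adjoint (rho r *: M) = rho r *: adjoint M.
Proof.
rewrite /adjoint; case: k M => /= M; apply/matrixP => i j; rewrite !mxE //.
by rewrite rmorphM /= oppr0.
Qed.

End Scalars.

Lemma inf_eq_min (R : realType) (S : set R) a : S a -> lbound S a -> inf S = a.
Proof.
move=> Sa aS; apply/eqP; rewrite eq_le lb_le_inf //; last by exists a.
by rewrite ge_inf //; exists a.
Qed.

(* A realification of K^n: row vectors over R multiplied on the right by the
   real matrix [Phi B] represent column vectors over K multiplied by [B]. *)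
Section Realification.
Variables (R : realType) (k : scalar_kind) (m n N : nat).
Local Notation K := (scalar_field R k).
Local Notation rho := (of_real k : R -> K).
Variables (z : 'cV[K]_n -> 'rV[R]_N) (Phi : 'M[K]_n -> 'M[R]_N).
Hypothesis z_bij : bijective z.
Hypothesis zD : {morph z : x y / x + y}.
Hypothesis zZ : forall r x, z (rho r *: x) = r *: z x.
Hypothesis zM : forall B x, z (B *m x) = z x *m Phi B.
(** Adding the conjugate product yields twice the real part, which states the compatibility of the
    inner products for both kinds of scalars at once. *)
Hypothesis z_ip : forall x y,
  (adjoint x *m y) 0 0 + (adjoint y *m x) 0 0 = rho (2 * dot (z x) (z y)).
Hypothesis z_enorm : forall x, enorm x ^+ 2 = dot (z x) (z x).

Let z0 : z 0 = 0.
Proof. by apply: (addrI (z 0)); rewrite -zD !addr0. Qed.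

Let z_sum I (s : seq I) (F : I -> 'cV[K]_n) : z (\sum_(i <- s) F i) = \sum_(i <- s) z (F i).
Proof. exact: (big_morph z zD z0). Qed.

Let eq_on_z (M P : 'M[R]_N) : (forall x, z x *m M = z x *m P) -> M = P.
Proof.
move=> h; apply/row_matrixP => i; rewrite !rowE.
by have [y _ yK] := z_bij; rewrite -[delta_mx 0 i]yK.
Qed.

Lemma of_real_half (a : K) r : a + a = rho (2 * r) -> a = rho r.
Proof.
have -> : 2 * r = r + r by ring.
rewrite of_realD -[a + a](@mulr2n K) -[rho r + _](@mulr2n K) => h.
have : (a - rho r) *+ 2 == 0 by rewrite mulrnBl h subrr.
by rewrite mulrn_eq0 /= subr_eq0 => /eqP.
Qed.

Lemma herm_form (B : 'M[K]_n) x : adjoint B = B ->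
  (adjoint x *m B *m x) 0 0 = rho (dot (z x *m Phi B) (z x)).
Proof.
move=> Bh; apply: of_real_half; rewrite dotC -zM -z_ip; congr (_ + _).
  by rewrite mulmxA.
by rewrite adjointM Bh.
Qed.

Lemma Phi_sym (B : 'M[K]_n) : adjoint B = B -> (Phi B)^T = Phi B.
Proof.
move=> Bh.
have sym x y : dot (z x *m Phi B) (z y) = dot (z x) (z y *m Phi B).
  rewrite -!zM; apply: (@mulfI _ (2 : R)); first by rewrite pnatr_eq0.
  apply: (@of_real_inj R k); rewrite -!z_ip; congr (_ + _).
    by rewrite adjointM Bh mulmxA.
  by rewrite adjointM Bh mulmxA.
apply: eq_on_z => x; apply/eqP; rewrite -subr_eq0 -dot_eq0; apply/eqP.
set u := _ - _; have [y _ yK] := z_bij.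
by rewrite {1}/u dotBl dotMl trmxK -[u]yK sym subrr.
Qed.

Section Family.
Variables (A : 'I_m -> 'M[K]_n) (v : 'I_m -> 'cV[K]_n).
Hypothesis Ah : forall i, adjoint (A i) = A i.

Lemma Phi_comb c : Phi (comb_mx A c) = mcomb (fun i => Phi (A i)) c.
Proof.
apply: eq_on_z => x; rewrite -zM /comb_mx mulmx_suml z_sum /mcomb mulmx_sumr.
by apply: eq_bigr => i _; rewrite -scalemxAl zZ zM scalemxAr.
Qed.

Lemma z_comb c : z (comb_vec v c) = vcomb (fun i => z (v i)) c.
Proof. by rewrite /comb_vec z_sum; apply: eq_bigr => i _; rewrite zZ. Qed.

Lemma comb_mx_herm c : adjoint (comb_mx A c) = comb_mx A c.
Proof.
rewrite /comb_mx (big_morph _ (@adjointD R k n n) (_ : adjoint 0 = 0)).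
  by apply: eq_bigr => i _; rewrite adjointZ Ah.
by apply: (addrI (adjoint 0)); rewrite -adjointD !addr0.
Qed.

Lemma quadE i x : quad A v i x = rho (qmap (fun i => Phi (A i)) (fun i => z (v i)) (z x) 0 i).
Proof.
have ent (P Q S : 'M[K]_1) : (P - Q - S) 0 0 = P 0 0 - (Q 0 0 + S 0 0).
  by rewrite 4!mxE opprD addrA.
by rewrite mxE of_realB -herm_form // -z_ip /quad ent.
Qed.

Lemma joint_rangeE :
  joint_range A v = qrange (fun i => Phi (A i)) (fun i => z (v i)).
Proof.
apply/seteqP; split=> y /=.
  move=> [x [x1 xy]]; exists (z x); first by rewrite /sphere /= -z_enorm.
  by apply/rowP => i; apply: (@of_real_inj R k); rewrite xy quadE.
move=> [u u1 <-]; have [zi _ ziK] := z_bij; exists (zi u).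
by split=> [|i]; [rewrite z_enorm ziK|rewrite quadE ziK].
Qed.

Hypothesis N_gt0 : (0 < N)%N.

(** The minimum of the real form on the sphere is attained at an eigenvector, which pulls back to
    one of B; every real eigenvalue of B is at least this minimum. So the infimum in [lambda_min] is
    attained and equals it. *)
Lemma lambda_min_rayleigh (B : 'M[K]_n) : adjoint B = B ->
  forall u, lambda_min B * dot u u <= dot (u *m Phi B) u.
Proof.
move=> Bh; have Psym := Phi_sym Bh.
have cl i : lipb (@sphere R N) (fun u => u 0 i).
  by apply: (lipb_coord i (r := 1)) => // u; exact: sphere_norm_le.
have lQ : lipb (@sphere R N) (fun u => dot (u *m Phi B) u).
  by apply: lipb_dot => // i; exact: lipb_mulmx.
have [u0 u0S umin] := lipb_min_attained (@compact_sphere R N) (sphere_nonempty R N_gt0) lQ.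
pose lam := dot (u0 *m Phi B) u0.
have Q u : lam * dot u u <= dot (u *m Phi B) u.
  have [->|un0] := eqVneq u 0; first by rewrite mul0mx !dot0l mulr0.
  have := umin _ (unit_scale un0); rewrite -scalemxAl dotZl dotZr -/lam => h.
  have up := nrm_gt0 un0; rewrite -nrm_sqr.
  have -> : dot (u *m Phi B) u = nrm u ^+ 2 * ((nrm u)^-1 * ((nrm u)^-1 * dot (u *m Phi B) u)).
    by field; rewrite gt_eqF.
  by rewrite mulrC ler_wpM2l // sqr_ge0.
have [zi zK ziK] := z_bij.
have crit w : 0 <= dot (u0 *m Phi B - lam *: u0) w.
  apply: (@le0_of_quadratic _ _ (dot (w *m Phi B) w - lam * dot w w)) => t _ _.
  have := Q (u0 + t *: w); rewrite mulmxDl -scalemxAl.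
  have -> : dot (u0 *m Phi B + t *: (w *m Phi B)) (u0 + t *: w) =
     lam + 2 * t * dot (u0 *m Phi B) w + t ^+ 2 * dot (w *m Phi B) w.
    rewrite !(dotDl, dotDr, dotZl, dotZr) -/lam.
    by rewrite [dot (w *m _) u0]dotMl Psym [dot w _]dotC; ring.
  have -> : dot (u0 + t *: w) (u0 + t *: w) = 1 + 2 * t * dot u0 w + t ^+ 2 * dot w w.
    by rewrite !(dotDl, dotDr, dotZl, dotZr) (u0S : dot u0 u0 = 1) [dot w u0]dotC; ring.
  by rewrite dotBl dotZl; lra.
have eig : u0 *m Phi B = lam *: u0.
  apply/eqP; rewrite -subr_eq0 -dot_eq0 eq_le dot_ge0 andbT.
  by have := crit (- (u0 *m Phi B - lam *: u0)); rewrite dotNr oppr_ge0.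
suff -> : lambda_min B = lam by [].
apply: inf_eq_min => [|r /= /eigenvalueP [w wB w0]].
  (* [eigenvalue] refers to left eigenvectors, hence the adjoint; B is hermitian. *)
  apply/eigenvalueP; exists (adjoint (zi u0)).
    rewrite -{1}Bh -adjointM -adjointZ; congr adjoint.
    by apply: (bij_inj z_bij); rewrite zM zZ ziK eig.
  apply/eqP => /(congr1 (@adjoint R k 1 n)); rewrite adjointK => x0.
  have := u0S; rewrite /sphere /= -[u0]ziK x0.
  have -> : adjoint (0 : 'rV[K]_n) = 0.
    by apply: (addrI (adjoint 0)); rewrite -adjointD !addr0.
  by rewrite z0 dot0l => /esym/eqP; rewrite oner_eq0.
have wE : B *m adjoint w = rho r *: adjoint w.
  by rewrite -{1}Bh -adjointM wB adjointZ.
have zw0 : z (adjoint w) != 0.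
  apply: contra_neq w0 => zw; rewrite -[w]adjointK.
  have -> : adjoint w = 0 by apply: (bij_inj z_bij); rewrite zw z0.
  by apply: (addrI (adjoint 0)); rewrite -adjointD !addr0.
have := Q (z (adjoint w)); rewrite -zM wE zZ dotZl ler_pM2r //; exact: dot_gt0.
Qed.

Lemma resolvent_coercive e : 0 < e -> 1 < min_resolvent_norm A v e ->
  forall c, dot c c = 1 -> exists lam w,
  [/\ forall u, lam * dot u u <= dot (u *m mcomb (fun i => Phi (A i)) c) u,
      w *m pencil (fun i => Phi (A i)) c (e - lam) = vcomb (fun i => z (v i)) c
    & 1 < dot w w].
Proof.
move=> e0 minl c cc; pose lam := lambda_min (comb_mx A c).
pose M := comb_mx A c + (rho (e - lam))%:M.
pose x := invmx M *m comb_vec v c.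
have Q u : lam * dot u u <= dot (u *m mcomb (fun i => Phi (A i)) c) u.
  by rewrite -Phi_comb; apply: lambda_min_rayleigh; exact: comb_mx_herm.
have zMx y : z (M *m y) = z y *m pencil (fun i => Phi (A i)) c (e - lam).
  rewrite mulmxDl mul_scalar_mx zD zM zZ Phi_comb mul_pencil //.
(* [invmx] returns a singular matrix unchanged, so invertibility has to be checked: the Rayleigh
   bound makes the real form of M at least e. *)
have Mu : M \in unitmx.
  rewrite -unitmx_tr; apply: unitmx_inj => u uM.
  have Mu0 : M *m u^T = 0 by apply: trmx_inj; rewrite trmx_mul trmxK uM trmx0.
  have := zMx u^T; rewrite Mu0 z0 mul_pencil => h.
  have := congr1 (fun y => dot y (z u^T)) h; rewrite dot0l dotDl dotZl => h1.
  have h2 := Q (z u^T).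
  have h3 : e * dot (z u^T) (z u^T) <= 0 by lra.
  have h4 : dot (z u^T) (z u^T) = 0.
    by apply/eqP; rewrite eq_le dot_ge0 andbT; rewrite pmulr_rle0 in h3.
  have : u^T = 0 by apply: (bij_inj z_bij); rewrite z0; apply/eqP; rewrite -dot_eq0; apply/eqP.
  by move/(congr1 trmx); rewrite trmxK trmx0.
exists lam, (z x); split=> //.
  by rewrite -zMx mulmxA mulmxV // mul1mx z_comb.
rewrite -z_enorm; apply: exprn_egt1 => //; apply: lt_le_trans minl _.
apply: ge_inf; last by exists c.
by exists 0 => _ [d _ <-]; exact: sqrtr_ge0.
Qed.

End Family.

Lemma realified_main (A : 'I_m -> 'M[K]_n) (v : 'I_m -> 'cV[K]_n) (l : \bar R) :
  (0 < m)%N -> (forall i, adjoint (A i) = A i) ->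
  (min_resolvent_norm A v e)%:E @[e --> 0^'+] --> l -> (1 < l)%E ->
  ((m < N)%N -> strongly_convex (joint_range A v) /\ smooth_boundary (joint_range A v)) /\
  (N = m -> joint_range A v = frontier (conv_hull (joint_range A v))).
Proof.
move=> m0 Ah cvl l1.
have [N0|N0] := posnP N.
  by split=> [|h]; [rewrite {1}N0|by have := m0; rewrite -{1}h N0].
(* The limit, finite or not, serves only to provide one positive e whose minimum exceeds 1. *)
have [e [e0 e1]] : exists e : R, 0 < e /\ 1 < min_resolvent_norm A v e.
  have h1 : \forall e \near (0 : R)^'+, (1 < (min_resolvent_norm A v e)%:E)%E.
    exact: (cvl [set y : \bar R | (1 < y)%E] (open_ereal_gt' l1)).
  have h2 : \forall e \near (0 : R)^'+, 0 < e by exact: nbhs_right_gt.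
  have [e [he1 he2]] := @filter_ex _ _ (at_right_proper_filter 0) _ (filterI h1 h2).
  by exists e; split=> //; move: he1; rewrite lte_fin.
rewrite joint_rangeE //; apply: (@qrange_geometry _ _ _ _ _ _ e e0 m0).
  by move=> i; exact: Phi_sym.
exact: resolvent_coercive.
Qed.

End Realification.

(** * The real and the complex realification *)

Section RealCase.
Variables (R : realType) (n : nat).
Local Notation K := (scalar_field R RealScalars).

Lemma real_ip (x y : 'cV[K]_n) : (adjoint x *m y) 0 0 = dot (x^T : 'rV[R]_n) (y^T : 'rV[R]_n).
Proof. by rewrite mxE; apply: eq_bigr => i _; rewrite !mxE. Qed.

Lemma real_enorm (x : 'cV[K]_n) : enorm x ^+ 2 = dot (x^T : 'rV[R]_n) (x^T : 'rV[R]_n).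
Proof.
rewrite /enorm sqr_sqrtr; last by apply: sumr_ge0 => i _; exact: sqr_ge0.
by apply: eq_bigr => i _; rewrite /= !mxE real_normK ?num_real // expr2.
Qed.

End RealCase.

Section ComplexCase.
Variables (R : realType) (n : nat).
Local Notation K := (scalar_field R ComplexScalars).

Definition realify (x : 'cV[K]_n) : 'rV[R]_(n + n) :=
  row_mx (\row_j complex.Re (x j 0)) (\row_j complex.Im (x j 0)).

(** The transpose of the usual real form of B with rows (Re, -Im) and (Im, Re), since vectors are
    rows here. *)
Definition realify_mx (B : 'M[K]_n) : 'M[R]_(n + n) :=
  block_mx (\matrix_(i, j) complex.Re (B j i)) (\matrix_(i, j) complex.Im (B j i))
    (\matrix_(i, j) - complex.Im (B j i)) (\matrix_(i, j) complex.Re (B j i)).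

Lemma realify_bij : bijective realify.
Proof.
exists (fun u => \col_j (lsubmx u 0 j +i* rsubmx u 0 j)%C) => x.
  by apply/colP => j; rewrite /realify row_mxKl row_mxKr !mxE; case: (x j 0).
by rewrite -[RHS]hsubmxK; congr row_mx; apply/rowP => j; rewrite !mxE.
Qed.

Lemma realifyD : {morph realify : x y / x + y}.
Proof.
move=> x y; rewrite /realify add_row_mx; congr row_mx; apply/rowP => j; rewrite !mxE.
  by case: (x j 0) (y j 0) => ? ? [].
by case: (x j 0) (y j 0) => ? ? [].
Qed.

Lemma realifyZ r x : realify (of_real ComplexScalars r *: x) = r *: realify x.
Proof.
rewrite /realify scale_row_mx; congr row_mx; apply/rowP => j; rewrite !mxE /=.
  by case: (x j 0) => a b; rewrite /= mul0r subr0.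
by case: (x j 0) => a b; rewrite /= mul0r addr0.
Qed.

Lemma Re_sum I (s : seq I) (F : I -> R[i]) :
  complex.Re (\sum_(i <- s) F i) = \sum_(i <- s) complex.Re (F i).
Proof. by apply: (big_morph _ _ (erefl _)) => [[? ?] [? ?]]. Qed.

Lemma Im_sum I (s : seq I) (F : I -> R[i]) :
  complex.Im (\sum_(i <- s) F i) = \sum_(i <- s) complex.Im (F i).
Proof. by apply: (big_morph _ _ (erefl _)) => [[? ?] [? ?]]. Qed.

Lemma realifyM B x : realify (B *m x) = realify x *m realify_mx B.
Proof.
rewrite /realify /realify_mx mul_row_block; congr row_mx; apply/rowP => j; rewrite !mxE.
  rewrite Re_sum -big_split; apply: eq_bigr => i _; rewrite !mxE /=.
  by case: (B j i) (x i 0) => [? ?] [? ?] /=; ring.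
rewrite Im_sum -big_split; apply: eq_bigr => i _; rewrite !mxE /=.
by case: (B j i) (x i 0) => [? ?] [? ?] /=; ring.
Qed.

Lemma dot_realify x y : dot (realify x) (realify y) =
  \sum_i (complex.Re (x i 0) * complex.Re (y i 0) + complex.Im (x i 0) * complex.Im (y i 0)).
Proof.
rewrite /dot big_split_ord big_split; congr (_ + _); apply: eq_bigr => i _.
  by rewrite !row_mxEl !mxE.
by rewrite !row_mxEr !mxE.
Qed.

Lemma realify_ip x y : (adjoint x *m y) 0 0 + (adjoint y *m x) 0 0 =
  of_real ComplexScalars (2 * dot (realify x) (realify y)).
Proof.
rewrite dot_realify mulr_sumr /= (rmorph_sum (real_complex R)) !mxE -big_split; apply: eq_bigr => i _.
rewrite !mxE /=; case: (x i 0) (y i 0) => [a b] [c d] /=.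
by apply/eqP; rewrite eq_complex /=; apply/andP; split; apply/eqP; ring.
Qed.

Lemma realify_enorm x : enorm x ^+ 2 = dot (realify x) (realify x).
Proof.
rewrite dot_realify /enorm sqr_sqrtr; last by apply: sumr_ge0 => i _; exact: sqr_ge0.
apply: eq_bigr => i _.
have normE (w : R[i]) : complex.Re `|w| ^+ 2 =
    complex.Re w * complex.Re w + complex.Im w * complex.Im w.
  by rewrite normc_def /= sqr_sqrtr ?addr_ge0 ?sqr_ge0 // !expr2.
exact: normE (x i 0).
Qed.

End ComplexCase.

Theorem proposition3 (R : realType) (k : scalar_kind) (m n : nat)
    (A : 'I_m -> 'M[scalar_field R k]_n) (v : 'I_m -> 'cV[scalar_field R k]_n)
    (l : \bar R) :
  (0 < m)%N ->
  (forall i, adjoint (A i) = A i) ->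
  (min_resolvent_norm A v e)%:E @[e --> 0^'+] --> l ->
  (1 < l)%E ->
  ((m < scalar_dim k * n)%N ->
     strongly_convex (joint_range A v) /\ smooth_boundary (joint_range A v)) /\
  ((scalar_dim k * n)%N = m ->
     joint_range A v = frontier (conv_hull (joint_range A v))).
Proof.
case: k A v => A v.
  rewrite mul1n.
  apply: (@realified_main R RealScalars m n n (fun x => x^T) (fun B => B^T)).
  - by exists trmx => x; exact: trmxK.
  - by move=> x y; rewrite linearD.
  - by move=> r x; rewrite linearZ.
  - by move=> B x; rewrite trmx_mul.
  - by move=> x y; rewrite !real_ip (dotC y^T) /=; ring.
  - exact: real_enorm.
rewrite mul2n -addnn.
apply: (@realified_main R ComplexScalars m n (n + n) (@realify R n) (@realify_mx R n)).
- exact: realify_bij.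
- exact: realifyD.
- exact: realifyZ.
- exact: realifyM.
- exact: realify_ip.
- exact: realify_enorm.
Qed.
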